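(* Let $f:M\to M$ be a $C^{r}$ ($r>1$) map on a compact Riemannian manifold $M$, and let $\bar\eta=\{\eta_m\}_{m\ge1}$ be any sequence of positive real numbers converging to $0$. Then the folding entropy $\mu\mapsto F_f(\mu)$ is upper semi-continuous on $\mathcal P_{\bar\eta}(f)$ (endowed with the weak$^*$ topology).
   Context: $\mathcal P(M)$ is the set of Borel probability measures on $M$ with the weak$^*$ topology. Folding entropy: let $\epsilon=\{\{x\}\}_{x\in M}$ be the partition into points and $f^{-1}\epsilon=\{f^{-1}\{x\}\}_{x\in M}$ the partition into preimage sets. For $\mu\in\mathcal P(M)$, the folding entropy is the conditional entropy $F_f(\mu)=H_\mu(\epsilon\mid f^{-1}\epsilon)=\int_M H_{\tilde\mu_x}(\epsilon)\,d(f\mu)(x)$, where $f\mu=\mu\circ f^{-1}$ is the image measure, $\{\tilde\mu_x\}$ is the disintegration (system of conditional probability measures) of $\mu$ along the sets $f^{-1}\{x\}$, and $H_{\tilde\mu_x}(\epsilon)$ is the entropy of the partition into points with respect to $\tilde\mu_x$ (equal to $-\sum_y \tilde\mu_x(\{y\})\log\tilde\mu_x(\{y\})$ if $\tilde\mu_x$ is purely atomic and $+\infty$ otherwise). Degenerate rate: $\Sigma_f=\{x\in M:\mathrm{Jac}(D_xf)=0\}$, where $\mathrm{Jac}(D_xf)$ is the Jacobian determinant of $D_xf$. Fix a decreasing sequence $\{V_m\}_{m\ge1}$ of open neighborhoods of $\Sigma_f$ with $d_H(V_m,\Sigma_f)\to0$ as $m\to\infty$, $d_H$ being the Hausdorff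 distance. Then $$\mathcal P_{\bar\eta}(f)=\Big\{\nu\in\mathcal P(M):\ \Big|\int_{V_m}\log|\mathrm{Jac}(D_xf)|\,d\nu(x)\Big|\le\eta_m\ \ \forall m\ge1\Big\}$$ (with $\log 0=-\infty$, so that $\nu(\Sigma_f)=0$ for $\nu\in\mathcal P_{\bar\eta}(f)$). *)

(* Defs.v *)
From mathcomp Require Import all_boot all_order all_algebra.
From mathcomp Require Import all_classical all_reals all_analysis.

Set Implicit Arguments.
Unset Strict Implicit.
Unset Printing Implicit Defensive.

Import Order.TTheory GRing.Theory Num.Theory.
Import numFieldNormedType.Exports.

Local Open Scope classical_set_scope.
Local Open Scope ring_scope.

Section regularity.
Context {R : realType} {V W : normedModType R}.
Implicit Types (U : set V) (f : V -> W).

(* f is of class C^k on the open set U, and its k-th derivative is locally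
   a-Hoelder there.  For a = 0 this is just C^k: since x `^ 0 = 1, the Hoelder
   condition then says "locally of bounded oscillation". *)
Fixpoint holder_class (k : nat) (a : R) U f : Prop :=
  match k with
  | 0 => forall x, U x -> {for x, continuous f} /\
      exists C : R, \forall p \near (x, x),
        `|f p.1 - f p.2| <= C * `|p.1 - p.2| `^ a
  | k'.+1 => (forall x, U x -> differentiable f x) /\
      forall v : V, holder_class k' a U (fun x => 'd f x v)
  end.

Definition Cr_on (r : R) U f :=
  holder_class (Num.truncn r) (r - (Num.truncn r)%:R) U f.

Definition smooth_on U f := forall k, holder_class k 0 U f.

End regularity.

(* A homeomorphism from an open subset of M onto an open subset of R^d; the
   values of chart_fun and chart_inv outside these sets are irrelevant. *)
Record chart (R : realType) (d : nat) (M : topologicalType) := Chart {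
  chart_source : set M ;
  chart_target : set 'rV[R]_d ;
  chart_fun :> M -> 'rV[R]_d ;
  chart_inv : 'rV[R]_d -> M ;
  open_chart_source : open chart_source ;
  open_chart_target : open chart_target ;
  chart_fun_target : forall x, chart_source x -> chart_target (chart_fun x) ;
  chart_inv_source : forall u, chart_target u -> chart_source (chart_inv u) ;
  chart_funK : forall x, chart_source x -> chart_inv (chart_fun x) = x ;
  chart_invK : forall u, chart_target u -> chart_fun (chart_inv u) = u ;
  chart_fun_continuous :
    forall x, chart_source x -> {for x, continuous chart_fun} ;
  chart_inv_continuous :
    forall u, chart_target u -> {for u, continuous chart_inv} }.

(* A Riemannian manifold without boundary of dimension d.  The metric is given
   by its Gram matrices in the charts (on row vectors), transforming as a
   covariant 2-tensor.  [chart_at] only fixes a reference chart at each point;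
   the notions below do not depend on it. *)
Record riemannian_manifold (R : realType) (d : nat) (M : topologicalType) :=
  RiemannianManifold {
  manifold_hausdorff : hausdorff_space M ;
  manifold_second_countable : @second_countable M ;
  atlas : set (chart R d M) ;
  chart_at : M -> chart R d M ;
  chart_at_atlas : forall x, atlas (chart_at x) ;
  chart_at_source : forall x, chart_source (chart_at x) x ;
  transition_smooth : forall c c', atlas c -> atlas c' ->
    smooth_on (chart_target c `&` chart_inv c @^-1` chart_source c')
      (c' \o chart_inv c) ;
  metric : chart R d M -> 'rV[R]_d -> 'M[R]_d ;
  metric_smooth : forall c, atlas c -> smooth_on (chart_target c) (metric c) ;
  metric_sym : forall c u, atlas c -> chart_target c u ->
    (metric c u)^T = metric c u ;
  metric_pos : forall c u (v : 'rV[R]_d), atlas c -> chart_target c u ->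
    v != 0 -> 0 < (v *m metric c u *m v^T) 0 0 ;
  metric_transition : forall c c' u (v w : 'rV[R]_d), atlas c -> atlas c' ->
    chart_target c u -> chart_source c' (chart_inv c u) ->
    let tau := c' \o chart_inv c in
    v *m metric c u *m w^T =
      'd tau u v *m metric c' (tau u) *m ('d tau u w)^T }.

Section riemannian_notions.
Context {R : realType} {d : nat} {M : topologicalType}.
Variable g : riemannian_manifold R d M.
Implicit Types (r : R) (f : M -> M) (c : R -> M) (x y : M) (A B : set M).

Definition Cr_map r f := continuous f /\
  forall phi psi, atlas g phi -> atlas g psi ->
    Cr_on r (chart_target phi `&`
             (f \o chart_inv phi) @^-1` chart_source psi)
      (psi \o f \o chart_inv phi).

(* |Jac(D_x f)|, the Jacobian being taken with respect to the Riemannian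
   volume; its sign is not defined on a non-oriented manifold. *)
Definition abs_jac f x : R :=
  let phi := chart_at g x in
  let psi := chart_at g (f x) in
  `| \det ('J (psi \o f \o chart_inv phi) (phi x)) |
  * Num.sqrt (\det (metric g psi (psi (f x))))
  / Num.sqrt (\det (metric g phi (phi x))).

Definition degenerate_set f : set M := [set x | abs_jac f x = 0].

Definition C1_curve c := continuous c /\
  forall phi, atlas g phi ->
    Cr_on 1 (c @^-1` chart_source phi : set R^o) (phi \o c : R^o -> _).

Definition speed c (t : R) : R :=
  let phi := chart_at g (c t) in
  let v := derive1 (phi \o c) t in
  Num.sqrt ((v *m metric g phi (phi (c t)) *m v^T) 0 0).

(* +oo between points of distinct connected components *)
Definition riemannian_dist x y : \bar R :=
  ereal_inf [set l | exists c, [/\ C1_curve c, c 0 = x, c 1 = y &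
    l = (\int[@lebesgue_measure R]_(t in `[0%R, 1%R]) (speed c t)%:E)%E]].

Definition dist_to_set x B : \bar R :=
  ereal_inf [set riemannian_dist x y | y in B].

(* Suprema are taken in [0, +oo], so that set0 is at distance 0 from itself
   and +oo from any nonempty set. *)
Definition hausdorff_dist A B : \bar R :=
  maxe (ereal_sup (0%E |` [set dist_to_set x B | x in A]))
       (ereal_sup (0%E |` [set dist_to_set y A | y in B])).

End riemannian_notions.

Definition borel (M : ptopologicalType) := g_sigma_algebraType (@open M).

Definition test_integrals (R : realType) (M : ptopologicalType)
    (mu : probability (borel M) R) :
    prod_topology (fun _ : continuousType M R => R) :=
  fun phi => \int[mu]_x phi x.

(* The Borel probability measures with the weak-* topology.  It is meant for
   compact M: there, all continuous functions are bounded. *)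
Notation prob_space R M := (initial_topology (@test_integrals R M)).

Section folding_entropy.
Context {R : realType} {M : ptopologicalType}.
Local Open Scope ereal_scope.
Implicit Types (f : M -> M) (mu : probability (borel M) R).

Definition image_measure f mu : set (borel M) -> \bar R :=
  pushforward mu (f : borel M -> borel M).

(* k x is the conditional measure of mu on the fibre f^-1{x} *)
Definition disintegration f mu (k : R.-pker borel M ~> borel M) :=
  {ae image_measure f mu, forall x, k x (f @^-1` [set x]) = 1} /\
  forall A : set (borel M), measurable A ->
    mu A = \int[image_measure f mu]_x k x A.

(* the entropy of the partition into points *)
Definition point_entropy (l : set (borel M) -> \bar R) : \bar R :=
  if `[< exists2 A, countable A & l A = 1 >] then
    \esum_(y in [set: M]) (- (fine (l [set y]) * ln (fine (l [set y]))))%:E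
  else +oo.

(* A disintegration exists and is unique up to null sets (Rokhlin), so that [get]
   picks the only element of the set. *)
Definition folding_entropy f mu : \bar R :=
  get [set h | exists2 k, disintegration f mu k &
                 h = \int[image_measure f mu]_x point_entropy (k x)].

End folding_entropy.

Definition P_eta {R : realType} {d : nat} {M : ptopologicalType}
    (g : riemannian_manifold R d M) (f : M -> M) (V : nat -> set M)
    (eta : nat -> R) : set (prob_space R M) :=
  [set nu : probability (borel M) R | forall m,
    (`| \int[nu]_(x in V m) lne (abs_jac g f x)%:E | <= (eta m)%:E)%E].

Definition upper_semicontinuous_on {R : realType} {X : topologicalType}
    (A : set X) (F : X -> \bar R) :=
  forall x, A x -> forall a : R, (F x < a%:E)%E ->
    \forall y \near within A (nbhs x), (F y < a%:E)%E.

(* Main.v *)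
(**
Write J = |Jac Df| and let k_x be the conditional measures of nu.  By Gibbs'
inequality, for every weight w > 0 outside the degenerate set,
  F_f(nu) + 1 <= \int (sum_(f y = x) w y) d(f nu)(x) + \int (- ln w) dnu,
with near equality when w y is close to k_(f y) {y}.  Given mu, one takes
  w y = eps J(y)^N + sum_(i < n) s_i(f y) chi_i(y)
where f is injective on disjoint sets A_i covering most of M, and the continuous
functions chi_i and s_i approximate in L^1 the indicator of A_i and the mass
x |-> k_x(A_i).  The first integral is then at most eps C0 + \int sum_i s_i d(f nu),
because J^N has bounded sums along the fibres: if f y = f z with y <> z, the Hoelder
continuity of Df yields J(y) <= K |y - z|^a in a chart, so that dyadic cells bound the
number of points of a fibre with J > t polynomially in 1/t.  Truncating - ln w from above
makes the right-hand side weak-* continuous in nu, at the price of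
N \int_(J < delta) (- ln J) dnu.  This is uniformly small on P_eta: the Hausdorff
convergence puts V_m inside {J < 1/2} for large m, since a curve that leaves a
coordinate ball has length bounded below, and by compactness {J < delta} lies in
V_m for small delta.
*)
Require Import Defs.
From HB Require Import structures.
From mathcomp Require Import all_boot all_order all_algebra.
From mathcomp Require Import all_classical all_reals all_analysis.
From mathcomp Require Import measurable_realfun giry.
From mathcomp Require Import ring lra.

Set Implicit Arguments.
Unset Strict Implicit.
Unset Printing Implicit Defensive.

Import Order.TTheory GRing.Theory Num.Theory.
Import numFieldNormedType.Exports.

Local Open Scope classical_set_scope.
Local Open Scope ring_scope.

(** * Gibbs' inequality and integrals of non-measurable functions *)

(** The obstacle is that weights adapted to mu must serve for every nu near mu, and such a nu may
    charge points missed by the sets A_i. There the adapted sum can vanish and - ln w would be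
    infinite. The term eps J^N keeps w positive off the degenerate set and bounds - ln w by a
    constant plus N (- ln J), the quantity that membership in P_eta controls.

    The 1 beside F_f(nu) is the total mass of nu: the weights are not normalised along the fibres,
    so that their fibre sums admit a continuous bound, and Gibbs' inequality for unnormalised
    weights carries both masses.

    The entropy of the conditional measure is not shown to depend measurably on the base point; its
    integral is only compared with integrals of measurable functions lying above or below it.

    The folding entropy has its intended value only once a disintegration exists. One is built from
    Radon-Nikodym densities on closed pieces on which f is injective; these cover the complement of
    the degenerate set, which is null for every measure in P_eta. *)

Section real_lemmas.
Context {R : realType}.

(** This is ln u <= u - 1 at u = s / t, multiplied by t. The summand [t] on the left adds up to the
    total mass and is the source of the [+ 1] in the entropy bounds below. *)
Lemma gibbs_le (t s : R) : 0 <= t -> 0 < s ->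
  - (t * ln t) + t <= s + t * - ln s.
Proof.
move=> t0 s0; move: t0; rewrite le_eqVlt => /orP[/eqP <-|t0].
  by rewrite !mul0r oppr0 !addr0 ltW.
have h : ln (s / t) <= s / t - 1.
  have := @le_ln1Dx R (s / t - 1); rewrite addrCA subrr addr0; apply.
  by rewrite ltrBrDl subrr divr_gt0.
rewrite ln_div ?posrE// in h.
have : t * (ln s - ln t) <= t * (s / t - 1) by rewrite ler_pM2l.
rewrite mulrBr mulrBr mulr1 mulrCA divff ?gt_eqF// mulr1 => {}h.
lra.
Qed.

Lemma entropy_term_ge0 (t : R) : 0 <= t <= 1 -> 0 <= - (t * ln t).
Proof.
move=> /andP[t0 t1]; rewrite -mulrN mulr_ge0// oppr_ge0 -ln1.
move: t0; rewrite le_eqVlt => /orP[/eqP <-|t0]; last by rewrite ler_ln ?posrE.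
by rewrite ln1 ln0.
Qed.

End real_lemmas.

Section borel_sets.
Context {M : ptopologicalType}.

Lemma open_borel (A : set M) : open A -> measurable (A : set (borel M)).
Proof. by move=> oA; apply: sub_sigma_algebra. Qed.

Lemma closed_borel (A : set M) : closed A -> measurable (A : set (borel M)).
Proof.
move=> cA; rewrite -(setCK A).
by apply: measurableC; apply: open_borel; exact: closed_openC.
Qed.

Lemma continuous_borel (f : M -> M) : continuous f ->
  measurable_fun [set: borel M] (f : borel M -> borel M).
Proof.
move=> /continuousP cf; apply: (measurability (@open M : set (set (borel M)))) => //.
by move=> _ [B oB <-]; rewrite setTI; apply: open_borel; exact: cf.
Qed.

Lemma continuous_borel_real {R : realType} (h : M -> R) : continuous h ->
  measurable_fun [set: borel M] (h : borel M -> R).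
Proof.
move=> /continuousP ch; apply: (measurability (@RGenOpens.G R : set (set R))).
  exact: RGenOpens.measurableE.
move=> _ [_ [x [y ->]] <-]; rewrite setTI; apply: open_borel; apply: ch.
exact: interval_open.
Qed.

End borel_sets.

Section integral_nonmeasurable.
Import HBNNSimple.
Local Open Scope ereal_scope.
Context d (T : measurableType d) {R : realType} (mu : {measure set T -> \bar R}).

(** The integral of a nonnegative function is a supremum over the simple functions below it, so it
    is monotone without measurability. This is how [point_entropy (k x)] is handled as a function of
    [x]. *)
Lemma ge0_le_integral_any (f g : T -> \bar R) :
  (forall x, 0 <= f x) -> (forall x, f x <= g x) ->
  \int[mu]_x f x <= \int[mu]_x g x.
Proof.
move=> f0 fg; rewrite !ge0_integralTE//; last by move=> x; exact: le_trans (fg x).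
by apply: ereal_sup_le => _ [h hf <-]; exists h => // x;
  apply: le_trans (fg x); exact: hf.
Qed.

(** The exceptional null set is absorbed by the measurable side: raising [g] to +oo there does not
    change its integral and makes the comparison hold everywhere. *)
Lemma ae_le_integral_measurable_right (f g : T -> \bar R) :
  (forall x, 0 <= f x) -> (forall x, 0 <= g x) -> measurable_fun [set: T] g ->
  {ae mu, forall x, f x <= g x} -> \int[mu]_x f x <= \int[mu]_x g x.
Proof.
move=> f0 g0 mg [N [mN N0 sN]].
pose g' x := if x \in N then +oo else g x.
have mg' : measurable_fun [set: T] g'.
  apply: measurable_fun_ifT => //.
  by apply: (measurable_fun_bool true); rewrite setTI -[X in measurable X](_ : N = _)//;
    apply/seteqP; split => x /=; [move/mem_set|move/set_mem].
apply: (@le_trans _ _ (\int[mu]_x g' x)).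
  apply: ge0_le_integral_any => // x; rewrite /g'; case: ifPn => [_|]; first exact: leey.
  rewrite notin_setE => Nx; apply: contrapT => h; apply: Nx; exact: sN.
rewrite le_eqVlt; apply/orP; left; apply/eqP; apply: ge0_ae_eq_integral => //.
  by move=> x _; rewrite /g'; case: ifP.
exists N; split => // x /= h; apply: contrapT => Nx; apply: h => _.
by rewrite /g' memNset.
Qed.

(** Here the measurable function is the smaller one, and it is lowered to 0 on the exceptional null
    set. *)
Lemma ae_le_integral_measurable_left (f g : T -> \bar R) :
  (forall x, 0 <= f x) -> (forall x, 0 <= g x) -> measurable_fun [set: T] f ->
  {ae mu, forall x, f x <= g x} -> \int[mu]_x f x <= \int[mu]_x g x.
Proof.
move=> f0 g0 mf [N [mN N0 sN]].
pose f' x := if x \in N then 0 else f x.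
have mf' : measurable_fun [set: T] f'.
  apply: measurable_fun_ifT => //.
  by apply: (measurable_fun_bool true); rewrite setTI -[X in measurable X](_ : N = _)//;
    apply/seteqP; split => x /=; [move/mem_set|move/set_mem].
apply: (@le_trans _ _ (\int[mu]_x f' x)); last first.
  apply: ge0_le_integral_any => x; rewrite /f'; case: ifPn => //.
  rewrite notin_setE => Nx; apply: contrapT => h; apply: Nx; exact: sN.
rewrite le_eqVlt; apply/orP; left; apply/eqP; apply: ge0_ae_eq_integral => //.
  by move=> x _; rewrite /f'; case: ifP.
exists N; split => // x /= h; apply: contrapT => Nx; apply: h => _.
by rewrite /f' memNset.
Qed.

End integral_nonmeasurable.

(** An injection of [D] into the naturals cuts [D] into countably many pieces, each empty or a
    single point, to which sigma-additivity applies. *)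
Lemma measure_countable_esum d (T : measurableType d) (R : realType)
    (m : {measure set T -> \bar R}) (D : set T) : countable D ->
  (forall x : T, d.-measurable [set x]) -> m D = \esum_(x in D) m [set x].
Proof.
move=> cD m1.
have [f injf] : exists f : T -> nat, {in D &, injective f}.
  by move/countable_injP : cD => [f /[dup] ? injf]; exists f.
pose J n := D `&` f @^-1` [set n].
have JE n : J n = set0 \/ exists x, J n = [set x].
  have [->|/set0P[x [Dx fx]]] := eqVneq (J n) set0; [by left|right; exists x].
  apply/seteqP; split => [y [Dy fy]|y ->//].
  by apply: injf; rewrite ?inE//= fy fx.
have mJ n : measurable (J n) by have [->//|[x ->]] := JE n.
have DE : D = \bigcup_n J n.
  by apply/seteqP; split => [x Dx|x [n _ []]//]; exists (f x).
have tJ : trivIset setT J.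
  apply/trivIsetP => i j _ _ ij; apply/seteqP; split => //.
  by move=> x [[_ /= xi] [_ /= xj]]; move/eqP : ij; rewrite -xi -xj.
rewrite {1}DE measure_bigcup//= DE esum_bigcupT// nneseries_esum//.
rewrite (_ : [set n | _] = setT); last by apply/seteqP; split => // n _ /=; rewrite inE.
apply: eq_esum => n _; have [->|[x ->]] := JE n.
  by rewrite measure0 esum_set0.
by rewrite esum_set1.
Qed.

Lemma continuous_sum_real (R : realType) (M : topologicalType) (n : nat)
    (v : nat -> M -> R) : (forall i, continuous (v i)) ->
  continuous (fun x => \sum_(i < n) v i x).
Proof.
move=> cv; elim: n => [|n IH] x.
  under [X in continuous_at _ X]eq_fun do rewrite big_ord0.
  exact: cst_continuous.
under [X in continuous_at _ X]eq_fun do rewrite big_ord_recr/=.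
by apply: continuousD; [exact: IH|exact: cv].
Qed.

(** * Approximation by continuous functions *)

Section l1_density.
Context {R : realType} {M : ptopologicalType}.
Hypothesis M_normal : normal_space M.
Hypothesis M_countable : @second_countable M.

Lemma urysohn_function (C U : set M) : closed C -> open U -> C `<=` U ->
  exists h : M -> R, [/\ continuous h, forall x, 0 <= h x <= 1,
    forall x, C x -> h x = 1 & forall x, ~ U x -> h x = 0].
Proof.
move=> cC oU CU.
have sep : uniform_separator (~` U) C.
  move/(@normal_separatorP R M) : M_normal; apply => //; first exact: open_closedC.
  by apply/seteqP; split => // x [Ux /CU].
exists (Urysohn (~` U) C); split.
- exact: Urysohn_continuous.
- by move=> x; have /(_ _) := @Urysohn_range M R (~` U) C (Urysohn (~` U) C x);
    rewrite /= in_itv/=; apply; exists x.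
- by move=> x Cx; apply: (Urysohn_sub1 sep); exists x.
- by move=> x Ux; apply: (Urysohn_sub0 sep); exists x.
Qed.

Hypothesis M_hausdorff : hausdorff_space M.

Lemma normal_point_nbhs (x : M) (U : set M) : open U -> U x ->
  exists2 V : set M, open_nbhs x V & closure V `<=` U.
Proof.
move=> oU Ux.
have cx : closed [set x] by exact: accessible_closed_set1 (hausdorff_accessible M_hausdorff) _.
have [|V /set_nbhsP[W [oW xW WV]] VU] := M_normal cx (t := U).
  by apply/set_nbhsP; exists U; split => // _ ->.
exists W; first by split => //; exact: xW.
by apply: subset_trans VU; exact: closure_subset.
Qed.

(** The members of the cover are the closures of those basic open sets whose closure satisfies [G],
    the other indices being filled with [set0]. Regularity places around each point of [D] a basic
    set whose closure stays inside the given [U]. *)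
Lemma second_countable_closed_cover (G : set (set M)) (D : set M) :
  G set0 ->
  (forall x, D x -> exists U, [/\ open U, U x &
     forall A, A `<=` U -> closed A -> G A]) ->
  exists C : nat -> set M, (forall n, closed (C n) /\ G (C n)) /\
    D `<=` \bigcup_n C n.
Proof.
move=> G0 hD; have [B /pfcard_geP[B0|[b]] [oB bB]] := M_countable.
  exists (fun=> set0); split => [n|x Dx]; first by split => //; exact: closed0.
  have [U [oU Ux _]] := hD _ Dx.
  by have [V [+ _] _] := bB x U (open_nbhs_nbhs (conj oU Ux)); rewrite B0.
pose C n := if `[< G (closure (b n)) >] then closure (b n) else set0.
exists C; split => [n|x Dx].
  rewrite /C; case: asboolP => ?; split => //.
  - exact: closed_closure.
  - exact: closed0.
have [U [oU Ux GU]] := hD _ Dx.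
have [V [oV Vx] VU] := normal_point_nbhs oU Ux.
have [W [BW Wx] WV] := bB x V (open_nbhs_nbhs (conj oV Vx)).
have [n _ nW] : range b W by have := @surj _ _ _ _ b; apply.
exists n => //; rewrite /C nW; case: asboolP => [_|[]]; first exact: subset_closure.
apply: GU; last exact: closed_closure.
by apply: subset_trans VU; exact: closure_subset.
Qed.

Lemma open_bigcup_closed (U : set M) : open U ->
  exists2 C : nat -> set M, forall n, closed (C n) & U = \bigcup_n C n.
Proof.
move=> oU.
have [||C [hC UC]] := @second_countable_closed_cover [set A | A `<=` U] U.
- exact: sub0set.
- by move=> x Ux; exists U; split.
exists C => [n|]; first by have [] := hC n.
by apply/seteqP; split => // x [n _]; have [_] := hC n; exact.
Qed.

Variable P : probability (borel M) R.
Local Open Scope ereal_scope.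

Definition l1_close (u v : M -> R) : \bar R := \int[P]_x `|u x - v x|%:E.

Definition l1_approx (u : M -> R) := forall e : R, (0 < e)%R ->
  exists v : M -> R, [/\ continuous v, (forall x, 0 <= v x <= 1)%R &
    l1_close u v <= e%:E].

Lemma measurable_l1 (u v : borel M -> R) : measurable_fun setT u ->
  measurable_fun setT v -> measurable_fun setT (fun x => `|u x - v x|%:E).
Proof.
move=> mu mv; apply/measurable_EFinP; apply: measurableT_comp => //.
exact: measurable_funB.
Qed.

Lemma l1_close_triangle (u w v : borel M -> R) :
  measurable_fun setT u -> measurable_fun setT w -> measurable_fun setT v ->
  l1_close u v <= l1_close u w + l1_close w v.
Proof.
move=> mu mw mv; rewrite /l1_close -ge0_integralD//; try exact: measurable_l1.
apply: ge0_le_integral_any => x; first by rewrite lee_fin.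
by rewrite -EFinD lee_fin ler_distD.
Qed.

Lemma l1_approxC (A : set M) : l1_approx \1_A -> l1_approx \1_(~` A).
Proof.
move=> hA e e0; have [v [cv v01 hv]] := hA e e0.
exists (fun x => 1 - v x)%R; split.
- by move=> x; apply: continuousB; [exact: cst_continuous|exact: cv].
- by move=> x; have := v01 x; lra.
- apply: le_trans hv; rewrite /l1_close le_eqVlt; apply/orP; left; apply/eqP.
  apply: eq_integral => x _; rewrite !indicE in_setC.
  by case: (x \in A) => /=; rewrite ?sub0r ?subr0 -normrN; congr (`|_|%:E); lra.
Qed.

Lemma l1_approxI (A B : set M) : measurable (A : set (borel M)) ->
  measurable (B : set (borel M)) ->
  l1_approx \1_A -> l1_approx \1_B -> l1_approx \1_(A `&` B).
Proof.
move=> mA mB hA hB e e0; have e20 : (0 < e / 2)%R by rewrite divr_gt0.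
have [v [cv v01 hv]] := hA _ e20; have [w [cw w01 hw]] := hB _ e20.
exists (fun x => v x * w x)%R; split.
- by move=> x; apply: continuousM; [exact: cv|exact: cw].
- move=> x; have /andP[v0 v1] := v01 x; have /andP[w0 w1] := w01 x.
  by rewrite mulr_ge0//= mulr_ile1.
- rewrite (splitr e) EFinD; apply: le_trans (leeD hv hw).
  rewrite /l1_close -ge0_integralD//;
    try by apply: measurable_l1; [exact: measurable_indic|exact: continuous_borel_real].
  apply: ge0_le_integral_any => x; first by rewrite lee_fin.
  rewrite -EFinD lee_fin !indicE in_setI.
  have := v01 x; have := w01 x.
  by case: (x \in A) => /=; case: (x \in B) => /=; rewrite ?sub0r ?normrN;
    move=> ? ?; do ?[rewrite ger0_norm//; nra];
    rewrite ?(ger0_norm (x := _ - _)%R) ?ger0_norm//; nra.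
Qed.

(** Continuity of the measure makes the mass of the union outside [F n] small. Allowing that mass as
    an extra error in the hypothesis covers two cases at once: a Urysohn function squeezed between
    [F n] and an open union, and a direct approximation of the indicator of [F n]. *)
Lemma l1_approx_bigcup (F : nat -> set M) :
  (forall n, measurable (F n : set (borel M))) ->
  (forall m n, (m <= n)%N -> F m `<=` F n) ->
  (forall n e, (0 < e)%R -> exists v : M -> R, [/\ continuous v,
     (forall x, 0 <= v x <= 1)%R &
     l1_close \1_(F n) v <= e%:E + P (\bigcup_n F n `\` F n)]) ->
  l1_approx \1_(\bigcup_n F n).
Proof.
move=> mF ndF hF e e0; have e40 : (0 < e / 4)%R by rewrite divr_gt0.
pose U : set (borel M) := \bigcup_n F n.
have mU : measurable U by apply: bigcup_measurable => n _; exact: mF.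
have [n hn] : exists n, P (U `\` F n) <= (e / 4)%:E.
  have : P (U `\` F n) @[n --> \oo] --> P set0.
    have -> : set0 = \bigcap_n (U `\` F n).
      apply/seteqP; split => // x h; have [[m _ Fx] _] := h 0%N Logic.I.
      by have [_] := h m Logic.I; exact.
    apply: (@nonincreasing_cvg_mu _ _ _ P (fun n => U `\` F n)).
    - by apply: (le_lt_trans (probability_le1 _ _)); [exact: measurableD|rewrite ltry].
    - by move=> m; exact: measurableD.
    - by apply: bigcap_measurable => // m _; exact: measurableD.
    - by move=> m k mk; apply/subsetPset; apply: setDS; exact: ndF.
  rewrite measure0 => /fine_cvgP[_ /cvgrPdist_le/(_ _ e40)[m _ /(_ m (leqnn m))]] /=.
  rewrite sub0r normrN => h; exists m.
  rewrite -[leLHS]fineK ?fin_num_measure//; last exact: measurableD.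
  by rewrite lee_fin (le_trans _ h)// ler_norm.
have [v [cv v01 hv]] := hF n _ e40.
exists v; split => //.
have mv := continuous_borel_real cv.
apply: (le_trans (@l1_close_triangle _ \1_(F n) _ _ _ _)) => //;
  try exact: measurable_indic.

have -> : e = (e / 4 + (e / 4 + (e / 4 + e / 4)))%R by field.
rewrite EFinD leeD//.
  apply: le_trans hn; rewrite -[X in _ <= P X]setIT -integral_indic//; last exact: measurableD.
  apply: ge0_le_integral_any => x; first by rewrite lee_fin.
  rewrite lee_fin !indicE.
  have [Fx|Fx] := pselect (F n x).
    have Ux : U x by exists n.
    by rewrite (mem_set Ux) (mem_set Fx) subrr normr0.
  have [Ux|Ux] := pselect (U x).
    by rewrite (mem_set Ux) (memNset Fx) mem_set// subr0 normr1.
  by rewrite (memNset Ux) (memNset Fx) subrr normr0.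
apply: (le_trans hv); rewrite EFinD leeD//.
apply: (le_trans hn); rewrite lee_fin; lra.
Qed.

(** The sets with approximable indicator form a sigma-algebra containing the open sets. Open sets
    are increasing unions of closed ones; finite unions come from complements and intersections, and
    countable unions from finite ones. *)
Lemma l1_approx_borel (A : set (borel M)) : measurable A -> l1_approx \1_A.
Proof.
pose D := [set A | measurable (A : set (borel M)) /\ l1_approx \1_A].
move=> mA; suff: D A by case.
apply: (@smallest_sub _ (sigma_algebra setT) open D) mA; last first.
  move=> U oU; split; first exact: open_borel.
  have [C cC UE] := open_bigcup_closed oU; rewrite {}UE in oU *.
  pose F n := \bigcup_(i < n) C i.
  have cF n : closed (F n).
    by apply: closed_bigcup => //; exact: finite_II.
  have FU n : F n `<=` \bigcup_n C n by move=> x [i _ Cx]; exists i.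
  have UF : \bigcup_n C n = \bigcup_n F n.
    apply/seteqP; split => x [n _ ?]; last exact: (FU n).
    by exists n.+1 => //; exists n => /=.
  rewrite UF; apply: l1_approx_bigcup.
  - by move=> n; exact: closed_borel.
  - by move=> m n mn x [i /= im Cx]; exists i => //=; exact: leq_trans mn.
  - move=> n e e0; rewrite -UF.
    have [h [ch h01 h1 h0]] := urysohn_function (cF n) oU (FU n).
    exists h; split => //; apply: (@le_trans _ _ (P (\bigcup_n C n `\` F n))); last first.
      by rewrite leeDr// lee_fin ltW.
    have mD : measurable ((\bigcup_n C n `\` F n) : set (borel M)).
      by apply: measurableD; [exact: open_borel|exact: closed_borel].
    rewrite -[X in _ <= P X]setIT -integral_indic//.
    apply: ge0_le_integral_any => x; first by rewrite lee_fin.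
    rewrite lee_fin !indicE.
    have [Fx|Fx] := pselect (F n x).
      by rewrite mem_set// h1// subrr normr0.
    rewrite (memNset Fx) sub0r normrN.
    have [Ux|Ux] := pselect ((\bigcup_n C n) x).
      rewrite mem_set//; have /andP[? ?] := h01 x; by rewrite ger0_norm.
    by rewrite h0// normr0.
split.
- split; first exact: measurable0.
  move=> e e0; exists (fun=> 0%R); split => //.
  - exact: cst_continuous.
  - by move=> x; rewrite lexx ler01.
  - rewrite /l1_close integral0_eq ?lee_fin ?ltW// => x _.
    by rewrite indicE in_set0 subrr normr0.
- by move=> B [mB hB]; rewrite setTD; split; [exact: measurableC|exact: l1_approxC].
- move=> F hF; have mF n : measurable (F n : set (borel M)) by have [] := hF n.
  split; first exact: bigcup_measurable.
  pose G n := \big[setU/set0]_(i < n) F i.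
  have hG n : D (G n).
    elim: n => [|n [mG lG]].
      rewrite /G big_ord0; split; first exact: measurable0.
      move=> e e0; exists (fun=> 0%R); split => //.
      - exact: cst_continuous.
      - by move=> x; rewrite lexx ler01.
      - rewrite /l1_close integral0_eq ?lee_fin ?ltW// => x _.
        by rewrite indicE in_set0 subrr normr0.
    rewrite /G big_ord_recr/= -/(G n); split; first exact: measurableU.
    rewrite -[X in \1_X]setCK; apply: l1_approxC; rewrite setCU.
    apply: l1_approxI; try exact: measurableC; apply: l1_approxC => //.
    by have [] := hF n.
  have GE : \bigcup_n F n = \bigcup_n G n.
    apply/seteqP; split => x [n _ Fx].
      by exists n.+1 => //; rewrite /G -bigcup_mkord; exists n => /=.
    by move: Fx; rewrite /G -bigcup_mkord => -[i _ Fx]; exists i.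
  rewrite GE; apply: l1_approx_bigcup.
  - by move=> n; have [] := hG n.
  - move=> m n mn x; rewrite /G -!bigcup_mkord => -[i /= im Fx].
    by exists i => //=; exact: leq_trans mn.
  - move=> n e e0; have [_ lG] := hG n; have [v [cv v01 hv]] := lG _ e0.
    by exists v; split => //; apply: (le_trans hv); rewrite leeDl.
Qed.

(** Layers: [u] is within 1/N of the average of the indicators of the N level sets [A i], because
    exactly floor(N u x) of them contain [x]. Each indicator is approximated within e / 2, hence so
    is the average, and 1/N <= e / 2. *)
Lemma l1_approx_measurable (u : borel M -> R) : measurable_fun setT u ->
  (forall x, 0 <= u x <= 1)%R -> l1_approx u.
Proof.
move=> mu u01 e e0.
pose N := (Num.truncn (2 / e)).+1.
have N0 : (0 < N%:R :> R)%R by rewrite ltr0n.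
have Ne : (N%:R^-1 <= e / 2)%R.
  rewrite -[(e / 2)%R]invrK lef_pV2 ?posrE ?invr_gt0 ?divr_gt0//.
  by rewrite invf_div ltW// /N truncnS_gt// num_real.
pose A (i : nat) : set (borel M) := [set x | i.+1%:R / N%:R <= u x]%R.
have mA i : measurable (A i).
  have -> : A i = setT `&` u @^-1` `[(i.+1%:R / N%:R)%R, +oo[%classic.
    by apply/seteqP; split => x /=; rewrite /A/= in_itv/= andbT => //; case.
  by apply: mu => //; exact: measurable_itv.
have e20 : (0 < e / 2)%R by rewrite divr_gt0.
have /choice[v hv] : forall i, exists v : M -> R, [/\ continuous v,
    (forall x, 0 <= v x <= 1)%R & l1_close \1_(A i) v <= (e / 2)%:E].
  by move=> i; exact: l1_approx_borel.
have mv i : measurable_fun setT (v i : borel M -> R).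
  by apply: continuous_borel_real; have [] := hv i.
exists (fun x => N%:R^-1 * \sum_(i < N) v i x)%R; split.
- move=> x; apply: cvgM; first exact: cvg_cst.
  by apply: (@continuous_sum_real _ _ _ v) => i; have [] := hv i.
- move=> x; rewrite mulr_ge0 ?invr_ge0 ?ler0n//=; last first.
    by apply: sumr_ge0 => i _; have [_ /(_ x)/andP[]] := hv i.
  rewrite mulrC ler_pdivrMr// mul1r (@le_trans _ _ (\sum_(i < N) 1)%R)//.
    by apply: ler_sum => i _; have [_ /(_ x)/andP[]] := hv i.
  by rewrite sumr_const card_ord.
- apply: (@le_trans _ _ (\int[P]_x ((N%:R^-1)%:E +
      \sum_(i < N) (N%:R^-1 * `|\1_(A i) x - v i x|)%:E))).
    apply: ge0_le_integral_any => x; first by rewrite lee_fin.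
    rewrite sumEFin -EFinD lee_fin -mulr_sumr.
    have -> : (u x - N%:R^-1 * \sum_(i < N) v i x = (u x - N%:R^-1 * \sum_(i < N) \1_(A i) x) +
      N%:R^-1 * \sum_(i < N) (\1_(A i) x - v i x))%R.
      by rewrite sumrB mulrBr; ring.
    rewrite (le_trans (ler_normD _ _))// lerD//; last first.
      rewrite normrM ger0_norm ?invr_ge0 ?ler0n//.
      by rewrite ler_pM2l ?invr_gt0// ler_norm_sum.
    have /andP[u0 u1] := u01 x.
    pose k := Num.truncn (N%:R * u x).
    have Nu0 : (0 <= N%:R * u x)%R by rewrite mulr_ge0.
    have /andP[k1 k2] := truncn_itv Nu0.
    have kN : (k <= N)%N.
      by rewrite -(ler_nat R) (le_trans k1)// ler_piMr.
    have -> : (\sum_(i < N) \1_(A i) x = k%:R :> R)%R.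
      rewrite (eq_bigr (fun i : 'I_N => (nat_of_bool (i < k)%N)%:R)); last first.
        move=> i _; rewrite indicE; congr (_%:R); congr nat_of_bool.
        apply/idP/idP => [/set_mem|ik].
          rewrite /A/= ler_pdivrMr// mulrC => h.
          by rewrite -ltnS -(ltr_nat R) (le_lt_trans h).
        apply/mem_set; rewrite /A/= ler_pdivrMr// mulrC.
        by rewrite (le_trans _ k1)// ler_nat.
      rewrite -natr_sum; congr (_%:R).
      rewrite -[RHS]card_ord -sum1_card (big_ord_widen N (fun=> 1%N) kN).
      by rewrite [RHS]big_mkcond; apply: eq_bigr => i _; case: (i < k)%N.
    rewrite ler_norml; apply/andP; split.
      by rewrite (@le_trans _ _ 0%R) ?oppr_le0 ?invr_ge0 ?ler0n// subr_ge0 ler_pdivrMl.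
    rewrite lerBlDr -(ler_pM2l N0) mulrDr mulrA divff ?gt_eqF// mul1r.
    by rewrite addrC natr1 ltW.
  have mterm (i : 'I_N) : measurable_fun setT
      (fun x : borel M => (N%:R^-1 * `|\1_(A i) x - v i x|)%:E).
    apply/measurable_EFinP; apply: measurable_funM => //.
    apply: measurableT_comp => //; exact: measurable_funB.
  have term0 (i : 'I_N) (x : borel M) : 0 <= (N%:R^-1 * `|\1_(A i) x - v i x|)%:E.
    by rewrite lee_fin mulr_ge0 ?invr_ge0 ?ler0n.
  rewrite ge0_integralD//; last 2 first.
  + by move=> x _; apply: sume_ge0.
  + exact: emeasurable_sum.
  rewrite integral_cst//= probability_setT mule1 ge0_integral_sum//.
  apply: (@le_trans _ _ ((N%:R^-1)%:E + \sum_(i < N) (N%:R^-1 * (e / 2))%:E)).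
    rewrite leeD2l//; apply: lee_sum => i _.
    under eq_integral do rewrite EFinM.
    rewrite ge0_integralZl_EFin ?invr_ge0//.
    - by rewrite EFinM lee_pmul2l ?lte_fin ?invr_gt0//; have [] := hv i.
    - by apply: measurable_l1 => //; exact: measurable_indic.
  rewrite sumEFin -EFinD lee_fin sumr_const card_ord -[X in (_ + X)%R]mulr_natl mulrA.
  by rewrite divff ?gt_eqF// mul1r; lra.
Qed.

End l1_density.

(** * Entropy and disintegrations *)

Section point_entropy_bounds.
Local Open Scope ereal_scope.
Context {R : realType} {M : ptopologicalType}.
Hypothesis measurable_set1 : forall x : M, measurable ([set x] : set (borel M)).
Variable m : {measure set borel M -> \bar R}.
Hypothesis m1 : m setT = 1.

Lemma measure1_le1 (A : set (borel M)) : measurable A -> m A <= 1.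
Proof. by move=> mA; rewrite -m1 le_measure ?inE. Qed.

Lemma measure1_fine (A : set (borel M)) : measurable A ->
  m A = (fine (m A))%:E.
Proof.
move=> mA; rewrite fineK// ge0_fin_numE//.
by rewrite (le_lt_trans (measure1_le1 mA)) ?ltry.
Qed.

Lemma fine_measure01 (A : set (borel M)) : measurable A ->
  (0 <= fine (m A) <= 1)%R.
Proof.
by move=> mA; rewrite fine_ge0//= -lee_fin -measure1_fine// measure1_le1.
Qed.

Lemma measure1_setC0 (F : set (borel M)) : measurable F -> m F = 1 -> m (~` F) = 0.
Proof.
move=> mF mF1; have mC := measurableC mF.
have : m [set: borel M] = m (setT `\` F) + m (setT `&` F) by exact: measureDI.
rewrite m1 setTI setTD mF1.
by rewrite (measure1_fine mC) -EFinD => -[] ?; congr EFin; lra.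
Qed.

Lemma fine_entropy_term_ge0 (A : set (borel M)) : measurable A ->
  0 <= (- (fine (m A) * ln (fine (m A))))%:E.
Proof. by move=> mA; rewrite lee_fin entropy_term_ge0// fine_measure01. Qed.

Lemma esum_le_integral (D : set M) (G : borel M -> R) :
  measurable_fun setT G -> (forall y, 0 <= G y)%R ->
  \esum_(y in D) (m [set y] * (G y)%:E) <= \int[m]_y (G y)%:E.
Proof.
move=> mG G0; apply: ge_ereal_sup => _ [A [fA AD] <-].
rewrite fsbig_finite//=.
apply: (@le_trans _ _ (\int[m]_x
   (\sum_(y <- finmap.enum_fset (fset_set A)) ((G y)%:E * (\1_[set y] x)%:E)))).
  rewrite ge0_integral_sum//; last 2 first.
  - move=> y; apply: measurable_funeM; apply/measurable_EFinP.
    exact: measurable_indic.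
  - by move=> y x _; rewrite mule_ge0// lee_fin.
  apply: lee_sum => y _; rewrite ge0_integralZl ?lee_fin//;
    try by [move=> *; rewrite lee_fin|apply/measurable_EFinP; exact: measurable_indic].
  by rewrite integral_indic// setIT muleC.
apply: ge0_le_integral_any => x.
  by apply: sume_ge0 => y _; rewrite mule_ge0// lee_fin.
have [xA|xA] := boolP (x \in finmap.enum_fset (fset_set A)).
  rewrite (bigD1_seq x)//= ?finmap.fset_uniq// big1 ?adde0.
    by rewrite indicE mem_set// mule1.
  by move=> y yx; rewrite indicE memNset ?mule0//= => xy; rewrite xy eqxx in yx.
rewrite big_seq big1 ?lee_fin// => y yA; rewrite indicE memNset ?mule0//= => xy.
by rewrite xy yA in xA.
Qed.

(** Gibbs' inequality is applied with [t] the mass of each point of [D] and summed; the masses add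
    up to 1. The inequality is assumed for a general pair [w], [G] instead of [G = - ln w], so that
    a truncated logarithm with an error term may stand for [- ln w]. *)
Lemma point_entropy_upper (D : set M) (w G : borel M -> R) :
  countable D -> m D = 1 -> measurable_fun setT G ->
  (forall y, 0 <= w y)%R -> (forall y, 0 <= G y)%R ->
  (forall y t, D y -> 0 <= t <= 1 -> - (t * ln t) + t <= w y + t * G y)%R ->
  point_entropy m + 1 <= \esum_(y in D) (w y)%:E + \int[m]_y (G y)%:E.
Proof.
move=> cD mD1 mG w0 G0 gibbs.
have mD : measurable (D : set (borel M)) by apply: countable_measurable.
rewrite /point_entropy asboolT; last by exists D.
have -> : \esum_(y in [set: M]) (- (fine (m [set y]) * ln (fine (m [set y]))))%:E =
    \esum_(y in D) (- (fine (m [set y]) * ln (fine (m [set y]))))%:E.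
  rewrite [RHS]esum_mkcond; apply: eq_esum => y _; case: ifPn => // yD.
  suff -> : m [set y] = 0 by rewrite /= mul0r oppr0.
  apply/eqP; rewrite eq_le measure_ge0 andbT -(measure1_setC0 mD mD1).
  rewrite le_measure ?inE//; first exact: measurableC.
  by move=> _ -> /mem_set; exact/negP.
rewrite -[X in _ + X]mD1 (measure_countable_esum m cD)// -esumD; last 2 first.
- by move=> y _; exact: fine_entropy_term_ge0.
- by [].
apply: (@le_trans _ _ (\esum_(y in D) ((w y)%:E + m [set y] * (G y)%:E))).
  apply: le_esum => y Dy; have my := fine_measure01 (measurable_set1 y).
  move: my (measure1_fine (measurable_set1 y)); set t := fine _ => t01 ->.
  by rewrite -EFinM -!EFinD lee_fin gibbs.
rewrite esumD; last 2 first.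
- by move=> y _; rewrite lee_fin.
- by move=> y _; rewrite mule_ge0// lee_fin.
by rewrite leeD2l// esum_le_integral.
Qed.

(** For [F] a fibre of a map injective on each [A i], the set [A i] meets [F] in at most one point,
    and the mass of [A i] is the mass of that point. The sum is then a partial sum of the
    nonnegative series defining the entropy. *)
Lemma point_entropy_lower (n : nat) (A : nat -> set M) (F : set M) :
  (forall i, measurable (A i : set (borel M))) ->
  measurable (F : set (borel M)) -> m F = 1 -> trivIset setT A ->
  (forall i x y, A i x -> A i y -> F x -> F y -> x = y) ->
  \sum_(i < n) (- (fine (m (A i)) * ln (fine (m (A i)))))%:E <= point_entropy m.
Proof.
move=> mA mF mF1 tA injA; rewrite /point_entropy; case: ifPn => _; last exact: leey.
pose J i := A i `&` F.
have JE i : J i = set0 \/ exists x, J i = [set x].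
  have [->|/set0P[x [Ax Fx]]] := eqVneq (J i) set0; [by left|right; exists x].
  by apply/seteqP; split => [y [Ay Fy]|y ->//]; exact: (injA i).
have tJ : trivIset setT J.
  apply/trivIsetP => i j _ _ ij; rewrite /J setIACA setIid.
  by move/trivIsetP : tA => /(_ i j Logic.I Logic.I ij) ->; rewrite set0I.
have mJ i : m (A i) = m (J i).
  rewrite /J; apply/eqP; rewrite eq_le; apply/andP; split; last first.
    by rewrite le_measure ?inE//; exact: measurableI.
  rewrite (measureDI m (mA i) mF) [X in X + _](_ : _ = 0) ?add0e//.
  apply/eqP; rewrite eq_le measure_ge0 andbT -(measure1_setC0 mF mF1).
  apply: le_measure; rewrite ?inE; [exact: measurableD|exact: measurableC|].
  by move=> x [].
pose t y : \bar R := (- (fine (m [set y]) * ln (fine (m [set y]))))%:E.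
have t0 y : 0 <= t y by exact: fine_entropy_term_ge0.
apply: (@le_trans _ _ (\esum_(y in \bigcup_(i in `I_n) J i) t y)).
  rewrite esum_bigcupT// esum_fset//; last by move=> i _; exact: esum_ge0.
  rewrite -fsbig_ord; apply: lee_sum => i _; rewrite mJ.
  have [->|[x ->]] := JE i; first by rewrite measure0 esum_set0 /= mul0r oppr0.
  by rewrite esum_set1.
by apply: le_ereal_sup => _ [B [fB BJ] <-]; exists B.
Qed.

End point_entropy_bounds.

(** A copy of [k x] carrying the structure of a probability measure, so that [k] can be seen as a
    measurable map into the Giry space. *)
Definition kernel_prob d d' (X : measurableType d) (Y : measurableType d')
  (R : realType) (k : R.-pker X ~> Y) (x : X) : set Y -> \bar R := k x.

HB.instance Definition _ d d' (X : measurableType d) (Y : measurableType d')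
  (R : realType) (k : R.-pker X ~> Y) (x : X) :=
  Measure.copy (kernel_prob k x) (k x).

HB.instance Definition _ d d' (X : measurableType d) (Y : measurableType d')
  (R : realType) (k : R.-pker X ~> Y) (x : X) :=
  Measure_isProbability.Build _ _ _ (kernel_prob k x)
    (@prob_kernel _ _ _ _ _ k x).

Section disintegrations.
Local Open Scope ereal_scope.
Context {R : realType} {M : ptopologicalType}.
Hypothesis M_hausdorff : hausdorff_space M.
Variable f : M -> M.
Hypothesis f_continuous : continuous f.
Implicit Types (mu : probability (borel M) R) (k : R.-pker borel M ~> borel M).

Lemma measurable_point (x : M) : measurable ([set x] : set (borel M)).
Proof.
apply: closed_borel.
exact: accessible_closed_set1 (hausdorff_accessible M_hausdorff) _.
Qed.

Lemma measurable_fiber (x : M) : measurable (f @^-1` [set x] : set (borel M)).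
Proof.
rewrite -[X in measurable X]setTI; apply: continuous_borel => //.
exact: measurable_point.
Qed.

(** [image_measure f mu] is a bare set function; the pair holds a probability measure together with
    the equation leading back to it. *)
Definition image_prob mu : {Q : probability (borel M) R |
  (Q : set (borel M) -> \bar R) = image_measure f mu}.
Proof.
pose mf := @isMeasurableFun.Build _ _ (borel M) (borel M) (f : borel M -> borel M)
  (continuous_borel f_continuous).
pose F : {mfun borel M >-> borel M} := HB.pack (f : borel M -> borel M) mf.
by exists (distribution mu F).
Qed.

Variables (mu : probability (borel M) R) (k : R.-pker borel M ~> borel M).
Hypothesis disk : disintegration f mu k.
Let Q := sval (image_prob mu).
Let QE : (Q : set (borel M) -> \bar R) = image_measure f mu :=
  svalP (image_prob mu).

Lemma integral_image (h : borel M -> \bar R) : measurable_fun setT h ->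
  (forall x, 0 <= h x) -> \int[image_measure f mu]_x h x = \int[mu]_y h (f y).
Proof.
move=> mh h0; rewrite ge0_integral_pushforward//.
exact: continuous_borel.
Qed.

Lemma kernel_fiber : {ae Q, forall x, k x (f @^-1` [set x]) = 1}.
Proof. by have [+ _] := disk; rewrite -QE. Qed.

Lemma kernel_giry :
  measurable_fun setT (fun x => kernel_prob k x : giry (borel M) R).
Proof.
apply: measurable_giry_codensity => // B mB; exact: measurable_kernel.
Qed.

Lemma measurable_integral_kernel (h : borel M -> \bar R) :
  measurable_fun setT h -> (forall x, 0 <= h x) ->
  measurable_fun setT (fun x => \int[k x]_y h y).
Proof.
move=> mh h0.
exact: (measurableT_comp (measurable_giry_int mh h0) kernel_giry).
Qed.

(** The disintegration formula, known for sets, says that [mu] is the Giry bind of its image measure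
    with the kernel; the integral against a bind is the iterated integral. *)
Lemma integral_disintegration (h : borel M -> \bar R) :
  measurable_fun setT h -> (forall x, 0 <= h x) ->
  \int[mu]_y h y = \int[Q]_x \int[k x]_y h y.
Proof.
move=> mh h0.
transitivity (giry_int (giry_bind (Q : giry (borel M) R) kernel_giry) h);
  last by rewrite giry_int_bind.
apply: eq_measure_integral => A mA _.
transitivity (mu A) => //; have [_ ->//] := disk; rewrite -(QE : Measure.sort Q = _).
by rewrite /giry_bind/= giry_int_map//; exact: measurable_giry_ev.
Qed.

Lemma kernel_null (N : set (borel M)) : measurable N -> mu N = 0 ->
  {ae Q, forall x, k x N = 0}.
Proof.
move=> mN N0; have mk : measurable_fun setT (fun x => k x N).
  exact: measurable_kernel.
have : \int[Q]_x `|k x N| = 0.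
  under eq_integral do rewrite gee0_abs//.
  by rewrite (QE : Measure.sort Q = _); have [_ <-] := disk.
move/(ae_eq_integral_abs _ measurableT mk); apply: filterS => x; exact.
Qed.

End disintegrations.

Section folding_bounds.
Local Open Scope ereal_scope.
Context {R : realType} {M : ptopologicalType}.
Hypothesis M_hausdorff : hausdorff_space M.
Variable f : M -> M.
Hypothesis f_continuous : continuous f.
Variables (mu : probability (borel M) R) (k : R.-pker borel M ~> borel M).
Hypothesis disk : disintegration f mu k.
Let Q := sval (image_prob f_continuous mu).
Let QE : (Q : set (borel M) -> \bar R) = image_measure f mu :=
  svalP (image_prob f_continuous mu).
Let point_measurable := measurable_point M_hausdorff.

Lemma point_entropy_ge0 (m : {measure set borel M -> \bar R}) : m setT = 1 ->
  0 <= point_entropy m.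
Proof.
move=> m1; rewrite /point_entropy; case: ifP => // _; apply: esum_ge0 => y _.
exact: fine_entropy_term_ge0.
Qed.

Lemma measurable_fine_kernel (A : set (borel M)) : measurable A ->
  measurable_fun setT (fun x => fine (k x A)).
Proof. by move=> mA; apply: measurableT_comp => //; exact: measurable_kernel. Qed.

(** Almost every [k x] lives on the fibre above [x], where [h (f y)] is the constant [h x] and
    leaves the inner integral. *)
Lemma integral_kernel_piece (A : set (borel M)) (h : borel M -> R) :
  measurable A -> measurable_fun setT h -> (forall x, 0 <= h x)%R ->
  \int[mu]_y (h (f y) * \1_A y)%:E = \int[Q]_x (h x * fine (k x A))%:E.
Proof.
move=> mA mh h0.
have mhf : measurable_fun setT (fun y : borel M => h (f y)).
  exact: (measurableT_comp mh (continuous_borel f_continuous)).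
have mhA : measurable_fun setT (fun y : borel M => (h (f y) * \1_A y)%:E).
  apply/measurable_EFinP; apply: measurable_funM => //.
have hA0 y : 0 <= (h (f y) * \1_A y)%:E by rewrite lee_fin mulr_ge0.
rewrite (integral_disintegration f_continuous disk)//.
apply: ge0_ae_eq_integral => //.
- exact: measurable_integral_kernel.
- apply/measurable_EFinP; apply: measurable_funM => //.
  exact: measurable_fine_kernel.
- by move=> x _; exact: integral_ge0.
- by move=> x _; rewrite lee_fin mulr_ge0// fine_ge0.
have := kernel_fiber f_continuous disk; apply: filterS => x kx1 _.
have mF := measurable_fiber M_hausdorff f_continuous x.
have k1 : k x setT = 1 by exact: prob_kernel.
rewrite EFinM -(measure1_fine k1 mA) -[X in k x X](setIT A) -integral_indic//.
rewrite -ge0_integralZl ?lee_fin//; last first.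
  by apply/measurable_EFinP; exact: measurable_indic.
apply: ge0_ae_eq_integral => //.
- by apply: measurable_funeM; apply/measurable_EFinP; exact: measurable_indic.
- by move=> y _; rewrite mule_ge0// lee_fin.
exists (~` (f @^-1` [set x])); split; first exact: measurableC.
  exact: measure1_setC0.
by move=> y /= hy fy; apply: hy => _; rewrite fy EFinM.
Qed.

(** [Z] will be the degenerate set: outside it the fibres are countable, so [k x] is carried by
    countably many points, and the weights are positive. The fibre sum of [w] is replaced by its
    bound [C], which is integrated against the image measure, while [G] is integrated against [mu]
    itself. *)
Lemma folding_upper (Z : set (borel M)) (w G C : borel M -> R) :
  measurable Z -> mu Z = 0 ->
  (forall x, countable (f @^-1` [set x] `\` Z)) ->
  measurable_fun setT G -> measurable_fun setT C ->
  (forall y, 0 <= w y)%R -> (forall y, 0 <= G y)%R -> (forall y, 0 <= C y)%R ->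
  (forall y t, ~ Z y -> 0 <= t <= 1 -> - (t * ln t) + t <= w y + t * G y)%R ->
  (forall x, \esum_(y in f @^-1` [set x] `\` Z) (w y)%:E <= (C x)%:E) ->
  \int[image_measure f mu]_x point_entropy (k x) + 1 <=
  \int[mu]_y (C (f y))%:E + \int[mu]_y (G y)%:E.
Proof.
move=> mZ Z0 cfib mG mC w0 G0 C0 gibbs wC; rewrite -QE.
pose H x := (C x)%:E + \int[k x]_y (G y)%:E.
have mH : measurable_fun setT H.
  apply: emeasurable_funD; first exact/measurable_EFinP.
  by apply: measurable_integral_kernel => //; exact/measurable_EFinP.
have H0 x : 0 <= H x by rewrite adde_ge0 ?lee_fin// integral_ge0// => y _; rewrite lee_fin.
have hH : {ae Q, forall x, point_entropy (k x) + 1 <= H x}.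
  have := kernel_null f_continuous disk mZ Z0.
  have := kernel_fiber f_continuous disk; apply: filterS2 => x kx1 kZ.
  have k1 : k x setT = 1 by exact: prob_kernel.
  have mF := measurable_fiber M_hausdorff f_continuous x.
  apply: le_trans (leeD2r _ (wC x)).
  apply: (@point_entropy_upper _ _ point_measurable) => //.
    rewrite -kx1 [RHS](measureDI (k x) mF mZ) [X in _ = _ + X](_ : _ = 0) ?adde0//.
    apply/eqP; rewrite eq_le measure_ge0 andbT -kZ le_measure ?inE//.
    exact: measurableI.
  by move=> y t [_ Zy]; exact: gibbs.
(* A measurable majorant of the entropy. The maximum keeps it nonnegative on the null set where
   [1 <= H x] may fail. *)
pose H' x := maxe (H x - 1) 0.
have mH' : measurable_fun setT H'.
  apply: measurable_maxe => //; exact: emeasurable_funB.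
have H'0 x : 0 <= H' x by rewrite /H' le_max lexx orbT.
have E0 x : 0 <= point_entropy (k x) by apply: point_entropy_ge0; exact: prob_kernel.
have FH : \int[Q]_x point_entropy (k x) <= \int[Q]_x H' x.
  apply: ae_le_integral_measurable_right => //.
  apply: filterS hH => x hx; rewrite /H' le_max; apply/orP; left.
  by rewrite leeBrDr.
apply: (le_trans (leeD2r 1 FH)).
have HE : \int[Q]_x H' x + 1 = \int[Q]_x H x.
  have {1}-> : 1 = \int[Q]_x (cst 1 x) by rewrite integral_cst// mul1e; exact/esym/probability_setT.
  rewrite -ge0_integralD//.
  apply: ge0_ae_eq_integral => //.
  - exact: emeasurable_funD.
  - by move=> x _; rewrite adde_ge0.
  apply: filterS hH => x hx _; rewrite /H'.
  have h1 : 1 <= H x by apply: le_trans hx; rewrite leeDr.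
  have HN : 0 <= H x - 1 by rewrite sube_ge0.
  by rewrite max_l// subeK.
have mG' : measurable_fun setT (EFin \o G) by exact/measurable_EFinP.
have G0' y : 0 <= (G y)%:E by rewrite lee_fin.
rewrite HE /H ge0_integralD//; try by [move=> x _; rewrite lee_fin|
  exact/measurable_EFinP|exact: measurable_integral_kernel|
  move=> x _; exact: integral_ge0].
rewrite -(integral_disintegration f_continuous disk)//.
rewrite leeD2r// (QE : Measure.sort Q = _).
rewrite (integral_image f_continuous mu (h := EFin \o C))//.
exact/measurable_EFinP.
Qed.

Lemma folding_lower (n : nat) (A : nat -> set (borel M)) :
  (forall i, measurable (A i)) -> trivIset setT A ->
  (forall i x y, A i x -> A i y -> f x = f y -> x = y) ->
  \sum_(i < n) \int[Q]_x (- (fine (k x (A i)) * ln (fine (k x (A i)))))%:E <=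
  \int[image_measure f mu]_x point_entropy (k x).
Proof.
move=> mA tA injA; rewrite -QE.
have mt i : measurable_fun setT
    (fun x => (- (fine (k x (A i)) * ln (fine (k x (A i)))))%:E).
  have mk := measurable_fine_kernel (mA i).
  apply/measurable_EFinP; apply: measurableT_comp => //.
  apply: measurable_funM => //.
  by apply: measurableT_comp => //; exact: measurable_ln.
have t0 i x : 0 <= (- (fine (k x (A i)) * ln (fine (k x (A i)))))%:E.
  by apply: fine_entropy_term_ge0 => //; exact: prob_kernel.
rewrite -ge0_integral_sum//.
apply: ae_le_integral_measurable_left.
- by move=> x; exact: sume_ge0.
- by move=> x; apply: point_entropy_ge0; exact: prob_kernel.
- exact: emeasurable_sum.
have := kernel_fiber f_continuous disk; apply: filterS => x kx1.
apply: (@point_entropy_lower _ _ point_measurable _ _ n A (f @^-1` [set x])) => //.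
- exact: prob_kernel.
- exact: measurable_fiber.
- by move=> i y z Ay Az /= fy fz; apply: (injA i) => //; rewrite fy fz.
Qed.

End folding_bounds.

(** * Continuous upper bounds for the folding entropy *)

Section truncated_log.
Context {R : realType}.
Variable tau : R.
Hypothesis tau01 : 0 < tau <= 1.

(** Clamping at [tau] makes the logarithm bounded, continuous and Lipschitz with constant 1 / tau;
    clamping at 1 keeps the result nonnegative. *)
Definition trunc_log (v : R) : R := - ln (Num.max (Num.min v 1) tau).

Let trunc_itv (v : R) : tau <= Num.max (Num.min v 1) tau <= 1.
Proof. by rewrite le_max lexx orbT ge_max ge_min lexx orbT; case/andP: tau01. Qed.

Let trunc_gt0 (v : R) : 0 < Num.max (Num.min v 1) tau.
Proof.
have /andP[+ _] := trunc_itv v; apply: lt_le_trans; by case/andP: tau01.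
Qed.

Lemma trunc_log_ge0 v : 0 <= trunc_log v.
Proof. by rewrite oppr_ge0 ln_le0//; have /andP[] := trunc_itv v. Qed.

Lemma trunc_log_le v : trunc_log v <= - ln tau.
Proof.
rewrite lerN2 ler_ln ?posrE//; first by have /andP[] := trunc_itv v.
by case/andP: tau01.
Qed.

Lemma trunc_log_ninc v v' : v <= v' -> trunc_log v' <= trunc_log v.
Proof.
move=> vv'; rewrite lerN2 ler_ln ?posrE//.
by rewrite ge_max !le_max lexx orbT andbT le_min !ge_min vv' lexx !orbT.
Qed.

Lemma trunc_log_lipschitz v v' :
  trunc_log v <= trunc_log v' + tau^-1 * `|v - v'|.
Proof.
have tau0 : 0 < tau by case/andP: tau01.
have [vv'|vv'] := leP v' v.
  apply: (le_trans (trunc_log_ninc vv')).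
  by rewrite lerDl mulr_ge0 ?invr_ge0// ltW.
set a := Num.max (Num.min v 1) tau; set b := Num.max (Num.min v' 1) tau.
have a0 : 0 < a := trunc_gt0 v; have b0 : 0 < b := trunc_gt0 v'.
have atau : tau <= a by have /andP[] := trunc_itv v.
have ab : b - a <= v' - v.
  rewrite /a /b /Num.max /Num.min; do ?case: ifPn; rewrite -?leNgt; lra.
have : ln (b / a) <= b / a - 1.
  have := @le_ln1Dx R (b / a - 1); rewrite addrCA subrr addr0; apply.
  by rewrite ltrBrDl subrr divr_gt0.
rewrite ln_div ?posrE// /trunc_log -/a -/b => h.
have h2 : b / a - 1 <= tau^-1 * `|v - v'|.
  have -> : b / a - 1 = a^-1 * (b - a) by rewrite mulrBr mulVf ?gt_eqF// mulrC.
  apply: (@le_trans _ _ (a^-1 * `|v - v'|)).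
    by rewrite ler_pM2l ?invr_gt0// distrC (le_trans ab)// ler_norm.
  by rewrite ler_wpM2r// lef_pV2 ?posrE.
lra.
Qed.

Lemma continuous_trunc_log : continuous trunc_log.
Proof.
move=> v; rewrite /trunc_log; apply: cvgN.
apply: continuous_cvg; first exact: (continuous_ln (trunc_gt0 v)).
apply: (@continuous_max R R (fun v => Num.min v 1) (fun=> tau)); last exact: cvg_cst.
by apply: (@continuous_min R R id (fun=> 1)); [exact: cvg_id|exact: cvg_cst].
Qed.

(* With [w >= eps * J ^+ N] and [tau = eps * dlt ^+ N], truncating the weight at
   [tau] costs at most [N * - ln J], and only where [J < dlt]. *)
Lemma gibbs_trunc_log (eps dlt J w t : R) (N : nat) :
  0 < eps <= 1 -> 0 < dlt <= 1 -> tau = eps * dlt ^+ N -> 0 < J ->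
  eps * J ^+ N <= w -> 0 <= t <= 1 ->
  - (t * ln t) + t <=
    w + t * (trunc_log w + N%:R * (if J < dlt then - ln J else 0)).
Proof.
move=> /andP[eps0 eps1] /andP[d0 d1] tauE J0 wJ /andP[t0 t1].
have tau0 : 0 < tau by case/andP: tau01.
have w0 : 0 < w by rewrite (lt_le_trans _ wJ)// mulr_gt0// exprn_gt0.
set l := if _ then _ else _.
have l0 : 0 <= l.
  by rewrite /l; case: ifPn => // Jd; rewrite oppr_ge0 ln_le0// (le_trans (ltW Jd)).
have Nl0 : 0 <= N%:R * l by rewrite mulr_ge0.
(* If [tau <= w], the lower clamp is inactive and Gibbs' inequality for min(w, 1) suffices. If
   [w < tau], then eps J^N < eps dlt^N forces [J < dlt], so that the error term is present. *)
have [wtau|wtau] := leP tau w.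
  have m0 : 0 < Num.min w 1 by rewrite lt_min w0 ltr01.
  apply: (le_trans (gibbs_le t0 m0)); apply: lerD; first by rewrite ge_min lexx.
  rewrite ler_wpM2l// /trunc_log max_l ?lerDl//.
  by rewrite le_min wtau; case/andP: tau01.
have Jd : J < dlt.
  rewrite ltNge; apply/negP => dJ; move: wtau; rewrite ltNge => /negP; apply.
  apply: le_trans wJ; rewrite tauE ler_pM2l//.
  by apply: lerXn2r => //; rewrite nnegrE ltW.
apply: (le_trans (gibbs_le t0 w0)); rewrite lerD2l ler_wpM2l//.
have -> : trunc_log w = - ln tau.
  rewrite /trunc_log max_r// ge_min ltW//.
rewrite /l Jd tauE lnM ?posrE ?exprn_gt0// lnXn// -mulr_natl.
have : ln (eps * J ^+ N) <= ln w by rewrite ler_ln ?posrE// mulr_gt0// exprn_gt0.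
rewrite lnM ?posrE ?exprn_gt0// lnXn// -mulr_natl.
have : N%:R * ln dlt <= 0 by rewrite mulr_ge0_le0// ln_le0.
lra.
Qed.

End truncated_log.

Section weights.
Local Open Scope ereal_scope.
Context {R : realType} {M : ptopologicalType}.
Hypothesis M_hausdorff : hausdorff_space M.
Variable f : M -> M.
Hypothesis f_continuous : continuous f.
Variable J : M -> R.
Hypothesis J_continuous : continuous J.
Hypothesis J_ge0 : forall x, (0 <= J x)%R.
Variables (N : nat) (C0 : R).
Hypothesis fiber_sum : forall x (s : seq M), uniq s ->
  (forall y, y \in s -> f y = x) -> (\sum_(y <- s) J y ^+ N <= C0)%R.
Variables (eps dlt : R).
Hypotheses (eps01 : (0 < eps <= 1)%R) (dlt01 : (0 < dlt <= 1)%R).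
Let tau := (eps * dlt ^+ N)%R.
Variables (n : nat) (s chi : nat -> M -> R).
Hypothesis s_continuous : forall i, continuous (s i).
Hypothesis s01 : forall i x, (0 <= s i x <= 1)%R.
Hypothesis chi_continuous : forall i, continuous (chi i).
Hypothesis chi01 : forall i x, (0 <= chi i x <= 1)%R.
Hypothesis chi_inj : forall i x y,
  chi i x != 0%R -> chi i y != 0%R -> f x = f y -> x = y.

(* [s i] stands for a continuous approximation of the conditional mass
   [x |-> k x (A i)] of a set [A i] on which [f] is injective, and [chi i] for one
   of the indicator of [A i].  By [chi_inj], each fibre meets the support of
   [chi i] at most once, whence [weight_fiber_sum]. *)
Definition weight (y : M) : R :=
  (eps * J y ^+ N + \sum_(i < n) s i (f y) * chi i y)%R.

Definition fiber_bound (x : M) : R := (eps * C0 + \sum_(i < n) s i x)%R.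

(** The integrand on the right of Gibbs' inequality: a bound for the fibre sum of the weights,
    pulled back to [M], plus the truncated [- ln] of the weight. It is continuous, so its integral
    is weak-* continuous in the measure. *)
Definition weight_potential (y : M) : R :=
  (fiber_bound (f y) + trunc_log tau (weight y))%R.

Let tau01 : (0 < tau <= 1)%R.
Proof.
case/andP: eps01 => e0 e1; case/andP: dlt01 => d0 d1.
by rewrite mulr_gt0 ?exprn_gt0//= mulr_ile1 ?exprn_ge0 ?exprn_ile1//; exact: ltW.
Qed.

Let C0_ge0 : (0 <= C0)%R.
Proof. by have := @fiber_sum point [::] isT; rewrite big_nil; apply. Qed.

Let s0 i x : (0 <= s i x)%R. Proof. by case/andP: (s01 i x). Qed.
Let chi0 i x : (0 <= chi i x)%R. Proof. by case/andP: (chi01 i x). Qed.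
Let eps0 : (0 < eps)%R. Proof. by case/andP: eps01. Qed.

Lemma weight_ge y : (eps * J y ^+ N <= weight y)%R.
Proof. by rewrite lerDl sumr_ge0// => i _; rewrite mulr_ge0. Qed.

Lemma weight_ge0 y : (0 <= weight y)%R.
Proof. by apply: le_trans (weight_ge y); rewrite mulr_ge0 ?exprn_ge0// ltW. Qed.

Lemma fiber_bound_ge0 x : (0 <= fiber_bound x)%R.
Proof. by rewrite addr_ge0 ?sumr_ge0// mulr_ge0// ltW. Qed.

Lemma sum_inj_le1 i x (r : seq M) : uniq r -> (forall y, y \in r -> f y = x) ->
  (\sum_(y <- r) chi i y <= 1)%R.
Proof.
move=> ur rx; have [[y yr cy]|h] := pselect (exists2 y, y \in r & chi i y != 0%R).
  rewrite (bigD1_seq y)//= big_seq_cond big1 ?addr0.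
    by case/andP: (chi01 i y).
  move=> z /andP[zr zy]; apply: contraNeq zy => cz; apply/eqP.
  by apply: (chi_inj cz cy); rewrite !rx.
rewrite big_seq big1 ?ler01// => y yr; apply: contrapT => cy; apply: h.
by exists y => //; apply/eqP.
Qed.

Lemma weight_fiber_sum (D : set M) x : D `<=` f @^-1` [set x] ->
  \esum_(y in D) (weight y)%:E <= (fiber_bound x)%:E.
Proof.
move=> Dx; apply: ge_ereal_sup => _ [A [fA AD] <-].
rewrite fsbig_finite// sumEFin lee_fin /weight.
set r := finmap.enum_fset (fset_set A).
have ur : uniq r := finmap.fset_uniq _.
have rx y : y \in r -> f y = x.
  by rewrite in_fset_set// => /set_mem /AD /Dx.
rewrite big_split/= lerD//.
  by rewrite -mulr_sumr ler_pM2l// (@fiber_sum x).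
rewrite exchange_big/=; apply: ler_sum => i _.
rewrite big_seq (eq_bigr (fun y => s i x * chi i y)%R); last first.
  by move=> y /rx ->.
rewrite -big_seq -mulr_sumr ler_piMr//.
exact: sum_inj_le1 ur rx.
Qed.

Lemma continuous_fiber_bound : continuous fiber_bound.
Proof.
move=> x; rewrite /fiber_bound; apply: cvgD; first exact: cvg_cst.
exact: continuous_sum_real.
Qed.

Lemma continuous_weight : continuous weight.
Proof.
move=> x; rewrite /weight; apply: cvgD.
  apply: cvgM; first exact: cvg_cst.
  by apply: (@continuous_comp _ _ _ J (fun t => t ^+ N)%R); [exact: J_continuous|
    exact: exprn_continuous].
apply: (@continuous_sum_real R M n (fun i y => s i (f y) * chi i y)%R) => i y.
apply: cvgM; last exact: chi_continuous.
by apply: continuous_cvg; [exact: s_continuous|exact: f_continuous].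
Qed.

Lemma continuous_trunc_weight : continuous (trunc_log tau \o weight).
Proof.
move=> x; apply: continuous_comp; first exact: continuous_weight.
exact: (continuous_trunc_log tau01).
Qed.

Lemma continuous_weight_potential : continuous weight_potential.
Proof.
move=> x; rewrite /weight_potential; apply: cvgD; last exact: continuous_trunc_weight.
by apply: continuous_cvg; [exact: continuous_fiber_bound|exact: f_continuous].
Qed.

(** [G] is the truncated logarithm of the weight plus N (- ln J) on the set J < dlt. The second
    summand is the only part not expressed by a continuous function, and the tail hypothesis bounds
    its integral. *)
Lemma folding_le_weight_potential (nu : probability (borel M) R)
    (k : R.-pker borel M ~> borel M) (kappa : R) :
  disintegration f nu k ->
  (forall x, countable (f @^-1` [set x] `\` [set y | J y = 0%R])) ->
  nu [set y | J y = 0%R] = 0 ->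
  \int[nu]_(x in [set x | (J x < dlt)%R]) (- ln (J x))%:E <= kappa%:E ->
  \int[image_measure f nu]_x point_entropy (k x) + 1 <=
  \int[nu]_y (weight_potential y)%:E + (N%:R * kappa)%:E.
Proof.
move=> disk cfib nuZ tail.
have mJ := continuous_borel_real J_continuous.
have mZ : measurable ([set y | J y = 0%R] : set (borel M)).
  rewrite -[X in measurable X](setTI (J @^-1` [set 0%R])).
  by apply: mJ => //; exact: measurable_set1.
pose l (y : M) := (if J y < dlt then - ln (J y) else 0)%R.
have md : measurable ([set x | (J x < dlt)%R] : set (borel M)).
  rewrite (_ : [set x | _] = setT `&` J @^-1` `]-oo, dlt[%classic).
    by apply: mJ => //; exact: measurable_itv.
  by apply/seteqP; split => x /=; rewrite in_itv//=; case.
have ml : measurable_fun setT (l : borel M -> R).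
  apply: measurable_fun_ifT => //.
    exact: measurable_fun_ltr.
  apply: measurableT_comp => //.
  exact: (measurableT_comp (@measurable_ln R) mJ).
have l0 y : (0 <= l y)%R.
  rewrite /l; case: ifPn => // Jd; rewrite oppr_ge0 ln_le0//.
  by case/andP: dlt01 => _ d1; rewrite (le_trans (ltW Jd)).
have mw : measurable_fun setT (trunc_log tau \o weight : borel M -> R).
  by apply: continuous_borel_real; exact: continuous_trunc_weight.
have mC : measurable_fun setT (fiber_bound : borel M -> R).
  by apply: continuous_borel_real; exact: continuous_fiber_bound.
have mCf : measurable_fun setT (fiber_bound \o f : borel M -> R).
  exact: (measurableT_comp mC (continuous_borel f_continuous)).
have mNl : measurable_fun setT (fun y : borel M => (N%:R * l y)%R).
  exact: measurable_funM.
pose G y := (trunc_log tau (weight y) + N%:R * l y)%R.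
apply: le_trans.
  apply: (@folding_upper _ _ M_hausdorff _ f_continuous _ _ disk
    [set y | J y = 0%R] weight G fiber_bound) => //.
  - exact: measurable_funD.
  - exact: weight_ge0.
  - by move=> y; rewrite addr_ge0 ?trunc_log_ge0// mulr_ge0.
  - exact: fiber_bound_ge0.
  - move=> y t Jy t01.
    apply: (gibbs_trunc_log tau01 eps01 dlt01 erefl _ (weight_ge y) t01).
    by rewrite lt_def J_ge0 andbT; apply/eqP.
  - by move=> x; apply: weight_fiber_sum => y [].
rewrite /weight_potential; under [in leRHS]eq_integral do rewrite EFinD.
rewrite /G; under [X in _ + X <= _]eq_integral do rewrite EFinD.
have C0f y : 0 <= (fiber_bound (f y))%:E by rewrite lee_fin fiber_bound_ge0.
have t0 y : 0 <= (trunc_log tau (weight y))%:E by rewrite lee_fin trunc_log_ge0.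
have Nl0 y : 0 <= (N%:R * l y)%:E by rewrite lee_fin mulr_ge0.
rewrite !ge0_integralD//; try by apply/measurable_EFinP.
rewrite addeA leeD2l//; under eq_integral do rewrite EFinM.
rewrite ge0_integralZl//; last 3 first;
  try by [apply/measurable_EFinP|move=> y _; rewrite lee_fin|rewrite lee_fin].
rewrite EFinM lee_wpmul2l ?lee_fin//.
rewrite [leLHS](_ : _ = \int[nu]_(x in [set x | (J x < dlt)%R]) (- ln (J x))%:E)//.
rewrite [RHS]integral_mkcond; apply: eq_integral => y _; rewrite /l patchE.
by case: ifPn => Jy; [rewrite mem_set|rewrite memNset//=; apply/negP].
Qed.

End weights.

Section weight_potential_bound.
Local Open Scope ereal_scope.
Context {R : realType} {M : ptopologicalType}.
Hypothesis M_hausdorff : hausdorff_space M.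
Variable f : M -> M.
Hypothesis f_continuous : continuous f.
Variable J : M -> R.
Hypothesis J_continuous : continuous J.
Hypothesis J_ge0 : forall x, (0 <= J x)%R.
Variables (N : nat) (C0 : R).
Hypothesis C0_ge0 : (0 <= C0)%R.
Variables (eps dlt : R).
Hypotheses (eps0 : (0 < eps)%R) (tau01 : (0 < eps * dlt ^+ N <= 1)%R).
Let tau := (eps * dlt ^+ N)%R.
Variables (n : nat) (s chi : nat -> M -> R).
Hypothesis s_continuous : forall i, continuous (s i).
Hypothesis s01 : forall i x, (0 <= s i x <= 1)%R.
Hypothesis chi_continuous : forall i, continuous (chi i).
Hypothesis chi01 : forall i x, (0 <= chi i x <= 1)%R.
Variables (mu : probability (borel M) R) (k : R.-pker borel M ~> borel M).
Hypothesis disk : disintegration f mu k.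
Variables (A : nat -> set (borel M)) (v : nat -> M -> R) (e : R).
Hypothesis mA : forall i, measurable (A i).
Hypothesis tA : trivIset setT A.
Hypothesis injA : forall i x y, A i x -> A i y -> f x = f y -> x = y.
Hypothesis v_continuous : forall i, continuous (v i).
Hypothesis chi_v : forall i y, (`|\1_(A i) y - chi i y| <= `|\1_(A i) y - v i y|)%R.
Let Q := sval (image_prob f_continuous mu).
Let QE : (Q : set (borel M) -> \bar R) = image_measure f mu :=
  svalP (image_prob f_continuous mu).
Let rho i (x : M) : R := fine (k x (A i)).
Hypothesis s_close : forall i, l1_close Q (rho i) (s i) <= e%:E.
Hypothesis v_close : forall i, l1_close mu \1_(A i) (v i) <= e%:E.

Let rho01 i x : (0 <= rho i x <= 1)%R.
Proof. by apply: fine_measure01 => //; exact: prob_kernel. Qed.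

Let mrho i : measurable_fun setT (rho i : borel M -> R).
Proof. exact: measurable_fine_kernel. Qed.

Let ti : (0 <= tau^-1)%R.
Proof. by rewrite invr_ge0 ltW//; case/andP: tau01. Qed.

Let tc := (trunc_log_ge0 tau01).

(** Comparison with the exact weight [w'], in which [s i] and [chi i] are replaced by the
    conditional mass [rho i] and the indicator of [A i]. The Lipschitz bound gives the factors 1 /
    tau, and replacing [s i] by [rho i] in [fiber_bound] gives the 1 in 1 + 1 / tau. On [A i] the
    exact weight is at least [rho i]; off all the [A i] only the bound [- ln tau] remains. *)
Lemma weight_potential_le y :
  (weight_potential f J N C0 eps dlt n s chi y <=
   eps * C0 + \sum_(i < n) (rho i (f y) + trunc_log tau (rho i (f y)) * \1_(A i) y +
     (1 + tau^-1) * `|rho i (f y) - s i (f y)| + tau^-1 * `|\1_(A i) y - v i y|) +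
   - ln tau * \1_(~` \big[setU/set0]_(i < n) A i) y)%R.
Proof.
pose w' := (eps * J y ^+ N + \sum_(i < n) rho i (f y) * \1_(A i) y)%R.
have h1 : (trunc_log tau (weight f J N eps n s chi y) <= trunc_log tau w' +
    tau^-1 * \sum_(i < n) (`|rho i (f y) - s i (f y)| + `|\1_(A i) y - v i y|))%R.
  apply: (le_trans (trunc_log_lipschitz tau01 _ w')); rewrite lerD2l ler_wpM2l//.
  rewrite /weight /w' opprD addrACA subrr add0r -sumrB.
  apply: (le_trans (ler_norm_sum _ _ _)); apply: ler_sum => i _.
  rewrite distrC.
  have -> : (rho i (f y) * \1_(A i) y - s i (f y) * chi i y =
    (rho i (f y) - s i (f y)) * \1_(A i) y + s i (f y) * (\1_(A i) y - chi i y))%R by ring.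
  apply: (le_trans (ler_normD _ _)); rewrite !normrM; apply: lerD.
    by rewrite ler_piMr// indicE; case: (_ \in _); rewrite ?normr1 ?normr0 ?ler01.
  apply: le_trans (chi_v i y); rewrite ler_piMl//.
  by have /andP[? ?] := s01 i (f y); rewrite ger0_norm.
have h2 : (trunc_log tau w' <= \sum_(i < n) trunc_log tau (rho i (f y)) * \1_(A i) y +
    - ln tau * \1_(~` \big[setU/set0]_(i < n) A i) y)%R.
  have s0 : (0 <= \sum_(i < n) trunc_log tau (rho i (f y)) * \1_(A i) y)%R.
    by apply: sumr_ge0 => i _; rewrite mulr_ge0// tc.
  have [yA|yA] := pselect ((\big[setU/set0]_(i < n) A i) y); last first.
    have -> : \1_(~` \big[setU/set0]_(i < n) A i) y = 1%R :> R.
      by rewrite indicE mem_set.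
    rewrite mulr1.
    by apply: (le_trans (trunc_log_le tau01 _)); rewrite lerDr.
  have -> : \1_(~` \big[setU/set0]_(i < n) A i) y = 0%R :> R.
    by rewrite indicE memNset//; exact.
  rewrite mulr0 addr0.
  have [i /= ni Ay] : exists2 i, (i < n)%N & A i y.
    by move: yA; rewrite -bigcup_mkord => -[i /= ni Ay]; exists i.
  rewrite (bigD1 (Ordinal ni))//= indicE mem_set// mulr1.
  apply: (@le_trans _ _ (trunc_log tau (rho i (f y)))); last first.
    by rewrite lerDl sumr_ge0// => j _; rewrite mulr_ge0// tc.
  apply: (trunc_log_ninc tau01); rewrite /w' (bigD1 (Ordinal ni))//= indicE mem_set// mulr1.
  rewrite addrCA lerDl addr_ge0//.
    by rewrite mulr_ge0 ?exprn_ge0// ltW.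
  by apply: sumr_ge0 => j _; rewrite mulr_ge0//; case/andP: (rho01 j (f y)).
rewrite /weight_potential /fiber_bound.
have h3 : (\sum_(i < n) s i (f y) <= \sum_(i < n) (rho i (f y) + `|rho i (f y) - s i (f y)|))%R.
  apply: ler_sum => i _; rewrite -lerBlDl distrC; apply: ler_norm.
move: h1 h2 h3; rewrite !big_split/= -!mulr_sumr; rewrite -/tau.
set a := weight _ _ _ _ _ _ _ _.
move=> h1 h2 h3; lra.
Qed.

Let phi i x := (- (rho i x * ln (rho i x)))%R.

Lemma rho_trunc_log_le i x : (trunc_log tau (rho i x) * rho i x <= phi i x)%R.
Proof.
have /andP[r0 r1] := rho01 i x; rewrite /phi -mulrN mulrC.
move: r0; rewrite le_eqVlt => /orP[/eqP <-|r0]; first by rewrite !mul0r.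
rewrite ler_pM2l// lerN2 ler_ln ?posrE//; first by rewrite min_l// le_max lexx.
by rewrite lt_max lt_min r0 ltr01.
Qed.

(** This is the near equality in Gibbs' inequality at [mu]. The masses [rho i] integrate to mu(A_i),
    at most 1 in total, and the terms with [trunc_log] integrate to at most the entropy terms of the
    conditional masses, whose sum is bounded by the folding entropy. The two approximation errors
    add (1 + 1 / tau) e and e / tau for each [i]. *)
Lemma integral_weight_potential_le :
  \int[mu]_y (weight_potential f J N C0 eps dlt n s chi y)%:E <=
  (eps * C0 + 1 + n%:R * (e * (1 + 2 * tau^-1)) +
   - ln tau * fine (mu (~` \big[setU/set0]_(i < n) A i)))%:E +
  \int[image_measure f mu]_x point_entropy (k x).
Proof.
pose A0 : set (borel M) := ~` \big[setU/set0]_(i < n) A i.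
have mA0 : measurable A0 by apply: measurableC; exact: bigsetU_measurable.
have mf := continuous_borel f_continuous.
pose t1 i y := rho i (f y).
pose t2 i y := (trunc_log tau (rho i (f y)) * \1_(A i) y)%R.
pose t3 i y := ((1 + tau^-1) * `|rho i (f y) - s i (f y)|)%R.
pose t4 i y := (tau^-1 * `|\1_(A i) y - v i y|)%R.
pose t5 (y : M) := (- ln tau * \1_A0 y)%R.
have mtl i : measurable_fun setT (fun x : borel M => trunc_log tau (rho i x)).
  apply: measurableT_comp => //.
  by apply: continuous_measurable_fun; exact: continuous_trunc_log.
have mrhof i : measurable_fun setT (fun y : borel M => rho i (f y)).
  exact: (measurableT_comp (mrho i) mf).
have ms i : measurable_fun setT (s i : borel M -> R) by exact: continuous_borel_real.
have mv i : measurable_fun setT (v i : borel M -> R) by exact: continuous_borel_real.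
have m1 i : measurable_fun setT (EFin \o t1 i : borel M -> \bar R).
  by apply/measurable_EFinP; exact: mrhof.
have m2 i : measurable_fun setT (EFin \o t2 i : borel M -> \bar R).
  apply/measurable_EFinP; apply: measurable_funM => //.
  exact: (measurableT_comp (mtl i) mf).
have m3 i : measurable_fun setT (EFin \o t3 i : borel M -> \bar R).
  apply/measurable_EFinP; apply: measurable_funM => //.
  apply: measurableT_comp => //; apply: measurable_funB => //.
  exact: (measurableT_comp (ms i) mf).
have m4 i : measurable_fun setT (EFin \o t4 i : borel M -> \bar R).
  apply/measurable_EFinP; apply: measurable_funM => //.
  by apply: measurableT_comp => //; apply: measurable_funB.
have m5 : measurable_fun setT (EFin \o t5 : borel M -> \bar R).
  by apply/measurable_EFinP; apply: measurable_funM.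
have lt0 : (0 <= - ln tau)%R by rewrite oppr_ge0 ln_le0//; case/andP: tau01.
have p1 i y : 0 <= (t1 i y)%:E by rewrite lee_fin; case/andP: (rho01 i (f y)).
have p2 i y : 0 <= (t2 i y)%:E by rewrite lee_fin mulr_ge0// tc.
have p3 i y : 0 <= (t3 i y)%:E by rewrite lee_fin mulr_ge0// addr_ge0.
have p4 i y : 0 <= (t4 i y)%:E by rewrite lee_fin mulr_ge0.
have p5 y : 0 <= (t5 y)%:E by rewrite lee_fin mulr_ge0.
have eC : (0 <= eps * C0)%R by rewrite mulr_ge0// ltW.
apply: (@le_trans _ _ (\int[mu]_y ((eps * C0)%:E +
   \sum_(i < n) ((t1 i y)%:E + (t2 i y)%:E + (t3 i y)%:E + (t4 i y)%:E) + (t5 y)%:E))).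
  apply: ge0_le_integral_any => y.
    rewrite lee_fin; apply: addr_ge0; last exact: tc.
    rewrite addr_ge0// sumr_ge0// => i _; by case/andP: (s01 i (f y)).
  under eq_bigr do rewrite -!EFinD.
  by rewrite sumEFin -!EFinD lee_fin weight_potential_le.
have m14 i : measurable_fun setT (fun y : borel M =>
    (t1 i y)%:E + (t2 i y)%:E + (t3 i y)%:E + (t4 i y)%:E).
  exact: (emeasurable_funD (emeasurable_funD (emeasurable_funD (m1 i) (m2 i)) (m3 i)) (m4 i)).
have p14 i y : 0 <= (t1 i y)%:E + (t2 i y)%:E + (t3 i y)%:E + (t4 i y)%:E.
  by rewrite !adde_ge0.
rewrite ge0_integralD//; last 2 first.
- by move=> y _; rewrite adde_ge0 ?lee_fin// sume_ge0.
- by apply: emeasurable_funD => //; exact: emeasurable_sum.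
rewrite ge0_integralD//; last 2 first.
- by move=> y _; exact: sume_ge0.
- exact: emeasurable_sum.
rewrite ge0_integral_sum// integral_cst//= probability_setT mule1.
have -> : \int[mu]_y (t5 y)%:E = (- ln tau * fine (mu A0))%:E.
  rewrite /t5; under eq_integral do rewrite EFinM.
  rewrite ge0_integralZl_EFin//; last first.
    by apply/measurable_EFinP; exact: measurable_indic.
  by rewrite integral_indic// setIT EFinM fineK// fin_num_measure.
have sum_le i : \int[mu]_y ((t1 i y)%:E + (t2 i y)%:E + (t3 i y)%:E + (t4 i y)%:E) <=
    (mu (A i) + \int[Q]_x (phi i x)%:E) + (e * (1 + 2 * tau^-1))%:E.
  have i1 : \int[mu]_y (t1 i y)%:E = mu (A i).
    have [_ ->//] := disk; rewrite integral_image//.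
    - by apply: eq_integral => y _; rewrite /t1 /rho -measure1_fine//; exact: prob_kernel.
    - exact: measurable_kernel.
  have i2 : \int[mu]_y (t2 i y)%:E <= \int[Q]_x (phi i x)%:E.
    rewrite /t2 (integral_kernel_piece M_hausdorff f_continuous disk
      (h := fun x => trunc_log tau (rho i x)))//.
    apply: ge0_le_integral_any => x; rewrite lee_fin; last exact: rho_trunc_log_le.
    by rewrite mulr_ge0// ?tc//; case/andP: (rho01 i x).
  have i3 : \int[mu]_y (t3 i y)%:E <= ((1 + tau^-1) * e)%:E.
    rewrite /t3; under eq_integral do rewrite EFinM.
    rewrite ge0_integralZl_EFin ?addr_ge0//; last first.
      apply/measurable_EFinP; apply: measurableT_comp => //; apply: measurable_funB => //.
      exact: (measurableT_comp (ms i) mf).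
    rewrite EFinM lee_wpmul2l ?lee_fin ?addr_ge0//; apply: le_trans (s_close i).
    rewrite /l1_close (QE : Measure.sort Q = _).
    rewrite (integral_image f_continuous mu (h := fun x => `|rho i x - s i x|%:E))//.
    exact: measurable_l1 (mrho i) (ms i).
  have i4 : \int[mu]_y (t4 i y)%:E <= (tau^-1 * e)%:E.
    rewrite /t4; under eq_integral do rewrite EFinM.
    have mi : measurable_fun setT (\1_(A i) : borel M -> R) by exact: measurable_indic.
    have ml := measurable_l1 mi (mv i).
    rewrite ge0_integralZl_EFin//.
    by rewrite EFinM lee_wpmul2l ?lee_fin//; exact: v_close.
  have m12 : measurable_fun setT (fun y : borel M => (t1 i y)%:E + (t2 i y)%:E).
    exact: (emeasurable_funD (m1 i) (m2 i)).
  have m123 : measurable_fun setT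
      (fun y : borel M => (t1 i y)%:E + (t2 i y)%:E + (t3 i y)%:E).
    exact: (emeasurable_funD m12 (m3 i)).
  have p12 y : 0 <= (t1 i y)%:E + (t2 i y)%:E by rewrite adde_ge0.
  have p123 y : 0 <= (t1 i y)%:E + (t2 i y)%:E + (t3 i y)%:E by rewrite adde_ge0.
  rewrite ge0_integralD//; try exact: m4.
  rewrite ge0_integralD//; try exact: m3.
  rewrite ge0_integralD//; try by [exact: m1|exact: m2].
  rewrite i1 (_ : e * (1 + 2 * tau^-1) = (1 + tau^-1) * e + tau^-1 * e)%R; last by ring.
  rewrite [X in _ <= _ + X]EFinD [leRHS]addeA.
  by rewrite leeD// leeD// leeD2l.
have hsum : \sum_(i < n) mu (A i) <= 1.
  rewrite -measure_bigsetU//.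
  by apply: probability_le1; exact: bigsetU_measurable.
have hphi : \sum_(i < n) \int[Q]_x (phi i x)%:E <=
    \int[image_measure f mu]_x point_entropy (k x).
  exact: (folding_lower M_hausdorff f_continuous disk n mA tA injA).
apply: (@le_trans _ _ ((eps * C0)%:E + (1 + \int[image_measure f mu]_x point_entropy (k x) +
    (n%:R * (e * (1 + 2 * tau^-1)))%:E) + (- ln tau * fine (mu A0))%:E)).
  rewrite leeD2r// leeD2l//.
  apply: (@le_trans _ _ (\sum_(i < n) (mu (A i) + \int[Q]_x (phi i x)%:E +
    (e * (1 + 2 * tau^-1))%:E))); first by apply: lee_sum => i _; exact: sum_le.
  rewrite big_split/=; apply: leeD; first by rewrite big_split/=; apply: leeD.
  by rewrite sumEFin lee_fin sumr_const card_ord [leRHS]mulr_natl.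
move: (\int[image_measure f mu]_x _) => F.
rewrite !EFinD -!addeA leeD2l// leeD2l//.
by rewrite addeC -addeA.
Qed.

End weight_potential_bound.

(** * Countable covers by sets on which the map is injective *)

Section injective_pieces.
Context {M : ptopologicalType}.
Hypothesis M_compact : compact [set: M].
Hypothesis M_hausdorff : hausdorff_space M.
Hypothesis M_countable : @second_countable M.
Let M_normal : normal_space M := compact_normal M_hausdorff M_compact.
Variable f : M -> M.
Variable D : set M.
Hypothesis locally_injective : forall x, D x ->
  exists U : set M, [/\ open U, U x & {in U &, injective f}].

(** Two sets for each index: closed [C n], suited to Urysohn functions and to measurable images,
    inside open [U n], where [f] is still injective and where the supports of the [chi n] will
    lie. *)
Lemma injective_closed_cover : exists C U : nat -> set M,
  [/\ forall n, closed (C n), forall n, open (U n), forall n, C n `<=` U n,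
      forall n x y, U n x -> U n y -> f x = f y -> x = y & D `<=` \bigcup_n C n].
Proof.
pose G := [set A : set M | exists U, [/\ open U, A `<=` U & {in U &, injective f}]].
have [||C [hC DC]] := @second_countable_closed_cover M M_normal M_countable
    M_hausdorff G D.
- by exists set0; split => //; [exact: open0|move=> x y; rewrite inE].
- move=> x /locally_injective[U [oU Ux injU]]; exists U; split => // A AU _.
  by exists U.
have /choice[U hU] : forall n, exists U,
    [/\ open U, C n `<=` U & {in U &, injective f}] by move=> n; have [] := hC n.
exists C, U; split => // n; try by have [] := hC n; try by have [] := hU n.
by move=> x y Ux Uy; have [_ _ injU] := hU n; apply: injU; rewrite inE.
Qed.

Lemma countable_injective_fiber (x : M) : countable (f @^-1` [set x] `&` D).
Proof.
have [C [U [_ _ CU injU DC]]] := injective_closed_cover.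
apply: (@sub_countable _ _ _ (\bigcup_n (f @^-1` [set x] `&` C n))).
  by apply: subset_card_le => y [fy /DC[n _ Cy]]; exists n.
apply: bigcup_countable => // n _; apply: finite_set_countable.
have [->|/set0P[y [fy Cy]]] := eqVneq (f @^-1` [set x] `&` C n) set0.
  exact: finite_set0.
apply: (@sub_finite_set _ _ [set y]) => [z [fz Cz]|]; last exact: finite_set1.
by apply: (injU n); [exact: CU|exact: CU|rewrite fy fz].
Qed.

End injective_pieces.

(** * Weak-* continuity and upper semi-continuity *)

Section weak_star.
Context {R : realType} {M : ptopologicalType}.

Lemma weak_star_continuous (L : M -> R) : continuous L ->
  continuous (fun nu : prob_space R M =>
    (\int[(nu : probability (borel M) R)]_x L x)).
Proof.
move=> cL.
pose mix := @isContinuous.Build M R L cL.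
pose phi : continuousType M R := HB.pack L mix.
move=> nu; apply: (@continuous_comp _ _ _ (@test_integrals R M : prob_space R M -> _)
  (fun g : prod_topology (fun _ : continuousType M R => R) => g phi)).
  exact: initial_continuous.
exact: (@proj_continuous _ (fun _ : continuousType M R => R) phi).
Qed.

Lemma compact_continuous_integral (L : M -> R) (nu : probability (borel M) R) :
  compact [set: M] -> continuous L ->
  (\int[nu]_x (L x)%:E)%E = (\int[nu]_x L x)%:E.
Proof.
move=> cM cL; rewrite /Rintegral fineK//.
apply: integrable_fin_num => //.
apply: measurable_bounded_integrable => //.
- by rewrite (le_lt_trans (probability_le1 _ _)) ?ltry.
- exact: continuous_borel_real.
have cLM : compact (L @` [set: M]).
  by apply: continuous_compact => //; exact: continuous_subspaceT.
have [B [_ hB]] := compact_bounded cLM.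
exists B; split; first exact: num_real.
by move=> b Bb x _; apply: hB => //; exists x.
Qed.

End weak_star.

Section folding_usc.
Local Open Scope ereal_scope.
Context {R : realType} {M : ptopologicalType}.
Hypothesis M_compact : compact [set: M].
Hypothesis M_hausdorff : hausdorff_space M.
Hypothesis M_countable : @second_countable M.
Let M_normal : normal_space M := compact_normal M_hausdorff M_compact.
Variable f : M -> M.
Hypothesis f_continuous : continuous f.
Variable J : M -> R.
Hypothesis J_continuous : continuous J.
Hypothesis J_ge0 : forall x, (0 <= J x)%R.
Variables (N : nat) (C0 : R).
Hypothesis fiber_sum : forall x (s : seq M), uniq s ->
  (forall y, y \in s -> f y = x) -> (\sum_(y <- s) J y ^+ N <= C0)%R.
Let Z := [set x | J x = 0%R].
Hypothesis locally_injective : forall x, (~` Z) x ->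
  exists U : set M, [/\ open U, U x & {in U &, injective f}].
Variable Ps : set (prob_space R M).
Hypothesis Ps_null : forall nu : probability (borel M) R, Ps nu -> nu Z = 0.
Hypothesis Ps_tail : forall kappa : R, (0 < kappa)%R ->
  exists2 dlt : R, (0 < dlt <= 1)%R & forall nu : probability (borel M) R,
    Ps nu -> \int[nu]_(x in [set x | (J x < dlt)%R]) (- ln (J x))%:E <= kappa%:E.
Hypothesis Ps_disintegration : forall nu : probability (borel M) R, Ps nu ->
  exists k : R.-pker borel M ~> borel M, disintegration f nu k.

Lemma folding_entropyE (nu : probability (borel M) R) : Ps nu ->
  exists2 k, disintegration f nu k &
    folding_entropy f nu = \int[image_measure f nu]_x point_entropy (k x).
Proof.
move=> /Ps_disintegration[k disk].
have h : exists h, [set h | exists2 k, disintegration f nu k &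
    h = \int[image_measure f nu]_x point_entropy (k x)] h.
  by exists (\int[image_measure f nu]_x point_entropy (k x)); exists k.
by have [k' ? ?] := getPex h; exists k'.
Qed.

(* At [mu], the weights are chosen so close to the conditional masses of [mu] on
   the points of the fibres that Gibbs' inequality is nearly an equality. *)
Lemma folding_potential (mu : probability (borel M) R) (a : R) : Ps mu ->
  folding_entropy f mu < a%:E ->
  exists (L : M -> R) (kappa : R), [/\ continuous L,
    forall nu : probability (borel M) R, Ps nu ->
      folding_entropy f nu + 1 <= \int[nu]_y (L y)%:E + kappa%:E &
    \int[mu]_y (L y)%:E + kappa%:E < a%:E + 1].
Proof.
move=> Pmu; have [k disk FE] := folding_entropyE Pmu.
pose F := folding_entropy f mu; rewrite -/F => Fa.
have F0 : 0 <= F.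
  rewrite /F FE -(svalP (image_prob f_continuous mu)).
  apply: integral_ge0 => x _; apply: (point_entropy_ge0 M_hausdorff).
  exact: prob_kernel.
have Ffin : F \is a fin_num by rewrite ge0_fin_numE// (lt_trans Fa)// ltry.
have C0_ge0 : (0 <= C0)%R.
  by have := @fiber_sum point [::] isT; rewrite big_nil; apply.
(* Four errors of size at most [eta] must fit strictly into the gap a - F: eps C0, N kap, the L^1
   approximation errors and the mass missed by the pieces. *)
pose eta := ((a - fine F) / 6)%R.
have eta0 : (0 < eta)%R.
  by rewrite divr_gt0// subr_gt0 -lte_fin fineK.
(* Chosen to have both [eps <= 1] and eps C0 <= eta. *)
pose eps := (eta / (C0 + 1 + eta))%R.
have den0 : (0 < C0 + 1 + eta)%R by lra.
have eps01 : (0 < eps <= 1)%R.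
  by rewrite divr_gt0//= ler_pdivrMr// mul1r; lra.
have epsC : (eps * C0 <= eta)%R.
  rewrite /eps mulrAC ler_pdivrMr// ler_pM2l//; lra.
pose kap := (eta / N.+1%:R)%R.
have kap0 : (0 < kap)%R by rewrite divr_gt0 ?ltr0n.
have [dlt dlt01 tail] := Ps_tail kap0.
pose tau := (eps * dlt ^+ N)%R.
have tau01 : (0 < tau <= 1)%R.
  case/andP: eps01 => e0 e1; case/andP: dlt01 => d0 d1.
  by rewrite mulr_gt0 ?exprn_gt0//= mulr_ile1 ?exprn_ge0 ?exprn_ile1//; exact: ltW.
pose T := (- ln tau)%R.
have T0 : (0 <= T)%R by rewrite oppr_ge0 ln_le0//; case/andP: tau01.
have [C [U [cC oU CU injU ZC]]] :=
  injective_closed_cover M_compact M_hausdorff M_countable locally_injective.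
pose A : nat -> set (borel M) := seqDU C.
have mC i : measurable (C i : set (borel M)) by exact: closed_borel.
have mA i : measurable (A i).
  by apply: measurableD => //; exact: bigsetU_measurable.
have tA : trivIset setT A by exact: trivIset_seqDU.
have AC i : A i `<=` C i by move=> x [].
pose A0 n : set (borel M) := ~` \big[setU/set0]_(i < n) A i.
have mA0 n : measurable (A0 n) by apply: measurableC; exact: bigsetU_measurable.
(* The order of the choices matters: [tau] depends only on [eps] and [dlt] and is already fixed, so
   the mass outside the first [n] pieces can be made small against T = - ln tau. The pieces exhaust
   the complement of the null set [Z]. *)
have [n hn] : exists n, mu (A0 n) <= (eta / (T + 1))%:E.
  have e0 : (0 < eta / (T + 1))%R by rewrite divr_gt0// ltr_wpDl.
  have : mu (A0 n) @[n --> \oo] --> mu (\bigcap_n A0 n).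
    apply: (@nonincreasing_cvg_mu _ _ _ mu A0) => //.
    - by apply: (le_lt_trans (probability_le1 _ _)); rewrite ?ltry.
    - exact: bigcapT_measurable.
    - move=> m p mp; apply/subsetPset; apply: subsetC.
      rewrite -!bigcup_mkord => x [i /= im Ax]; exists i => //=.
      exact: leq_trans mp.
  have -> : mu (\bigcap_n A0 n) = 0.
    apply/eqP; rewrite eq_le measure_ge0 andbT -(Ps_null Pmu).
    have mZ : measurable (Z : set (borel M)).
      rewrite -[X in measurable X](setTI (J @^-1` [set 0%R])).
      by apply: (continuous_borel_real J_continuous) => //; exact: measurable_set1.
    rewrite le_measure ?inE//; first exact: bigcapT_measurable.
    move=> x hx; apply: contrapT => /ZC; rewrite (seqDU_bigcup_eq C) => -[i _ Ax].
    by apply: (hx i.+1 Logic.I); rewrite -bigcup_mkord; exists i => /=.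
  move=> /fine_cvgP[_ /cvgrPdist_le/(_ _ e0)[m _ /(_ m (leqnn m))]] /=.
  rewrite sub0r normrN => h; exists m.
  rewrite -[leLHS]fineK ?fin_num_measure//.
  by rewrite lee_fin (le_trans _ h)// ler_norm.
have ti : (0 < tau^-1)%R by rewrite invr_gt0; case/andP: tau01.
(* The L^1 precision comes last, since its cost depends on both [n] and [tau]. *)
pose e := (eta / (n%:R * (1 + 2 * tau^-1) + 1))%R.
have den1 : (0 < n%:R * (1 + 2 * tau^-1) + 1)%R.
  by rewrite ltr_wpDl// mulr_ge0// addr_ge0// mulr_ge0// ltW.
have e0 : (0 < e)%R by rewrite divr_gt0.
have ebound : (n%:R * (e * (1 + 2 * tau^-1)) <= eta)%R.
  have -> : (n%:R * (e * (1 + 2 * tau^-1)) = e * (n%:R * (1 + 2 * tau^-1)))%R by ring.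
  rewrite /e mulrAC ler_pdivrMr// ler_pM2l//; lra.
pose Q := sval (image_prob f_continuous mu).
have l1 := l1_approx_measurable M_normal M_countable M_hausdorff.
have /choice[s hs] : forall i, exists v : M -> R, [/\ continuous v,
    (forall x, 0 <= v x <= 1)%R & l1_close Q (fun x => fine (k x (A i))) v <= e%:E].
  move=> i; have rho01 x : (0 <= fine (k x (A i)) <= 1)%R.
    by apply: fine_measure01 => //; exact: prob_kernel.
  exact: (l1 _ Q _ (measurable_fine_kernel k (mA i)) rho01 e e0).
have /choice[v hv] : forall i, exists v : M -> R, [/\ continuous v,
    (forall x, 0 <= v x <= 1)%R & l1_close mu \1_(A i) v <= e%:E].
  move=> i; have ind01 (x : borel M) : (0 <= (\1_(A i) x : R) <= 1)%R.
    by rewrite indicE; case: (_ \in _); rewrite ?lexx ler01.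
  have mind : measurable_fun setT (\1_(A i) : borel M -> R) by exact: measurable_indic.
  exact: (l1 _ mu _ mind ind01 e e0).
have /choice[h hh] : forall i, exists h : M -> R, [/\ continuous h,
    forall x, (0 <= h x <= 1)%R, forall x, C i x -> h x = 1%R &
    forall x, ~ U i x -> h x = 0%R].
  by move=> i; exact: (urysohn_function M_normal (cC i) (oU i) (CU i)).
(* The Urysohn factor confines the support to [U i], where [f] is injective. It equals 1 on [A i]
   and only decreases [v i] elsewhere, so the approximation of the indicator of [A i] does not get
   worse. *)
pose chi i y := (v i y * h i y)%R.
have s_cont i : continuous (s i) by have [] := hs i.
have s01 i x : (0 <= s i x <= 1)%R by have [] := hs i.
have chi_cont i : continuous (chi i).
  have [cv _ _] := hv i; have [ch _ _ _] := hh i.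
  by move=> x; apply: cvgM; [exact: cv|exact: ch].
have chi01 i x : (0 <= chi i x <= 1)%R.
  have [_ /(_ x)/andP[v0 v1] _] := hv i; have [_ /(_ x)/andP[h0 h1] _ _] := hh i.
  by rewrite mulr_ge0//= mulr_ile1.
have chi_inj i x y : chi i x != 0%R -> chi i y != 0%R -> f x = f y -> x = y.
  have [_ _ _ h0] := hh i; move=> cx cy; apply: (injU i).
    by apply: contrapT => /h0 hx; rewrite /chi hx mulr0 eqxx in cx.
  by apply: contrapT => /h0 hy; rewrite /chi hy mulr0 eqxx in cy.
have chi_v i y : (`|\1_(A i) y - chi i y| <= `|\1_(A i) y - v i y|)%R.
  have [_ /(_ y)/andP[h0 h1] hC _] := hh i; have [_ /(_ y)/andP[v0 v1] _] := hv i.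
  rewrite indicE /chi; have [Ay|Ay] := boolP (y \in A i).
    by rewrite hC ?mulr1//; apply: AC; exact: set_mem.
  by rewrite !sub0r !normrN !ger0_norm ?mulr_ge0// ler_piMr.
exists (weight_potential f J N C0 eps dlt n s chi), (N%:R * kap)%R; split.
- exact: continuous_weight_potential.
- move=> nu Pnu; have [k' disk' ->] := folding_entropyE Pnu.
  apply: (folding_le_weight_potential M_hausdorff f_continuous J_continuous) => //.
  + move=> x; rewrite setDE.
    exact: (countable_injective_fiber M_compact M_hausdorff M_countable locally_injective).
  + exact: Ps_null.
  + exact: tail.
have injA i x y : A i x -> A i y -> f x = f y -> x = y.
  by move=> Ax Ay; apply: (injU i); apply: CU; exact: AC.
have eps0 : (0 < eps)%R by case/andP: eps01.
have := @integral_weight_potential_le _ _ M_hausdorff f f_continuous J J_ge0 N C0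
  C0_ge0 eps dlt eps0 tau01 n s chi s_cont s01 mu k disk A v e mA tA injA _ chi_v _ _.
move=> H; have {}H := H (fun i => let: And3 c _ _ := hv i in c)
  (fun i => let: And3 _ _ c := hs i in c) (fun i => let: And3 _ _ c := hv i in c).
apply: (le_lt_trans (leeD2r _ H)); rewrite -FE -/F -(fineK Ffin) -!EFinD lte_fin.
have kN : (N%:R * kap <= eta)%R.
  by rewrite /kap mulrCA ler_piMr ?(ltW eta0)// ler_pdivrMr ?ltr0n// mul1r ler_nat.
have TA : (- ln tau * fine (mu (A0 n)) <= eta)%R.
  have h1 : (fine (mu (A0 n)) <= eta / (T + 1))%R.
    by rewrite -lee_fin fineK ?fin_num_measure.
  apply: (@le_trans _ _ (T * (eta / (T + 1)))%R); first by rewrite ler_wpM2l.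
  by rewrite mulrCA ler_piMr ?(ltW eta0)// ler_pdivrMr ?ltr_wpDl//; lra.
have : (a - fine F = 6 * eta)%R by rewrite /eta; field.
move: kN TA ebound epsC; rewrite -/(A0 n) -/tau => kN TA eb eC aF; lra.
Qed.

(** On [Ps] the entropy lies below a weak-* continuous functional whose value at [mu] is still less
    than [a]; the strict inequality persists near [mu]. *)
Theorem folding_entropy_usc :
  upper_semicontinuous_on Ps (folding_entropy f : prob_space R M -> \bar R).
Proof.
move=> mu Pmu a Fa.
have [L [kappa [cL hL Lmu]]] := folding_potential Pmu Fa.
rewrite (compact_continuous_integral _ M_compact cL) -!EFinD lte_fin in Lmu.
have cont := @weak_star_continuous R M L cL mu.
have gap : (0 < a + 1 - (\int[mu]_y L y + kappa))%R by rewrite subr_gt0.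
move/cvgrPdist_lt : cont => /(_ _ gap) hnear.
near=> nu.
have Pnu : Ps nu by near: nu; exact: withinT.
have := hL nu Pnu.
rewrite (compact_continuous_integral _ M_compact cL) -EFinD => h.
rewrite -(lteD2rE (x := 1))//; apply: (le_lt_trans h).
rewrite -EFinD lte_fin.
have : (`|\int[mu]_y L y - \int[(nu : probability (borel M) R)]_y L y| <
   a + 1 - (\int[mu]_y L y + kappa))%R.
  near: nu; apply: cvg_within; exact: hnear.
rewrite ltr_norml => /andP[h1 _]; lra.
Unshelve. all: by end_near.
Qed.

End folding_usc.

(** * Existence of disintegrations *)

Section injective_image.
Context {M : ptopologicalType}.
Hypothesis M_compact : compact [set: M].
Hypothesis M_hausdorff : hausdorff_space M.
Variable f : M -> M.
Hypothesis f_continuous : continuous f.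
Variable C : set M.
Hypothesis C_closed : closed C.
Hypothesis f_injective : forall x y, C x -> C y -> f x = f y -> x = y.

Lemma closed_image (B : set M) : closed B -> closed (f @` B).
Proof.
move=> cB; apply: (compact_closed M_hausdorff); apply: continuous_compact.
  exact: continuous_subspaceT.
exact: (subclosed_compact cB M_compact).
Qed.

(** Injectivity on [C] makes images commute with complements relative to [C], so the sets [B] for
    which the image of their trace on [C] is measurable form a sigma-algebra. Closed sets belong to
    it, because closed subsets of [M] are compact and have closed images. *)
Lemma measurable_injective_image (B : set (borel M)) : measurable B ->
  measurable (f @` (C `&` B) : set (borel M)).
Proof.
have imC (E : set M) : f @` (C `&` ~` E) = f @` C `\` f @` (C `&` E).
  apply/seteqP; split => [_ [x [Cx Ex] <-]|_ [[x Cx <-] hx]].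
    split; first by exists x.
    by move=> [y [Cy Ey]] /f_injective yx; apply: Ex; rewrite -yx.
  by exists x => //; split => // Ex; apply: hx; exists x.
have mC : measurable (f @` C : set (borel M)) by apply: closed_borel; exact: closed_image.
pose D := [set B | measurable (f @` (C `&` B) : set (borel M))].
move=> mB; suff: D B by [].
apply: (@smallest_sub _ (sigma_algebra setT) open D) mB; last first.
  move=> U oU; rewrite /D/= -(setCK U) imC; apply: measurableD => //.
  by apply: closed_borel; apply: closed_image; apply: closedI => //; exact: open_closedC.
split.
- by rewrite /D/= setI0 image_set0; exact: measurable0.
- by move=> E mE; rewrite setTD /D/= imC; exact: measurableD.
- move=> F mF; rewrite /D/= setI_bigcupr image_bigcup.
  by apply: bigcup_measurable => n _; exact: mF.
Qed.

End injective_image.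

(** The image under [f] of the restriction of [mu] to [A]. The proofs [mf] and [mA] are arguments so
    that a measure structure can be attached to this set function. *)
Definition piece_image d (T : measurableType d) (R : realType)
  (mu : {finite_measure set T -> \bar R}) (f : T -> T) (A : set T)
  (mf : measurable_fun setT f) (mA : measurable A) : set T -> \bar R :=
  fun B => mu (A `&` f @^-1` B).

Section piece_image_measure.
Local Open Scope ereal_scope.
Context d (T : measurableType d) (R : realType)
  (mu : {finite_measure set T -> \bar R}) (f : T -> T) (A : set T).
Variables (mf : measurable_fun setT f) (mA : measurable A).
Local Notation nu := (piece_image mu mf mA).

Let mpre (B : set T) : measurable B -> measurable (A `&` f @^-1` B).
Proof.
by move=> mB; apply: measurableI => //; rewrite -[X in measurable X]setTI; exact: mf.
Qed.

Let nu0 : nu set0 = 0.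
Proof. by rewrite /piece_image preimage_set0 setI0 measure0. Qed.

Let nu_ge0 B : 0 <= nu B.
Proof. exact: measure_ge0. Qed.

Let nu_additive : semi_sigma_additive nu.
Proof.
move=> F mF tF mUF; rewrite /piece_image preimage_bigcup setI_bigcupr.
apply: measure_semi_sigma_additive.
- by move=> n; exact: mpre.
- apply/trivIsetP => i j _ _ ij; rewrite setIACA setIid -preimage_setI.
  by move/trivIsetP : tF => /(_ _ _ _ _ ij) ->//; rewrite preimage_set0 setI0.
- by rewrite -setI_bigcupr -preimage_bigcup; exact: mpre.
Qed.

HB.instance Definition _ := isMeasure.Build _ _ _ nu nu0 nu_ge0 nu_additive.

Let nu_fin : fin_num_fun nu.
Proof. by move=> B mB; apply: fin_num_measure; exact: mpre. Qed.

HB.instance Definition _ := @Measure_isFinite.Build _ T R nu nu_fin.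

End piece_image_measure.

Section existence.
Local Open Scope ereal_scope.
Context {R : realType} {M : ptopologicalType}.
Hypothesis M_compact : compact [set: M].
Hypothesis M_hausdorff : hausdorff_space M.
Variable f : M -> M.
Hypothesis f_continuous : continuous f.
Variable C : nat -> set M.
Hypothesis C_closed : forall n, closed (C n).
Hypothesis f_injective : forall n x y, C n x -> C n y -> f x = f y -> x = y.
Variable mu : probability (borel M) R.
Hypothesis C_full : mu (~` \bigcup_n C n) = 0.

Let Q := sval (image_prob f_continuous mu).
Let QE : (Q : set (borel M) -> \bar R) = image_measure f mu :=
  svalP (image_prob f_continuous mu).
Let mf := continuous_borel f_continuous.
Let A : nat -> set (borel M) := seqDU C.

Let mC n : measurable (C n : set (borel M)). Proof. exact: closed_borel. Qed.

Let mA n : measurable (A n).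
Proof. by apply: measurableD => //; exact: bigsetU_measurable. Qed.

Let tA : trivIset setT A. Proof. exact: trivIset_seqDU. Qed.

Let AC n : A n `<=` C n. Proof. by move=> x []. Qed.

Let mpre (B : set (borel M)) : measurable B -> measurable (f @^-1` B : set (borel M)).
Proof. by move=> mB; rewrite -[X in measurable X]setTI; exact: mf. Qed.

Let mu_sum (B : set (borel M)) : measurable B ->
  \sum_(n <oo) mu (A n `&` B) = mu B.
Proof.
move=> mB; rewrite -measure_semi_bigcup//; last 3 first.
- by move=> n; exact: measurableI.
- apply/trivIsetP => i j _ _ ij; rewrite setIACA setIid.
  by move/trivIsetP : tA => /(_ _ _ _ _ ij) ->//; rewrite set0I.
- by apply: bigcup_measurable => n _; exact: measurableI.
have mU : measurable (\bigcup_n C n : set (borel M)) by exact: bigcup_measurable.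
rewrite -setI_bigcupl -(seqDU_bigcup_eq C) [RHS](measureDI mu mB mU).
rewrite [X in _ = X + _](_ : _ = 0) ?add0e 1?setIC//.
apply/eqP; rewrite eq_le measure_ge0 andbT -C_full le_measure ?inE//.
- exact: measurableD.
- exact: measurableC.
Qed.

(** The Radon-Nikodym density of the image of [mu] restricted to [A n] with respect to the whole
    image measure. Its value at [x] will be the conditional mass of the point of [A n] above [x]. *)
Lemma piece_density (n : nat) : exists rho : borel M -> R,
  [/\ measurable_fun setT rho, forall x, (0 <= rho x)%R &
   forall B : set (borel M), measurable B ->
     \int[Q]_(x in B) (rho x)%:E = mu (A n `&` f @^-1` B)].
Proof.
have [|h [h0 hfin hint hB]] :=
    @radon_nikodym_sigma_finite _ _ _ Q (piece_image mu mf (mA n)).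
  apply/null_content_dominatesP => B mB QB.
  have muB : mu (f @^-1` B) = 0 :=
    etrans (esym (congr1 (fun m : set (borel M) -> \bar R => m B) QE)) QB.
  apply/eqP; rewrite eq_le measure_ge0 andbT.
  apply: (@le_trans _ _ (mu (f @^-1` B))); last by rewrite muB.
  rewrite /piece_image; apply: le_measure; rewrite ?inE; last by move=> x [].
    exact: measurableI (mA n) (mpre mB).
  exact: mpre.
exists (fine \o h); split.
- by apply: measurableT_comp => //; have /integrableP[] := hint.
- by move=> x; exact: fine_ge0.
- move=> B mB; rewrite -[RHS]/(piece_image mu mf (mA n) B) hB//.
  by apply: eq_integral => x _; rewrite fineK.
Qed.

Let point_measurable := measurable_point M_hausdorff.

Let injA n x y : A n x -> A n y -> f x = f y -> x = y.
Proof. by move=> Ax Ay; apply: (f_injective (n := n)); exact: AC. Qed.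

Let mfA n (U : set (borel M)) : measurable U ->
  measurable (f @` (A n `&` U) : set (borel M)).
Proof.
move=> mU; rewrite (_ : A n `&` U = C n `&` (A n `&` U)); last first.
  by apply/seteqP; split => [x [Ax Ux]|x [_ []]//]; split => //; exact: AC.
apply: measurable_injective_image => //; first exact: f_injective.
exact: measurableI.
Qed.

(* The conditional measures are [sum_n rho n x *: \d_(g n x)], where [g n x] is the
   only point of [A n] above [x]; [term n U x] is the mass that the [n]-th term
   gives to [U]. *)
Section kernel.
Variable rho : nat -> borel M -> R.
Hypothesis mrho : forall n, measurable_fun setT (rho n).
Hypothesis rho0 : forall n x, (0 <= rho n x)%R.
Hypothesis rhoE : forall n (B : set (borel M)), measurable B ->
  \int[Q]_(x in B) (rho n x)%:E = mu (A n `&` f @^-1` B).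

Let term n (U : set (borel M)) (x : borel M) : R := (rho n x * \1_(f @` (A n `&` U)) x)%R.

Let term0 n U x : (0 <= term n U x)%R. Proof. by rewrite mulr_ge0. Qed.

Let mterm n U : measurable U -> measurable_fun setT (EFin \o term n U).
Proof.
move=> mU; apply/measurable_EFinP; apply: measurable_funM => //.
by apply: measurable_indic; exact: mfA.
Qed.

Let integral_term n U B : measurable U -> measurable B ->
  \int[Q]_(x in B) (term n U x)%:E = mu (A n `&` U `&` f @^-1` B).
Proof.
move=> mU mB; rewrite /term.
have mfU := mfA n mU.
transitivity (\int[Q]_(x in B `&` f @` (A n `&` U)) (rho n x)%:E).
  rewrite [RHS]integral_mkcondr; apply: eq_integral => x _; rewrite patchE indicE.
  by case: ifPn; rewrite ?mulr1 ?mulr0.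
rewrite rhoE; last exact: measurableI.
congr (mu _); apply/seteqP; split => [x [Ax [Bfx [y [Ay Uy] fyx]]]|x [[Ax Ux] Bfx]].
  by have yx := injA Ay Ax fyx; rewrite yx in Uy.
by split => //; split => //; exists x.
Qed.

Let total U x : \bar R := \sum_(n <oo) (term n U x)%:E.

Let mtotal U : measurable U -> measurable_fun setT (total U).
Proof.
move=> mU; apply: ge0_emeasurable_sum => n *; first by rewrite lee_fin.
exact: mterm.
Qed.

Let total_ge0 U x : 0 <= total U x.
Proof. by apply: nneseries_ge0 => n _ _; rewrite lee_fin. Qed.

Let integral_total U B : measurable U -> measurable B ->
  \int[Q]_(x in B) total U x = mu (U `&` f @^-1` B).
Proof.
move=> mU mB; rewrite integral_nneseries//; last 2 first.
- by move=> n; apply: measurable_funTS; exact: mterm.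
- by move=> n x _; rewrite lee_fin.
rewrite -mu_sum; last exact: measurableI (mpre mB).
by apply: eq_eseriesr => n _; rewrite integral_term// setIA.
Qed.

Let good : set (borel M) := [set x | total setT x = 1].

Let mgood : measurable good.
Proof.
rewrite (_ : good = setT `&` total setT @^-1` [set 1]) ?setTI//.
rewrite -[X in measurable X]setTI; apply: (mtotal measurableT measurableT).
exact: emeasurable_set1.
Qed.

Let good_ae : {ae Q, forall x, good x}.
Proof.
have : ae_eq Q setT (cst 1) (total setT).
  apply: integral_ae_eq => //.
  - exact: finite_measure_integrable_cst.
  - exact: mtotal.
  move=> B _ mB; rewrite integral_cst// mul1e integral_total// setTI.
  by rewrite (QE : Measure.sort Q = _).
by apply: filterS => x /(_ Logic.I) /esym.
Qed.

Let g n (x : borel M) : borel M := xget point [set y | A n y /\ f y = x].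

(** When no point of [A n] lies above [x], [g n x] is the default [point], but its coefficient is
    then 0 and both sides vanish. *)
Let term_dirac n U x : (term n U x)%:E = (term n setT x)%:E * \d_(g n x) U.
Proof.
rewrite /term diracE !indicE.
have [h|h] := pselect (exists y, A n y /\ f y = x); last first.
  have hV (V : set (borel M)) : ~ (f @` (A n `&` V)) x.
    by move=> [y [Ay _] fy]; apply: h; exists y.
  by rewrite (memNset (hV U)) (memNset (hV setT)) !mulr0 mul0e.
have [Ag fg] : A n (g n x) /\ f (g n x) = x.
  by have [y hy] := h; exact: (@xgetPex _ point [set y | A n y /\ f y = x] h).
have xT : x \in f @` (A n `&` setT) by apply/mem_set; exists (g n x).
rewrite xT mulr1 -EFinM; congr (rho n x * (nat_of_bool _)%:R)%:E.
apply/idP/idP => /set_mem => [[y [Ay Uy] fy]|Ug].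
  by apply/mem_set; rewrite (injA Ag Ay)// fg fy.
by apply/mem_set; exists (g n x).
Qed.

Let cond (x : borel M) : {measure set (borel M) -> \bar R} :=
  mseries (fun n => mscale (NngNum (term0 n setT x)) \d_(g n x)) 0.

Let condE x U : cond x U = total U x.
Proof.
by apply: eq_eseriesr => n _; rewrite term_dirac.
Qed.

(** A kernel must be a probability at every point. Where the total mass is not 1, which happens only
    on a null set of the image measure, a Dirac mass is used as a default. *)
Let ker (x : borel M) : {measure set (borel M) -> \bar R} :=
  if x \in good then cond x else \d_x.

Let measurable_ker U : measurable U -> measurable_fun setT (ker ^~ U).
Proof.
move=> mU.
rewrite (_ : (ker ^~ U) = fun x => if x \in good then total U x else \d_x U); last first.
  by apply/funext => x; rewrite /ker; case: ifPn => // _; rewrite condE.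
apply: measurable_fun_ifT.
- apply: (measurable_fun_bool true); rewrite setTI (_ : _ @^-1` _ = good)//.
  by apply/seteqP; split => x /=; [move/set_mem|move/mem_set].
- exact: mtotal.
- exact: measurable_fun_dirac.
Qed.

Let ker1 x : ker x setT = 1.
Proof.
rewrite /ker; case: ifPn => [/set_mem|_]; first by rewrite condE.
exact: diracT.
Qed.

Lemma disintegration_of_densities :
  exists k : R.-pker borel M ~> borel M, disintegration f mu k.
Proof.
pose m1 := @isKernel.Build _ _ (borel M) (borel M) R ker measurable_ker.
pose k0 : R.-ker borel M ~> borel M := HB.pack ker m1.
pose m2 := @Kernel_isProbability.Build _ _ (borel M) (borel M) R k0 ker1.
pose k : R.-pker borel M ~> borel M := HB.pack ker m1 m2.
have kE x : good x -> forall U, k x U = total U x.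
  by move=> gx U; rewrite -condE /k /= /ker mem_set.
exists k; split.
  rewrite -QE; apply: filterS good_ae => x gx; rewrite kE//.
  rewrite -[RHS]gx; apply: eq_eseriesr => n _; rewrite /term !indicE; congr (_ * _)%:E.
  congr (nat_of_bool _)%:R; apply/idP/idP => /set_mem [y [Ay _] fy]; apply/mem_set; exists y => //.
move=> U mU; rewrite -QE.
transitivity (\int[Q]_x total U x).
  by rewrite integral_total// preimage_setT setIT.
apply: ge0_ae_eq_integral => //.
- exact: mtotal.
- exact: measurable_kernel.
by apply: filterS good_ae => x gx _; rewrite kE.
Qed.

End kernel.

Lemma disintegration_exists :
  exists k : R.-pker borel M ~> borel M, disintegration f mu k.
Proof.
have /choice[rho hrho] := piece_density.
by apply: (@disintegration_of_densities rho) => n; have [] := hrho n.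
Qed.

End existence.

(** * Differential calculus in charts *)

Section row_vectors.
Context {R : realType}.

Lemma coord_norm_le n (v : 'rV[R]_n) j : `|v 0 j| <= `|v|.
Proof. by rewrite [leRHS]mx_normrE; exact: (le_bigmax _ (fun ij => `|v ij.1 ij.2|) (0, j)). Qed.

Lemma row_norm_le n (v : 'rV[R]_n) (e : R) : 0 <= e ->
  (forall j, `|v 0 j| <= e) -> `|v| <= e.
Proof.
move=> e0 h; rewrite [leLHS]mx_normrE; apply: bigmax_le => // -[i j] _ /=.
by rewrite (ord1 i).
Qed.

Lemma linear_row_norm_le n (W : normedModType R) (L : {linear 'rV[R]_n -> W})
    (w : 'rV[R]_n) : `|L w| <= `|w| * \sum_j `|L (delta_mx 0 j)|.
Proof.
rewrite {1}(row_sum_delta w) linear_sum mulr_sumr.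
apply: (le_trans (ler_norm_sum _ _ _)); apply: ler_sum => j _.
by rewrite linearZ normrZ ler_wpM2r// coord_norm_le.
Qed.

Lemma linear_row_sub_norm_le n (W : normedModType R)
    (L L' : {linear 'rV[R]_n -> W}) (w : 'rV[R]_n) (c : 'I_n -> R) :
  (forall j, `|L (delta_mx 0 j) - L' (delta_mx 0 j)| <= c j) ->
  `|L w - L' w| <= `|w| * \sum_j c j.
Proof.
move=> Lc; have -> : L w - L' w = \sum_j w 0 j *: (L (delta_mx 0 j) - L' (delta_mx 0 j)).
  have E (T : {linear 'rV[R]_n -> W}) : T w = \sum_j w 0 j *: T (delta_mx 0 j).
    by rewrite {1}(row_sum_delta w) linear_sum; apply: eq_bigr => j _; rewrite linearZ.
  by rewrite (E L) (E L') -sumrB; apply: eq_bigr => j _; rewrite scalerBr.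
rewrite mulr_sumr; apply: (le_trans (ler_norm_sum _ _ _)); apply: ler_sum => j _.
by rewrite normrZ ler_pM// coord_norm_le.
Qed.

Lemma near_eq_diff (V W : normedModType R) (f g : V -> W) (x : V) :
  (\forall y \near x, f y = g y) -> differentiable f x ->
  differentiable g x /\ ('d g x = 'd f x :> (V -> W)).
Proof.
move=> fg df; have [cdf fE] := (diff_locallyP x f).1 df.
have gE : g \o shift x = cst (g x) + 'd f x +o_ 0 id.
  apply/eqaddoP => e e0; move/eqaddoP : fE => /(_ e e0) fE.
  have fg0 : \forall y \near 0, f (y + x) = g (y + x).
    by move: fg; rewrite (near_shift 0) subr0.
  apply: filterS2 fg0 fE => y fgy; rewrite /= /cst !fctE/= fgy.
  by rewrite (nbhs_singleton fg).
have dgE := diff_unique cdf gE.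
split; last exact: dgE.
apply/diff_locallyP; split; first by rewrite dgE.
by rewrite dgE.
Qed.

(** The mean value theorem along the segment, for each coordinate of F minus the affine path of
    slope [b]; coordinates suffice because the norm is the maximum norm. [b = 0] gives Lipschitz
    bounds, and [b = 'd F y (z - y)] gives the Taylor remainder. *)
Lemma segment_mvt n m (F : 'rV[R]_n -> 'rV[R]_m) (y z : 'rV[R]_n)
    (b : 'rV[R]_m) (e : R) : 0 <= e ->
  (forall t : R, 0 <= t <= 1 -> differentiable F (y + t *: (z - y)) /\
     `|'d F (y + t *: (z - y)) (z - y) - b| <= e) ->
  `|F z - F y - b| <= e.
Proof.
move=> e0 hF; apply: row_norm_le => // j; set w := z - y.
pose P (t : R) : 'rV[R]_n := y + t *: w.
pose G (x : 'rV[R]_n) : R := F x 0 j.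
pose phi (t : R) : R := G (P t) - t * b 0 j.
pose dphi (t : R) : R := 'd F (P t) w 0 j - b 0 j.
have hphi t : 0 <= t <= 1 -> is_derive (t : R^o) 1 (phi : R^o -> R^o) (dphi t).
  move=> t01; have [dF _] := hF t t01.
  have dFw : derivable F (P t) w by exact: diff_derivable.
  have hG : is_derive (P t) w G ('d F (P t) w 0 j).
    split; first by move/derivable_mxP : dFw => /(_ 0 j).
    by rewrite -deriveE// derive_mx// mxE.
  have gE : (fun h : R => h^-1 *: (G (P (h *: 1 + t)) - G (P t))) =
      (fun h : R => h^-1 *: (G (h *: w + P t) - G (P t))).
    apply/funext => h; congr (_ *: (G _ - _)).
    by rewrite /P scalerDl addrCA -[h *: 1]/(h * 1) mulr1.
  have hGP : is_derive (t : R^o) 1 (fun t : R^o => G (P t) : R^o) ('d F (P t) w 0 j).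
    have [d1 d2] := hG; split; first by rewrite /derivable /= gE.
    by rewrite /derive /= gE.
  apply: is_deriveB.
  have h1 : is_derive (t : R^o) 1 (fun u : R^o => u * b 0 j : R^o) (b 0 j).
    apply: is_derive_eq; by rewrite scaler0 add0r [_ *: _]mulr1.
  exact: h1.
have [t /[!in_itv]/= /andP[t0 t1] tE] : exists2 c, c \in `]0, 1[%R &
    phi 1 - phi 0 = dphi c * (1 - 0).
  apply: MVT => //.
    by move=> u /[!in_itv]/= /andP[u0 u1]; apply: hphi; rewrite !ltW.
  apply: derivable_within_continuous => u; rewrite in_itv/= => u01.
  by have [] := hphi u u01.
have -> : (F z - F y - b) 0 j = dphi t.
  move: tE; rewrite subr0 mulr1 => <-.
  rewrite /phi /P /G mul1r mul0r scale1r scale0r addr0 subr0 !mxE /w.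
  by rewrite addrCA subrr addr0; ring.
have t01 : 0 <= t <= 1 by rewrite !ltW.
have [_ h] := hF t t01.
have -> : dphi t = ('d F (P t) w - b) 0 j by rewrite !mxE.
exact: le_trans (coord_norm_le _ _) h.
Qed.

Lemma near_diagonal_ball (V : normedModType R) (x : V) (P : V * V -> Prop) :
  (\forall p \near (x, x), P p) ->
  exists2 rho : R, 0 < rho & forall y z, ball x rho y -> ball x rho z -> P (y, z).
Proof.
case=> -[A B] /= [/nbhs_ballP[a /= a0 xA] /nbhs_ballP[b /= b0 xB]] AB.
exists (Num.min a b); first by rewrite lt_min a0 b0.
move=> y z xy xz; apply: AB; split => /=.
  by apply: xA; apply: le_ball xy; rewrite ge_min lexx.
by apply: xB; apply: le_ball xz; rewrite ge_min lexx orbT.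
Qed.

Lemma segment_ball n (x y z : 'rV[R]_n) (rho t : R) : 0 <= t <= 1 ->
  ball x rho y -> ball x rho z -> ball x rho (y + t *: (z - y)).
Proof.
move=> /andP[t0 t1]; rewrite -!ball_normE /= => xy xz.
have -> : x - (y + t *: (z - y)) = (1 - t) *: (x - y) + t *: (x - z).
  by rewrite !scalerBr !scalerBl !scale1r opprD opprB; apply/rowP => j; rewrite !mxE; ring.
apply: (le_lt_trans (ler_normD _ _)); rewrite !normrZ.
rewrite (ger0_norm t0) (ger0_norm (x := 1 - t)) ?subr_ge0//.
have := normr_ge0 (x - y); have := normr_ge0 (x - z).
have [->|t0'] := eqVneq t 0; first by lra.
have tp : 0 < t by rewrite lt_neqAle eq_sym t0'.
have h1 : t * `|x - z| < t * rho by rewrite ltr_pM2l.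
have h2 : (1 - t) * `|x - y| <= (1 - t) * rho by rewrite ler_wpM2l ?subr_ge0// ltW.
move=> _ _; lra.
Qed.

Definition local_holder (V W : normedModType R) (a : R) (U : set V) (h : V -> W) :=
  forall x, U x -> exists C : R,
    \forall p \near (x, x), `|h p.1 - h p.2| <= C * `|p.1 - p.2| `^ a.

Definition C1_on (V W : normedModType R) (U : set V) (h : V -> W) :=
  (forall x, U x -> differentiable h x) /\
  forall v x, U x -> {for x, continuous (fun y => 'd h y v)}.

Lemma C1_lipschitz n m (U : set 'rV[R]_n) (h : 'rV[R]_n -> 'rV[R]_m) :
  open U -> C1_on U h -> local_holder 1 U h.
Proof.
move=> oU [dh ch] x Ux.
pose B := \sum_j (`|'d h x (delta_mx 0 j)| + 1).
have B0 : 0 <= B by rewrite sumr_ge0// => j _; rewrite addr_ge0.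
exists B.
have nearB : \forall y \near x, forall j : 'I_n,
    `|'d h y (delta_mx 0 j)| <= `|'d h x (delta_mx 0 j)| + 1.
  suff : forall j : 'I_n, \forall y \near x,
    `|'d h y (delta_mx 0 j)| <= `|'d h x (delta_mx 0 j)| + 1 by move/filter_forall.
  move=> j; have /cvgrPdist_le/(_ 1 ltr01) := ch (delta_mx 0 j) x Ux.
  apply: filterS => y hy; rewrite -lerBlDl (le_trans _ hy)//.
  by rewrite distrC (le_trans _ (ler_dist_dist _ _))// ler_norm.
have nearU : \forall y \near x, U y by exact: open_nbhs_nbhs.
have /nbhs_ballP[rho /= rho0 hrho] : \forall y \near x, U y /\ forall j : 'I_n,
    `|'d h y (delta_mx 0 j)| <= `|'d h x (delta_mx 0 j)| + 1.
  exact: filterI.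
have hP y z : ball x rho y -> ball x rho z -> `|h y - h z| <= B * `|y - z| `^ 1.
  move=> xy xz; rewrite powRr1// -[h y - h z]subr0.
  apply: segment_mvt; first by rewrite mulr_ge0.
  move=> t t01; have [Ut Bt] := hrho _ (segment_ball t01 xz xy).
  split; first exact: dh.
  rewrite subr0 (le_trans (linear_row_norm_le _ _))// mulrC ler_wpM2r//.
  by apply: ler_sum => j _.
exists (ball x rho, ball x rho); first by split; exact: nbhsx_ballx.
by move=> [y z] [/= xy xz]; exact: hP.
Qed.

Lemma holder_class_continuous (V W : normedModType R) k a (U : set V) (h : V -> W) :
  holder_class k a U h -> forall x, U x -> {for x, continuous h}.
Proof.
case: k => [|k] /=; first by move=> hh x /hh[].
by move=> [dh _] x Ux; apply: differentiable_continuous; exact: dh.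
Qed.

Lemma holder_class_C1 (V W : normedModType R) k a (U : set V) (h : V -> W) :
  holder_class k.+1 a U h -> C1_on U h.
Proof.
by move=> [dh hh]; split => // v; exact: holder_class_continuous (hh v).
Qed.

(** For 1 < r < 2 the derivative is Hoelder of exponent r - 1 by the definition of the class. For r
    >= 2 it is of class C^1, hence locally Lipschitz, and the exponent is 1. *)
Definition holder_exponent (r : R) : R :=
  if Num.truncn r == 1%N then r - 1 else 1.

Lemma holder_exponent_gt0 r : 1 < r -> 0 < holder_exponent r.
Proof. by move=> r1; rewrite /holder_exponent; case: ifP; rewrite ?subr_gt0. Qed.

Lemma Cr_on_C1 n m (r : R) (U : set 'rV[R]_n) (F : 'rV[R]_n -> 'rV[R]_m) :
  open U -> 1 < r -> Cr_on r U F ->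
  C1_on U F /\ forall v, local_holder (holder_exponent r) U (fun x => 'd F x v).
Proof.
move=> oU r1; rewrite /Cr_on /holder_exponent.
have : (0 < Num.truncn r)%N by rewrite truncn_gt0 ltW.
case: (Num.truncn r) => // -[|k] _ hF; split; try exact: holder_class_C1 hF.
  by move=> v x Ux; have [_ /(_ v) /(_ x Ux)[]] := hF.
by move=> v /=; apply: C1_lipschitz => //; have [_ /(_ v)/holder_class_C1] := hF.
Qed.

Lemma continuous_det (T : topologicalType) n (A : T -> 'M[R]_n) (x : T) :
  (forall i j, {for x, continuous (fun y => A y i j)}) ->
  {for x, continuous (fun y => \det (A y))}.
Proof.
move=> cA; rewrite /determinant.
apply: (@cvg_big R _ +%R 0 xpredT _ _ (nbhs x)) => [|s _].
  exact: add_continuous.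
apply: cvgM; first exact: cvg_cst.
apply: (@cvg_big R _ *%R 1 xpredT _ _ (nbhs x)) => [|i _]; first exact: mul_continuous.
exact: cA.
Qed.

Lemma continuous_adj (T : topologicalType) n (A : T -> 'M[R]_n) (x : T) :
  (forall i j, {for x, continuous (fun y => A y i j)}) ->
  forall i j, {for x, continuous (fun y => (\adj (A y)) i j)}.
Proof.
move=> cA i j.
have -> : (fun y => (\adj (A y)) i j) =
    (fun y => (-1) ^+ (j + i) * \det (row' j (col' i (A y)))).
  by apply/funext => y; rewrite mxE.
apply: cvgM; first exact: cvg_cst.
apply: (@continuous_det _ _ (fun y => row' j (col' i (A y)))) => k l.
have -> : (fun y => (row' j (col' i (A y))) k l) =
    (fun y => A y (lift j k) (lift i l)) by apply/funext => y; rewrite !mxE.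
exact: cA.
Qed.

(** The identity w A adj(A) = det(A) w puts the adjugate in the place of the inverse, so the bound
    keeps its meaning as the determinant tends to 0. *)
Lemma det_row_norm_le n (A : 'M[R]_n) (w : 'rV[R]_n) :
  `|\det A| * `|w| <= `|w *m A| * \sum_j \sum_i `|(\adj A) j i|.
Proof.
rewrite -normrZ -mul_mx_scalar -mul_mx_adj mulmxA.
pose L : {linear 'rV[R]_n -> 'rV[R]_n} := mulmxr (\adj A).
apply: (le_trans (linear_row_norm_le L (w *m A))).
rewrite ler_wpM2l//; apply: ler_sum => j _; apply: row_norm_le.
  by apply: sumr_ge0.
move=> i; rewrite /= -rowE mxE (bigD1 i)//= lerDl.
by apply: sumr_ge0.
Qed.

(* If [F y = F z] with [w := z - y <> 0], the Taylor remainder gives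
   [|dF_y w| <= C |w|^(1+a)], while [|det JF(y)| |w| <= |adj| |dF_y w|]. *)
Lemma jacobian_separation n (a : R) (U : set 'rV[R]_n) (F : 'rV[R]_n -> 'rV[R]_n)
    (x : 'rV[R]_n) : 0 < a -> open U -> C1_on U F ->
  (forall v, local_holder a U (fun x => 'd F x v)) -> U x ->
  exists rho K : R, [/\ 0 < rho, 0 <= K, ball x rho `<=` U &
    forall y z, ball x rho y -> ball x rho z -> F y = F z -> y != z ->
      `|\det ('J F y)| <= K * `|y - z| `^ a].
Proof.
move=> a0 oU [dF cF] hF Ux.
have /choice[C hC] : forall j : 'I_n, exists C : R, \forall p \near (x, x),
    `|'d F (p.1) (delta_mx 0 j) - 'd F (p.2) (delta_mx 0 j)| <= C * `|p.1 - p.2| `^ a.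
  by move=> j; exact: hF.
have [rho1 rho10 h1] : exists2 rho : R, 0 < rho & forall y z, ball x rho y -> ball x rho z ->
    forall j : 'I_n, `|'d F y (delta_mx 0 j) - 'd F z (delta_mx 0 j)| <= C j * `|y - z| `^ a.
  have := @near_diagonal_ball _ x (fun p => forall j : 'I_n,
    `|'d F (p.1) (delta_mx 0 j) - 'd F (p.2) (delta_mx 0 j)| <= C j * `|p.1 - p.2| `^ a).
  by apply; move/filter_forall : hC.
have cJ i j : {for x, continuous (fun y => ('J F y) i j)}.
  have -> : (fun y => ('J F y) i j) = (fun y => ('d F y (delta_mx 0 i)) 0 j).
    by apply/funext => y; rewrite /jacobian /lin1_mx mxE.
  apply: (@continuous_comp _ _ _ (fun y => 'd F y (delta_mx 0 i))
    (fun N : 'rV[R]_n => N 0 j)); first exact: cF.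
  exact: coord_continuous.
pose Sadj y := \sum_j \sum_i `|(\adj ('J F y)) j i|.
have cS : {for x, continuous Sadj}.
  apply: (@cvg_big R _ +%R 0 xpredT _ _ (nbhs x)) => [|j _]; first exact: add_continuous.
  apply: (@cvg_big R _ +%R 0 xpredT _ _ (nbhs x)) => [|i _]; first exact: add_continuous.
  by apply: cvg_norm; exact: continuous_adj.
have /nbhs_ballP[rho2 /= rho20 h2] : \forall y \near x, U y /\ Sadj y <= Sadj x + 1.
  apply: filterI; first exact: open_nbhs_nbhs.
  have /cvgrPdist_le/(_ 1 ltr01) := cS.
  apply: filterS => y hy; rewrite -lerBlDl (le_trans _ hy)//.
  by rewrite distrC ler_norm.
have Sx0 : 0 <= Sadj x by apply: sumr_ge0 => j _; apply: sumr_ge0.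
pose B := \sum_j `|C j|.
have B0 : 0 <= B by apply: sumr_ge0.
exists (Num.min rho1 rho2), (B * (Sadj x + 1)); split.
- by rewrite lt_min rho10 rho20.
- by rewrite mulr_ge0// addr_ge0.
- move=> y xy; have [] // := h2 y _.
  by apply: le_ball xy; rewrite ge_min lexx orbT.
move=> y z xy xz Fyz yz; set w := z - y.
have xy1 : ball x rho1 y by apply: le_ball xy; rewrite ge_min lexx.
have xz1 : ball x rho1 z by apply: le_ball xz; rewrite ge_min lexx.
have [_ Sy] : U y /\ Sadj y <= Sadj x + 1.
  by apply: h2; apply: le_ball xy; rewrite ge_min lexx orbT.
have w0 : 0 < `|w| by rewrite normr_gt0 subr_eq0 eq_sym.
have nw : `|y - z| = `|w| by rewrite distrC.
have hT : `|F z - F y - 'd F y w| <= `|w| * (B * `|w| `^ a).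
  apply: segment_mvt; first by rewrite !mulr_ge0// powR_ge0.
  move=> t /[dup] t01 /andP[t0 t1].
  have [Ut _] : U (y + t *: w) /\ Sadj (y + t *: w) <= Sadj x + 1.
    by apply: h2; apply: segment_ball => //; [apply: le_ball xy|apply: le_ball xz];
      rewrite ge_min lexx orbT.
  split; first exact: dF.
  have hle := @linear_row_sub_norm_le n _ ('d F (y + t *: w)) ('d F y) w
    (fun j => `|C j| * `|w| `^ a).
  apply: (le_trans (hle _)).
    move=> j; have := h1 _ _ (segment_ball t01 xy1 xz1) xy1 j => /le_trans; apply.
    rewrite -/w addrAC subrr add0r normrZ ger0_norm//.
    apply: (@le_trans _ _ (`|C j| * (t * `|w|) `^ a)).
      by rewrite ler_wpM2r ?powR_ge0// ler_norm.
    rewrite ler_wpM2l//; apply: ge0_ler_powR; rewrite ?(ltW a0) ?nnegrE//.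
      by rewrite mulr_ge0.
    by rewrite ler_piMl.
  by rewrite -mulr_suml.
have hdF : `|w *m 'J F y| <= `|w| * (B * `|w| `^ a).
  by move: hT; rewrite Fyz subrr sub0r normrN /jacobian mul_rV_lin1.
have := det_row_norm_le ('J F y) w; rewrite -/(Sadj y) => hdet.
rewrite -(ler_pM2r w0) (le_trans hdet)// nw.
have S0 : 0 <= Sadj y by apply: sumr_ge0 => j _; apply: sumr_ge0.
apply: (le_trans (ler_pM (normr_ge0 _) S0 hdF Sy)).
by rewrite le_eqVlt; apply/orP; left; apply/eqP; ring.
Qed.

End row_vectors.

Lemma open_near (T : topologicalType) (A : set T) (x : T) :
  open A -> A x -> nbhs x A.
Proof. by move=> oA Ax; apply: open_nbhs_nbhs. Qed.

Lemma jacobian_comp {R : realType} n m p (h : 'rV[R]_n -> 'rV[R]_m)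
    (k : 'rV[R]_m -> 'rV[R]_p) (x : 'rV[R]_n) :
  differentiable h x -> differentiable k (h x) ->
  'J (k \o h) x = 'J h x *m 'J k (h x).
Proof.
move=> dh dk; apply/row_matrixP => i; rewrite !rowE mulmxA.
by rewrite /jacobian !mul_rV_lin1 /= diff_comp.
Qed.

Lemma jacobian_comp3 {R : realType} n m p q (h : 'rV[R]_n -> 'rV[R]_m)
    (k : 'rV[R]_m -> 'rV[R]_p) (l : 'rV[R]_p -> 'rV[R]_q) (x : 'rV[R]_n) :
  differentiable h x -> differentiable k (h x) -> differentiable l (k (h x)) ->
  'J (l \o (k \o h)) x = 'J h x *m 'J k (h x) *m 'J l (k (h x)).
Proof.
move=> dh dk dl; rewrite (jacobian_comp (differentiable_comp dh dk) dl).
by rewrite (jacobian_comp dh dk).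
Qed.

(** Along the segment from the identity to [A] every matrix is positive definite, so the determinant
    never vanishes; it starts at 1, and the intermediate value theorem keeps it positive. *)
Lemma posdef_det_gt0 {R : realType} n (A : 'M[R]_n) :
  (forall v : 'rV[R]_n, v != 0 -> 0 < (v *m A *m v^T) 0 0) -> 0 < \det A.
Proof.
move=> pA.
pose B (t : R) : 'M[R]_n := t *: A + (1 - t) *: 1%:M.
have pI (v : 'rV[R]_n) : v != 0 -> 0 < (v *m v^T) 0 0.
  move=> v0; have [j vj] : exists j, v 0 j != 0.
    apply: contrapT => h; move/eqP : v0; apply; apply/rowP => j; rewrite mxE.
    by apply: contrapT => hj; apply: h; exists j; apply/eqP.
  rewrite mxE (bigD1 j)//= mxE ltr_wpDr//.
    by apply: sumr_ge0 => i _; rewrite mxE -expr2 sqr_ge0.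
  by rewrite -expr2 lt_neqAle eq_sym sqrf_eq0 vj sqr_ge0.
have Bneq0 t : 0 <= t <= 1 -> \det (B t) != 0.
  move=> /andP[t0 t1]; apply/negP => /det0P[v v0 vB].
  have h0 : (v *m B t *m v^T) 0 0 = 0 by rewrite vB mul0mx mxE.
  have hE : v *m B t *m v^T = t *: (v *m A *m v^T) + (1 - t) *: (v *m v^T).
    by rewrite /B mulmxDr -!scalemxAr mulmx1 mulmxDl -!scalemxAl.
  have h1 := pA v v0; have h2 := pI v v0.
  have h3 : t * (v *m A *m v^T) 0 0 + (1 - t) * (v *m v^T) 0 0 = 0.
    have aux (X Y : 'M[R]_1) : (t *: X + (1 - t) *: Y) 0 0 = t * X 0 0 + (1 - t) * Y 0 0.
      by rewrite !mxE.
    by rewrite -h0 hE aux.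
  move: h1 h2 h3; move: ((v *m A *m v^T) 0 0) ((v *m v^T) 0 0) => a b a0 b0.
  apply/eqP; rewrite gt_eqF//.
  have [->|t0'] := eqVneq t 0; first by rewrite mul0r add0r subr0 mul1r.
  rewrite ltr_wpDr//; first by rewrite mulr_ge0 ?subr_ge0// ltW.
  by rewrite mulr_gt0// lt_neqAle eq_sym t0'.
have cB : continuous (fun t => \det (B t)).
  move=> t; apply: continuous_det => i j.
  have -> : (fun t => B t i j) = (fun t => t * A i j + (1 - t) * (1%:M : 'M[R]_n) i j).
    by apply/funext => u; rewrite !mxE.
  apply: cvgD; first by apply: cvgM; [exact: cvg_id|exact: cvg_cst].
  apply: cvgM; last exact: cvg_cst.
  by apply: cvgB; [exact: cvg_cst|exact: cvg_id].
have B0 : \det (B 0) = 1 by rewrite /B scale0r add0r subr0 scale1r det1.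
have B1 : \det (B 1) = \det A by rewrite /B scale1r subrr scale0r addr0.
rewrite ltNge; apply/negP => detA.
have [||t /[!in_itv]/= t01 /eqP] := @IVT R (fun t => \det (B t)) 0 1 0 ler01.
- exact: continuous_subspaceT.
- by rewrite B0 B1 ge_min detA orbT le_max ler01.
by apply/negP; apply: Bneq0.
Qed.

(** * The Riemannian Jacobian in charts *)

Section manifold_charts.
Context {R : realType} {d : nat} {M : topologicalType}.
Variable g : riemannian_manifold R d M.
Implicit Types (c phi psi : chart R d M) (x : M) (u : 'rV[R]_d).

Definition gram_det c u : R := \det (metric g c u).

Lemma gram_det_gt0 c u : atlas g c -> chart_target c u -> 0 < gram_det c u.
Proof.
by move=> ac cu; apply: posdef_det_gt0 => v v0; exact: (metric_pos ac cu v0).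
Qed.

Lemma sqrt_gram_det_neq0 c x : atlas g c -> chart_source c x ->
  Num.sqrt (gram_det c (c x)) != 0.
Proof.
move=> ac cx; apply: lt0r_neq0; rewrite sqrtr_gt0.
exact: gram_det_gt0 ac (chart_fun_target cx).
Qed.

Lemma chart_domain_open c (f : M -> M) psi : continuous f ->
  open (chart_target c `&` (f \o chart_inv c) @^-1` chart_source psi).
Proof.
move=> cf; rewrite openE => u [cu fu].
apply: filterI; first by apply: open_near => //; exact: open_chart_target.
have : {for u, continuous (f \o chart_inv c)}.
  apply: continuous_comp; last exact: cf.
  exact: chart_inv_continuous cu.
by apply; exact: open_near (open_chart_source psi) fu.
Qed.

Lemma near_chart_inv c x (D : set M) : chart_source c x -> open D -> D x ->
  \forall u \near c x, chart_target c u /\ D (chart_inv c u).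
Proof.
move=> cx oD Dx; have cu := chart_fun_target cx.
apply: filterI; first by apply: open_near => //; exact: open_chart_target.
apply: (chart_inv_continuous cu); rewrite chart_funK//.
exact: open_near oD Dx.
Qed.

Lemma transition_differentiable c c' x : atlas g c -> atlas g c' ->
  chart_source c x -> chart_source c' x ->
  differentiable (c' \o chart_inv c) (c x).
Proof.
move=> ac ac' cx c'x; have [+ _] := transition_smooth ac ac' 1%N; apply.
by split; [exact: chart_fun_target|rewrite /= chart_funK].
Qed.

Lemma metric_transition_mx c c' x : atlas g c -> atlas g c' ->
  chart_source c x -> chart_source c' x ->
  metric g c (c x) = 'J (c' \o chart_inv c) (c x) *m metric g c' (c' x) *m
    ('J (c' \o chart_inv c) (c x))^T.
Proof.
move=> ac ac' cx c'x; have cu := chart_fun_target cx.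
have c'u : chart_source c' (chart_inv c (c x)) by rewrite chart_funK.
apply/matrixP => i j.
have := metric_transition (delta_mx 0 i) (delta_mx 0 j) ac ac' cu c'u.
rewrite /= chart_funK// => /matrixP/(_ 0 0).
rewrite -!(mul_rV_lin1 ('d _ _)) -/(jacobian _ _).
move: ('J _ _) (metric g c (c x)) (metric g c' (c' x)) => J A B.
have delE (N : 'M[R]_d) :
    ((delta_mx 0 i : 'rV[R]_d) *m N *m (delta_mx 0 j : 'rV[R]_d)^T) 0 0 = N i j.
  by rewrite -rowE trmx_delta -colE !mxE.
by rewrite delE trmx_mul !mulmxA -(delE (J *m B *m J^T)) !mulmxA.
Qed.

Lemma gram_det_transition c c' x : atlas g c -> atlas g c' ->
  chart_source c x -> chart_source c' x ->
  Num.sqrt (gram_det c (c x)) =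
  `|\det ('J (c' \o chart_inv c) (c x))| * Num.sqrt (gram_det c' (c' x)).
Proof.
move=> ac ac' cx c'x; rewrite /gram_det (metric_transition_mx ac ac' cx c'x).
rewrite !det_mulmx det_tr mulrAC -expr2 sqrtrM ?sqr_ge0//.
by rewrite sqrtr_sqr.
Qed.

Lemma jac_change_scalar (b a s j q : R) : j != 0 -> q != 0 ->
  b * (a * s / q) = j * b * a * (s / (j * q)).
Proof. by move=> j0 q0; field; rewrite j0 q0. Qed.

Section jacobian.
Variable f : M -> M.
Hypothesis f_continuous : continuous f.
Variable r : R.
Hypothesis r1 : 1 < r.
Hypothesis f_Cr : Cr_map g r f.

Definition local_expr phi psi := psi \o f \o chart_inv phi.

Definition jac_factor phi psi x : R :=
  Num.sqrt (gram_det psi (psi (f x))) / Num.sqrt (gram_det phi (phi x)).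

Definition local_jac phi psi x : R :=
  `|\det ('J (local_expr phi psi) (phi x))| * jac_factor phi psi x.

Lemma abs_jacE x : abs_jac g f x = local_jac (chart_at g x) (chart_at g (f x)) x.
Proof. by rewrite /abs_jac /local_jac mulrA. Qed.

Let dom phi psi := chart_target phi `&` (f \o chart_inv phi) @^-1` chart_source psi.

Lemma local_expr_C1 phi psi : atlas g phi -> atlas g psi ->
  C1_on (dom phi psi) (local_expr phi psi) /\
  forall v, local_holder (holder_exponent r) (dom phi psi)
    (fun u => 'd (local_expr phi psi) u v).
Proof.
move=> aphi apsi; apply: (Cr_on_C1 _ r1); first exact: chart_domain_open.
by have [_ ] := f_Cr; exact.
Qed.

(** By the chain rule the determinant picks up those of the two chart transitions, and the Gram
    factors absorb them. The reference charts in [abs_jac] change with the point without any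
    regularity; thanks to this invariance, fixed charts serve in a whole neighbourhood. *)
Lemma local_jac_invariant phi psi phi' psi' x :
  atlas g phi -> atlas g psi -> atlas g phi' -> atlas g psi' ->
  chart_source phi x -> chart_source phi' x ->
  chart_source psi (f x) -> chart_source psi' (f x) ->
  local_jac phi psi x = local_jac phi' psi' x.
Proof.
move=> a1 a2 a3 a4 s1 s3 s2 s4.
pose t1 := phi \o chart_inv phi'; pose t2 := psi' \o chart_inv psi.
pose F := local_expr phi psi.
have dt1 : differentiable t1 (phi' x) by exact: transition_differentiable.
have t1x : t1 (phi' x) = phi x by rewrite /t1 /= chart_funK.
have dF : differentiable F (phi x).
  have [[+ _] _] := local_expr_C1 a1 a2; apply; split; first exact: chart_fun_target.
  by rewrite /= chart_funK.
have Fx : F (phi x) = psi (f x) by rewrite /F /local_expr /= chart_funK.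
have dt2 : differentiable t2 (psi (f x)) by exact: transition_differentiable.
have dFt1 : differentiable (F \o t1) (phi' x).
  by apply: differentiable_comp => //; rewrite t1x.
have nearE : \forall u \near phi' x, (t2 \o (F \o t1)) u = local_expr phi' psi' u.
  have oD : open (chart_source phi `&` f @^-1` chart_source psi).
    apply: openI; first exact: open_chart_source.
    by move/continuousP : f_continuous; apply; exact: open_chart_source.
  have := near_chart_inv s3 oD (conj s1 s2).
  apply: filterS => u [tu [pu fu]].
  by rewrite /t2 /F /t1 /local_expr /= chart_funK// chart_funK.
have d2 : differentiable (t2 \o (F \o t1)) (phi' x).
  by apply: differentiable_comp => //; rewrite /= t1x Fx.
have [_ dE] := near_eq_diff nearE d2.
have JE : 'J (local_expr phi' psi') (phi' x) = 'J t1 (phi' x) *m 'J F (phi x) *m 'J t2 (psi (f x)).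
  transitivity ('J (t2 \o (F \o t1)) (phi' x)).
    exact: (congr1 (@lin1_mx R d d) dE).
  have dF' : differentiable F (t1 (phi' x)) by rewrite t1x.
  have dt2' : differentiable t2 (F (t1 (phi' x))) by rewrite t1x Fx.
  by have := jacobian_comp3 dt1 dF' dt2'; rewrite t1x Fx.
have g1 : Num.sqrt (gram_det phi' (phi' x)) =
    `|\det ('J t1 (phi' x))| * Num.sqrt (gram_det phi (phi x)).
  exact: gram_det_transition.
have g2 : Num.sqrt (gram_det psi (psi (f x))) =
    `|\det ('J t2 (psi (f x)))| * Num.sqrt (gram_det psi' (psi' (f x))).
  exact: gram_det_transition.
have p1 : Num.sqrt (gram_det phi (phi x)) != 0 := sqrt_gram_det_neq0 a1 s1.
have p3 : Num.sqrt (gram_det phi' (phi' x)) != 0 := sqrt_gram_det_neq0 a3 s3.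
have j1 : `|\det ('J t1 (phi' x))| != 0.
  by apply: contraNneq p3 => h; rewrite g1 h mul0r.
rewrite /local_jac /jac_factor JE !det_mulmx !normrM g2 g1.
exact: jac_change_scalar j1 p1.
Qed.

Lemma continuous_gram_det c x : atlas g c -> chart_source c x ->
  {for x, continuous (fun y => gram_det c (c y))}.
Proof.
move=> ac cx.
apply: (@continuous_comp _ _ _ c (gram_det c)); first exact: chart_fun_continuous.
apply: continuous_det => i j.
apply: (@continuous_comp _ _ _ (metric g c) (fun N : 'M[R]_d => N i j)).
  have := metric_smooth ac 0%N; move=> /= /(_ _ (chart_fun_target cx))[+ _]; exact.
exact: coord_continuous.
Qed.

Lemma continuous_jac_factor phi psi x : atlas g phi -> atlas g psi ->
  chart_source phi x -> chart_source psi (f x) ->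
  {for x, continuous (jac_factor phi psi)}.
Proof.
move=> a1 a2 s1 s2; apply: cvgM.
  apply: (@continuous_comp _ _ _ (fun y => gram_det psi (psi (f y))) Num.sqrt).
    apply: (@continuous_comp _ _ _ f (fun z => gram_det psi (psi z))).
      exact: f_continuous.
    exact: continuous_gram_det.
  exact: sqrt_continuous.
apply: cvgV; first exact: sqrt_gram_det_neq0.
apply: (@continuous_comp _ _ _ (fun y => gram_det phi (phi y)) Num.sqrt).
  exact: continuous_gram_det.
exact: sqrt_continuous.
Qed.

Lemma near_abs_jacE x : \forall y \near x,
  abs_jac g f y = local_jac (chart_at g x) (chart_at g (f x)) y.
Proof.
have nearD : \forall y \near x,
    chart_source (chart_at g x) y /\ chart_source (chart_at g (f x)) (f y).
  apply: filterI; first exact: open_near (open_chart_source _) (chart_at_source g x).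
  by apply: f_continuous; exact: open_near (open_chart_source _) (chart_at_source g (f x)).
apply: filterS nearD => y [sy fy]; rewrite abs_jacE.
by apply: local_jac_invariant => //; first [exact: chart_at_atlas|exact: chart_at_source].
Qed.

Lemma continuous_abs_jac : continuous (abs_jac g f).
Proof.
move=> x; set phi := chart_at g x; set psi := chart_at g (f x).
have a1 : atlas g phi by exact: chart_at_atlas.
have a2 : atlas g psi by exact: chart_at_atlas.
have s1 : chart_source phi x by exact: chart_at_source.
have s2 : chart_source psi (f x) by exact: chart_at_source.
have cl : {for x, continuous (local_jac phi psi)}.
  apply: cvgM; last exact: continuous_jac_factor.
  apply: cvg_norm.
  apply: (@continuous_comp _ _ _ phi (fun u => \det ('J (local_expr phi psi) u))).
    exact: chart_fun_continuous.
  apply: continuous_det => i j.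
  have -> : (fun y => ('J (local_expr phi psi) y) i j) =
      (fun y => ('d (local_expr phi psi) y (delta_mx 0 i)) 0 j).
    by apply/funext => y; rewrite /jacobian /lin1_mx mxE.
  apply: (@continuous_comp _ _ _ (fun y => 'd (local_expr phi psi) y (delta_mx 0 i))
    (fun N : 'rV[R]_d => N 0 j)); last exact: coord_continuous.
  have [[_ +] _] := local_expr_C1 a1 a2; apply; split; first exact: chart_fun_target.
  by rewrite /= chart_funK.
have nE := near_abs_jacE x; rewrite -/phi -/psi in nE.
rewrite /continuous_at (nbhs_singleton nE).
apply: cvg_trans cl; apply: near_eq_cvg.
by apply: filterS nE => y ->.
Qed.

Lemma abs_jac_ge0 x : 0 <= abs_jac g f x.
Proof. by rewrite abs_jacE mulr_ge0// divr_ge0// sqrtr_ge0. Qed.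

(** Transfer of [jacobian_separation] to [M]: the neighbourhood is small enough for the Gram factor
    to exceed its value at [p] by at most 1, and for the chart image to lie in the unit ball around
    [phi p], as the later dyadic count requires. *)
Lemma chart_separation (p : M) : exists (W : set M) (phi : M -> 'rV[R]_d) (K : R),
  [/\ open W /\ W p, 0 <= K, {for p, continuous phi},
      forall y, W y -> `|phi y - phi p| <= 1 &
      forall y z, W y -> W z -> f y = f z -> y != z ->
        phi y != phi z /\
        abs_jac g f y <= K * `|phi y - phi z| `^ holder_exponent r].
Proof.
set phi := chart_at g p; set psi := chart_at g (f p).
have a1 : atlas g phi by exact: chart_at_atlas.
have a2 : atlas g psi by exact: chart_at_atlas.
have s1 : chart_source phi p by exact: chart_at_source.
have s2 : chart_source psi (f p) by exact: chart_at_source.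
have [C1F hF] := local_expr_C1 a1 a2.
have dp : dom phi psi (phi p).
  by split; [exact: chart_fun_target|rewrite /= chart_funK].
have [rho [K [rho0 K0 _ sep]]] := jacobian_separation (holder_exponent_gt0 r1)
  (chart_domain_open f_continuous) C1F hF dp.
pose good y := [/\ chart_source phi y,
    ball (phi p) (Num.min rho 1) (phi y), jac_factor phi psi y <= jac_factor phi psi p + 1 &
    abs_jac g f y = local_jac phi psi y].
have nearW : \forall y \near p, good y.
  near=> y; split.
  - by near: y; exact: open_near (open_chart_source _) s1.
  - near: y; apply: (chart_fun_continuous s1).
    by apply: nbhsx_ballx; rewrite lt_min rho0 ltr01.
  - near: y.
    have /cvgrPdist_le/(_ 1 ltr01) := continuous_jac_factor a1 a2 s1 s2.
    apply: filterS => y hy; rewrite -lerBlDl (le_trans _ hy)//.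
    by rewrite distrC ler_norm.
  - by near: y; exact: near_abs_jacE.
pose W : set M := interior good.
have WE y : W y -> good y by move=> /nbhs_singleton.
have jf0 y : 0 <= jac_factor phi psi y by rewrite divr_ge0// sqrtr_ge0.
exists W, phi, (K * (jac_factor phi psi p + 1)); split.
- by split; [exact: open_interior|exact: nearW].
- by rewrite mulr_ge0// addr_ge0.
- exact: chart_fun_continuous.
- move=> y /WE[_ + _ _]; rewrite -ball_normE /= distrC => /ltW /le_trans; apply.
  by rewrite ge_min lexx orbT.
move=> y z /WE[sy by_ jy Jy] /WE[sz bz jz Jz] fyz yz.
have pyz : phi y != phi z.
  by apply: contraNneq yz => h; rewrite -(chart_funK sy) -(chart_funK sz) h.
split => //.
have By : ball (phi p) rho (phi y) by apply: le_ball by_; rewrite ge_min lexx.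
have Bz : ball (phi p) rho (phi z) by apply: le_ball bz; rewrite ge_min lexx.
have Fyz : local_expr phi psi (phi y) = local_expr phi psi (phi z).
  by rewrite /local_expr /= !chart_funK// fyz.
have := sep _ _ By Bz Fyz pyz; rewrite Jy /local_jac => h.
apply: (@le_trans _ _ ((K * `|phi y - phi z| `^ holder_exponent r) * (jac_factor phi psi p + 1))).
  by apply: ler_pM.
by rewrite mulrAC.
Unshelve. all: by end_near.
Qed.

End jacobian.
End manifold_charts.

(** * Sums of the Jacobian along fibres *)

Section separated_points.
Context {R : realType} {T : eqType} {d : nat}.
Variables (v : T -> 'rV[R]_d) (t : T -> R).

(** Pigeonhole on the cubes of side h = 2^-(n+1) covering [-1, 1]^d: two points in one cube are at
    distance at most h in the maximum norm. Each coordinate index is at most 2^(n+2), endpoint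
    included, and is therefore below 2^(n+3). *)
Lemma separated_count (s : seq T) (n : nat) : uniq s ->
  (forall y, y \in s -> `|v y| <= 1) ->
  (forall y z, y \in s -> z \in s -> y != z -> 2^-1 ^+ n.+1 < `|v y - v z|) ->
  (size s <= (2 ^ n.+3) ^ d)%N.
Proof.
move=> us v1 sep; set h : R := 2^-1 ^+ n.+1.
have h0 : 0 < h by rewrite exprn_gt0// invr_gt0.
have hV : h^-1 = 2 ^+ n.+1 by rewrite /h exprVn invrK.
pose num y (k : 'I_d) : R := (v y 0 k + 1) / h.
have vk y k : y \in s -> -1 <= v y 0 k <= 1.
  by move=> ys; rewrite -ler_norml (le_trans (coord_norm_le _ _))// v1.
have num0 y k : y \in s -> 0 <= num y k.
  by move=> ys; apply: divr_ge0; [have := vk y k ys; lra|exact: ltW].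
have numlt y k : y \in s -> (Num.truncn (num y k) < (2 ^ n.+3).-1.+1)%N.
  move=> ys; rewrite prednK ?expn_gt0//.
  rewrite -(ltr_nat R); have /andP[/le_lt_trans + _] := truncn_itv (num0 y k ys); apply.
  rewrite /num hV natrX.
  have : (v y 0 k + 1) * 2 ^+ n.+1 <= 2 * 2 ^+ n.+1.
    by rewrite ler_pM2r ?exprn_gt0//; have := vk y k ys; lra.
  move=> /le_lt_trans; apply; rewrite -exprS ltr_eXn2l//; lra.
pose cell y : {ffun 'I_d -> 'I_(2 ^ n.+3).-1.+1} := [ffun k => inord (Num.truncn (num y k))].
have cell_inj : {in s &, injective cell}.
  move=> y z ys zs yz; apply/eqP; apply: contraT => ynz.
  have := sep y z ys zs ynz; rewrite ltNge => /negP[].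
  apply: row_norm_le; first exact: ltW.
  move=> k; move/ffunP/(_ k) : yz; rewrite !ffunE => /(congr1 val).
  rewrite /= !inordK ?numlt// => e.
  have /andP[y1 y2] := truncn_itv (num0 y k ys).
  have /andP[z1 z2] := truncn_itv (num0 z k zs).
  rewrite e in y1 y2.
  have : `|num y k - num z k| <= 1.
    by rewrite ler_norml; rewrite -natr1 in y2 z2; lra.
  rewrite /num -mulrBl normrM normfV (gtr0_norm h0) ler_pdivrMr// mul1r !mxE.
  by rewrite opprD addrACA subrr addr0.
have : uniq (map cell s) by rewrite map_inj_in_uniq.
move/card_uniqP; rewrite size_map => <-.
apply: (leq_trans (max_card _)).
by rewrite card_ffun !card_ord prednK ?expn_gt0.
Qed.

(* There are at most [(2 ^ n.+3) ^ d] points with [t y > 2^-1 ^+ n.+1], so the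
   exponent [d.+1] makes the sum over the dyadic levels geometric. *)
Lemma separated_sum (s : seq T) : uniq s ->
  (forall y, y \in s -> `|v y| <= 1) ->
  (forall y, y \in s -> 0 <= t y <= 1) ->
  (forall y z, y \in s -> z \in s -> y != z -> t y <= `|v y - v z|) ->
  \sum_(y <- s) t y ^+ d.+1 <= 8 ^+ d * 2.
Proof.
move=> us v1 t01 sep.
pose lev (n : nat) y := 2^-1 ^+ n.+1 < t y.
have hN y : exists n, t y = 0 \/ (0 < t y -> lev n y).
  have [t0|t0] := leP (t y) 0; first by exists 0%N; right.
  have [n hn] : exists n, (t y)^-1 < 2 ^+ n.+1.
    exists (Num.truncn (t y)^-1); apply: (lt_le_trans (truncnS_gt (t y)^-1)).
    by rewrite -natrX ler_nat ltnW// ltn_expl.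
  exists n; right => _; rewrite /lev exprVn.
  by rewrite -(invrK (t y)) ltf_pV2 ?posrE ?exprn_gt0 ?invr_gt0.
have lev_mono n m y : (n <= m)%N -> lev n y -> lev m y.
  move=> nm; apply: le_lt_trans; apply: ler_wiXn2l => //.
  by rewrite invf_le1 ?ler1n.
have [Nmax hmax] : exists N, forall y, y \in s -> 0 < t y -> lev N y.
  elim: (s) => [|y s' [N IH]]; first by exists 0%N.
  have [m hm] := hN y; exists (maxn m N) => z; rewrite inE => /orP[/eqP ->|zs] tz.
    case: hm => [t0|/(_ tz)]; first by rewrite t0 ltxx in tz.
    by apply: lev_mono; rewrite leq_maxl.
  by apply: (lev_mono N); [rewrite leq_maxr|exact: IH].
have termle y : y \in s -> t y ^+ d.+1 <=
    \sum_(n < Nmax.+1) (if lev n y then (2^-1 ^+ n) ^+ d.+1 else 0).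
  move=> ys; have /andP[t0 t1] := t01 y ys.
  have sum0 (P : pred 'I_Nmax.+1) : 0 <= \sum_(n < Nmax.+1 | P n)
      (if lev n y then (2^-1 ^+ n : R) ^+ d.+1 else 0).
    by apply: sumr_ge0 => n _; case: ifP => // _; rewrite !exprn_ge0// invr_ge0.
  move: t0; rewrite le_eqVlt => /orP[/eqP <-|t0]; first by rewrite expr0n.
  have ex : exists n, lev n y by exists Nmax; exact: hmax.
  (* Each point is charged to its least level, where t y <= 2^-n by minimality, or by [t y <= 1] at
     level 0. *)
  case: (ex_minnP ex) => n ln nmin.
  have nN : (n < Nmax.+1)%N by rewrite ltnS; apply: nmin; exact: hmax.
  rewrite (bigD1 (Ordinal nN))//= ln; apply: ler_wpDr; first exact: sum0.
  apply: lerXn2r; rewrite ?nnegrE ?(ltW t0) ?exprn_ge0 ?invr_ge0//.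
  case: n ln nmin nN => [|n] ln nmin nN; first by rewrite expr0.
  rewrite leNgt; apply/negP => h.
  by have := nmin n h; rewrite ltnn.
rewrite big_seq; apply: (le_trans (ler_sum _ termle)); rewrite -big_seq exchange_big/=.
(* The factor 8^d comes from (2^-n)^(d+1) (2^(n+3))^d = 8^d 2^-n. *)
have levelle (n : 'I_Nmax.+1) :
    \sum_(y <- s) (if lev n y then (2^-1 ^+ n : R) ^+ d.+1 else 0) <= 8 ^+ d * 2^-1 ^+ n.
  rewrite -big_mkcond/= -big_filter big_const_seq count_predT iter_addr_0.
  have cnt : (size [seq y <- s | lev n y] <= (2 ^ n.+3) ^ d)%N.
    apply: separated_count.
    - by rewrite filter_uniq.
    - by move=> y; rewrite mem_filter => /andP[_]; exact: v1.
    - move=> y z; rewrite !mem_filter => /andP[ly ys] /andP[_ zs] yz.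
      exact: lt_le_trans ly (sep _ _ ys zs yz).
  apply: (@le_trans _ _ ((2^-1 ^+ n) ^+ d.+1 *+ ((2 ^ n.+3) ^ d))).
    by apply: ler_wpMn2l; rewrite ?exprn_ge0 ?invr_ge0.
  rewrite -mulr_natr !natrX exprS -mulrA -exprMn.
  have -> : (2^-1 ^+ n : R) * 2 ^+ n.+3 = 8.
    rewrite -addn3 exprD mulrA -exprMn mulVf ?pnatr_eq0// expr1n mul1r.
    by rewrite !exprS expr0; ring.
  by rewrite mulrC.
apply: (le_trans (ler_sum _ (fun n _ => levelle n))).
rewrite -mulr_sumr ler_pM2l ?exprn_gt0//.
have -> : \sum_(n < Nmax.+1) (2^-1 ^+ n : R) = 2 - 2^-1 ^+ Nmax.
  elim: (Nmax) => [|m IH]; first by rewrite big_ord1 !expr0; lra.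
  by rewrite big_ord_recr/= IH !exprS; field.
by rewrite lerBlDr lerDl exprn_ge0// invr_ge0.
Qed.

End separated_points.

Section fibers.
Context {R : realType} {d : nat} {M : ptopologicalType}.
Variable g : riemannian_manifold R d M.
Hypothesis M_compact : compact [set: M].
Variable r : R.
Hypothesis r1 : 1 < r.
Variable f : M -> M.
Hypothesis f_Cr : Cr_map g r f.
Let f_continuous : continuous f. Proof. by case: f_Cr. Qed.
Let J := abs_jac g f.
Let J_continuous : continuous J. Proof. exact: (continuous_abs_jac f_continuous r1 f_Cr). Qed.
Let J_ge0 x : 0 <= J x. Proof. exact: abs_jac_ge0. Qed.
Let alpha := holder_exponent r.
Let alpha0 : 0 < alpha. Proof. exact: holder_exponent_gt0. Qed.

(** Two points of one fibre close to [p] would, by the separation estimate, have a small Jacobian,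
    whereas J stays above J(p) / 2 near [p]. *)
Lemma locally_injective_off_degenerate (p : M) : J p != 0 ->
  exists U : set M, [/\ open U, U p & {in U &, injective f}].
Proof.
move=> Jp; have {Jp}Jp : 0 < J p by rewrite lt_def Jp J_ge0.
have [W [phi [K [[oW Wp] K0 cphi _ sep]]]] := chart_separation f_continuous r1 f_Cr p.
(* Then K e <= J(p) / 2, and [s] below is the distance with s^alpha = e. *)
pose e := J p / 2 / (K + 1).
have K1 : 0 < K + 1 by exact: ltr_wpDl.
have e0 : 0 < e by apply: divr_gt0 => //; exact: divr_gt0.
pose s := e `^ alpha^-1.
have s0 : 0 < s by rewrite powR_gt0.
have sa : s `^ alpha = e by rewrite -powRrM mulVf ?gt_eqF// powRr1// ltW.
pose U : set M := interior [set y | [/\ W y, J p / 2 < J y & `|phi p - phi y| < s / 2]].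
have UE y : U y -> [/\ W y, J p / 2 < J y & `|phi p - phi y| < s / 2].
  by move=> /nbhs_singleton.
exists U; split.
- exact: open_interior.
- have n1 : \forall y \near p, W y by exact: open_near.
  have n2 : \forall y \near p, J p / 2 < J y.
    have J2 : 0 < J p / 2 by rewrite divr_gt0.
    have /cvgrPdist_lt/(_ _ J2) := @J_continuous p.
    by apply: filterS => y; rewrite ltr_norml => /andP[_]; lra.
  have n3 : \forall y \near p, `|phi p - phi y| < s / 2.
    by move/cvgrPdist_lt : cphi; apply; rewrite divr_gt0.
  by near=> y; split; near: y.
move=> y z /set_mem/UE[Wy Jy py] /set_mem/UE[Wz Jz pz] fyz.
apply/eqP; apply: contraT => yz; have [_] := sep y z Wy Wz fyz yz.
rewrite -/J -/alpha leNgt => /negP[]; apply: le_lt_trans Jy.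
have yz_s : `|phi y - phi z| <= s.
  rewrite -(subrKA (phi p)) (le_trans (ler_normD _ _))// distrC.
  by rewrite (splitr s) lerD// ltW.
apply: (@le_trans _ _ (K * e)).
  rewrite ler_wpM2l// -sa; apply: ge0_ler_powR; rewrite ?nnegrE//; exact: ltW.
rewrite /e mulrCA ler_piMr ?divr_ge0//.
by rewrite ler_pdivrMr ?ltr_wpDl// mul1r lerDl.
Unshelve. all: by end_near.
Qed.

(** As q >= 1 / alpha, a bound j <= D^alpha with j in [0, 1] becomes j^q <= D, the linear separation
    that [separated_sum] expects. *)
Let q : nat := (Num.truncn alpha^-1).+1.

Let jac_bounded : exists2 B : R, 0 < B & forall x, J x <= B.
Proof.
have cJM : compact (J @` [set: M]).
  by apply: continuous_compact => //; exact: continuous_subspaceT.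
have [B [_ hB]] := compact_bounded cJM.
exists (`|B| + 1); first by rewrite ltr_wpDl.
move=> x; apply: (le_trans (ler_norm _)); apply: hB; last by exists x.
by rewrite (le_lt_trans (ler_norm _))// ltrDl.
Qed.

Lemma local_fiber_sum (p : M) : exists (W : set M) (C : R),
  [/\ open W, W p & forall x (s : seq M), uniq s ->
    (forall y, y \in s -> W y /\ f y = x) ->
    \sum_(y <- s) J y ^+ (q * d.+1) <= C].
Proof.
have [W [phi [K [[oW Wp] K0 cphi phi1 sep]]]] := chart_separation f_continuous r1 f_Cr p.
have [B B0 hB] := jac_bounded.
(* Division by [A] brings J into [0, 1], because of [B], and the constant of the Hoelder separation
   down to at most 1, because of [K]. *)
pose A := B + K.
have A0 : 0 < A by rewrite ltr_wpDr.
exists W, (A ^+ (q * d.+1) * (8 ^+ d * 2)); split => // x s us sW.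
pose j y := J y / A.
have j01 y : 0 <= j y <= 1.
  rewrite divr_ge0// ?(ltW A0)//= ler_pdivrMr// mul1r.
  by rewrite (le_trans (hB y))// lerDl.
have JE y : J y ^+ (q * d.+1) = A ^+ (q * d.+1) * (j y ^+ q) ^+ d.+1.
  by rewrite -exprM -exprMn /j mulrCA divff ?gt_eqF// mulr1.
rewrite (eq_bigr _ (fun y _ => JE y)) -mulr_sumr ler_pM2l ?exprn_gt0//.
apply: (@separated_sum _ _ _ (fun y => phi y - phi p)) => //.
- by move=> y /sW[Wy _]; exact: phi1.
- by move=> y _; have /andP[? ?] := j01 y; rewrite exprn_ge0//= exprn_ile1.
move=> y z /sW[Wy fy] /sW[Wz fz] yz.
have [pyz hJ] := sep y z Wy Wz (etrans fy (esym fz)) yz.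
have -> : phi y - phi p - (phi z - phi p) = phi y - phi z.
  by rewrite opprB addrA subrK.
set D := `|phi y - phi z|; have D0 : 0 < D by rewrite normr_gt0 subr_eq0.
have jD : j y <= D `^ alpha.
  rewrite /j ler_pdivrMr// mulrC; apply: (le_trans hJ).
  by rewrite ler_wpM2r ?powR_ge0// /A lerDr ltW.
have /andP[j0 j1] := j01 y.
have [->|jn0] := eqVneq (j y) 0; first by rewrite expr0n/= ltW.
have jp : 0 < j y by rewrite lt_def jn0.
apply: (@le_trans _ _ (j y `^ alpha^-1)).
  rewrite -powR_mulrn//; apply: ger_powR; first by rewrite jp.
  by rewrite /q ltW// truncnS_gt// num_real.
have -> : D = (D `^ alpha) `^ alpha^-1.
  by rewrite -powRrM divff ?gt_eqF// powRr1// ltW.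
apply: ge0_ler_powR => //; rewrite ?nnegrE ?powR_ge0//.
by rewrite invr_ge0 ltW.
Qed.

(** By compactness finitely many of the local neighbourhoods cover [M]; each point of a fibre is
    counted in at least one of them, so the local constants add up to a global one. *)
Lemma fiber_sum_bounded : exists (N : nat) (C0 : R), forall x (s : seq M), uniq s ->
  (forall y, y \in s -> f y = x) -> \sum_(y <- s) J y ^+ N <= C0.
Proof.
have /choice[W hW] : forall p : M, exists W : set M, exists C : R,
  [/\ open W, W p & forall x (s : seq M), uniq s ->
    (forall y, y \in s -> W y /\ f y = x) ->
    \sum_(y <- s) J y ^+ (q * d.+1) <= C] by exact: local_fiber_sum.
have /choice[C hC] := hW.
have : cover_compact [set: M] by rewrite -compact_cover.
move=> /(_ M setT W (fun p _ => let: And3 o _ _ := hC p in o)).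
case=> [p _|P _ cov].
  by exists p => //; have [] := hC p.
exists (q * d.+1)%N, (\sum_(p <- finmap.enum_fset P) C p) => x s us sx.
apply: (@le_trans _ _ (\sum_(p <- finmap.enum_fset P)
   \sum_(y <- [seq y <- s | `[< W p y >]]) J y ^+ (q * d.+1))).
  under [leRHS]eq_bigr do rewrite big_filter.
  rewrite (exchange_big_dep xpredT)//=; apply: ler_sum => y _.
  have [p /= pP Wpy] := cov y Logic.I.
  rewrite big_mkcond (bigD1_seq p)/=; [|exact: pP|exact: finmap.fset_uniq].
  rewrite asboolT// lerDl; apply: sumr_ge0 => p' _.
  by case: ifP => // _; rewrite exprn_ge0.
apply: ler_sum => p _; have [_ _] := hC p; apply; first by rewrite filter_uniq.
by move=> y; rewrite mem_filter => /andP[/asboolP Wy ys]; split => //; exact: sx.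
Qed.

End fibers.

(** * Lower bounds for the Riemannian distance *)

Section quadratic_forms.
Context {R : realType} {n : nat}.
Implicit Types (A : 'M[R]_n) (w : 'rV[R]_n).

Lemma quadratic_formE A w :
  (w *m A *m w^T) 0 0 = \sum_i \sum_j w 0 i * A i j * w 0 j.
Proof.
rewrite exchange_big mxE; apply: eq_bigr => j _.
by rewrite !mxE mulr_suml; apply: eq_bigr.
Qed.

Lemma quadratic_formZ A (a : R) w :
  ((a *: w) *m A *m (a *: w)^T) 0 0 = a ^+ 2 * (w *m A *m w^T) 0 0.
Proof.
by rewrite !quadratic_formE mulr_sumr; apply: eq_bigr => i _;
  rewrite mulr_sumr; apply: eq_bigr => j _; rewrite !mxE; ring.
Qed.

Lemma continuous_quadratic_form A :
  continuous (fun w : 'rV[R]_n => (w *m A *m w^T) 0 0).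
Proof.
move=> w; under eq_fun do rewrite quadratic_formE.
rewrite /continuous_at.
apply: (@cvg_big R _ +%R 0 xpredT _ _ (nbhs w)) => [|i _]; first exact: add_continuous.
apply: (@cvg_big R _ +%R 0 xpredT _ _ (nbhs w)) => [|j _]; first exact: add_continuous.
apply: cvgM; last exact: coord_continuous.
by apply: cvgM; [exact: coord_continuous|exact: cvg_cst].
Qed.

Lemma compact_unit_sphere : compact [set w : 'rV[R]_n | `|w| = 1].
Proof.
apply: bounded_closed_compact.
  by exists 1; split; [exact: num_real|move=> x x1 w /= ->; exact: ltW].
have -> : [set w : 'rV[R]_n | `|w| = 1] = (fun w : 'rV[R]_n => `|w|) @^-1` [set 1 : R] by [].
apply: closed_comp; first by move=> w _; exact: norm_continuous.
exact: closed_eq.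
Qed.

Lemma posdef_norm_le A : (forall w, w != 0 -> 0 < (w *m A *m w^T) 0 0) ->
  exists2 lam : R, 0 < lam & forall w, lam * `|w| ^+ 2 <= (w *m A *m w^T) 0 0.
Proof.
move=> Apos.
suff [lam lam0 h] : exists2 lam : R, 0 < lam & forall w, `|w| = 1 ->
    lam <= (w *m A *m w^T) 0 0.
  exists lam => // w; have [->|w0] := eqVneq w 0.
    by rewrite normr0 expr0n/= mulr0 !mul0mx mxE.
  have nw : 0 < `|w| by rewrite normr_gt0.
  have w1 : `| `|w|^-1 *: w | = 1.
    by rewrite normrZ ger0_norm ?invr_ge0// mulVf ?gt_eqF.
  have := h _ w1; rewrite quadratic_formZ exprVn mulrC.
  by rewrite ler_pdivlMr// exprn_gt0.
(* The unit sphere is empty in dimension 0, where any constant will do. *)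
have [[w0 w01]|ne] := pselect ([set w : 'rV[R]_n | `|w| = 1] !=set0); last first.
  by exists 1 => // w w1; exfalso; apply: ne; exists w.
have [||z z1 zmin] := @EVT_min_rV R n (fun w => (w *m A *m w^T) 0 0)
  [set w | `|w| = 1] _ compact_unit_sphere.
- by exists w0.
- by apply: continuous_subspaceT => w; exact: continuous_quadratic_form.
exists ((z *m A *m z^T) 0 0).
  apply: Apos; move/set_mem : z1 => /= z1; apply/eqP => ze.
  by move: z1; rewrite ze normr0 => /eqP; rewrite eq_sym oner_eq0.
by move=> w w1; apply: zmin; exact/mem_set.
Qed.

(** A perturbation of the entries changes the form by at most |w|^2 times the sum of their
    variations, so half of the lower bound at [x] survives nearby. The square root lets [lam] act on
    lengths. *)
Lemma near_posdef_norm_le (T : topologicalType) (A : T -> 'M[R]_n) (x : T) :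
  (forall i j, {for x, continuous (fun y => A y i j)}) ->
  (forall w, w != 0 -> 0 < (w *m A x *m w^T) 0 0) ->
  exists2 lam : R, 0 < lam & \forall y \near x,
    forall w, (lam * `|w|) ^+ 2 <= (w *m A y *m w^T) 0 0.
Proof.
move=> cA /posdef_norm_le[m m0 hm].
exists (Num.sqrt (m / 2)); first by rewrite sqrtr_gt0 divr_gt0.
pose S y := \sum_i \sum_j `|A y i j - A x i j|.
have cS : {for x, continuous S}.
  apply: (@cvg_big R _ +%R 0 xpredT _ _ (nbhs x)) => [|i _]; first exact: add_continuous.
  apply: (@cvg_big R _ +%R 0 xpredT _ _ (nbhs x)) => [|j _]; first exact: add_continuous.
  by apply: cvg_norm; apply: cvgB; [exact: cA|exact: cvg_cst].
have Sx : S x = 0.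
  by rewrite /S big1// => i _; rewrite big1// => j _; rewrite subrr normr0.
have m20 : 0 < m / 2 by rewrite divr_gt0.
have /cvgrPdist_le/(_ _ m20) := cS; rewrite Sx; apply: filterS => y.
rewrite sub0r normrN ger0_norm; last by rewrite sumr_ge0// => i _; exact: sumr_ge0.
move=> Sy w; rewrite exprMn (sqr_sqrtr (ltW m20)).
have h : (w *m A x *m w^T) 0 0 - (w *m A y *m w^T) 0 0 <= `|w| ^+ 2 * S y.
  rewrite !quadratic_formE -sumrB mulr_sumr; apply: ler_sum => i _.
  rewrite -sumrB mulr_sumr; apply: ler_sum => j _.
  apply: (le_trans (ler_norm _)).
  have -> : w 0 i * A x i j * w 0 j - w 0 i * A y i j * w 0 j =
    (w 0 i * w 0 j) * (A x i j - A y i j) by ring.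
  rewrite normrM (distrC (A x i j)) normrM ler_wpM2r// expr2.
  by rewrite ler_pM// coord_norm_le.
have h2 : `|w| ^+ 2 * S y <= m / 2 * `|w| ^+ 2 by rewrite mulrC ler_wpM2r ?exprn_ge0.
have h3 : m * `|w| ^+ 2 = m / 2 * `|w| ^+ 2 + m / 2 * `|w| ^+ 2 by field.
have := hm w; rewrite h3 => hk.
by move: (le_trans h h2); rewrite lerBlDr => /(le_trans hk); rewrite lerD2l.
Qed.

End quadratic_forms.

Section curves.
Context {R : realType} {d : nat} {M : topologicalType}.
Variable g : riemannian_manifold R d M.
Variable c : R -> M.
Hypothesis c_C1 : C1_curve g c.
Let c_continuous : continuous c. Proof. by case: c_C1. Qed.

Lemma curve_chart_C1 phi : atlas g phi ->
  C1_on (c @^-1` chart_source phi : set R^o) (phi \o c : R^o -> 'rV[R]_d).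
Proof.
move=> aphi; have [_ /(_ phi aphi)] := c_C1.
by rewrite /Cr_on truncn1 => /holder_class_C1.
Qed.

Lemma curve_domain_open (phi : chart R d M) : open (c @^-1` chart_source phi).
Proof.
by move/continuousP : c_continuous; apply; exact: open_chart_source.
Qed.

(** The speed is defined through a reference chart that varies along the curve; by the tensor law of
    the metric a single chart can serve for a whole arc. *)
Lemma speedE phi t : atlas g phi -> chart_source phi (c t) ->
  let w := 'd (phi \o c : R^o -> 'rV[R]_d) (t : R^o) (1 : R^o) in
  speed g c t = Num.sqrt ((w *m metric g phi (phi (c t)) *m w^T) 0 0).
Proof.
move=> aphi sphi w; rewrite /speed; set psi := chart_at g (c t).
have apsi : atlas g psi by exact: chart_at_atlas.
have spsi : chart_source psi (c t) by exact: chart_at_source.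
pose tau := psi \o chart_inv phi.
have dphi : differentiable (phi \o c : R^o -> 'rV[R]_d) (t : R^o).
  by have [+ _] := curve_chart_C1 aphi; exact.
have dtau : differentiable tau (phi (c t)) by apply: (@transition_differentiable _ _ _ g).
have dcomp : differentiable (tau \o (phi \o c : R^o -> 'rV[R]_d)) (t : R^o).
  by apply: differentiable_comp.
have nearE : \forall s \near (t : R^o), (tau \o (phi \o c)) s = (psi \o c) s.
  have : nbhs (t : R^o) (c @^-1` chart_source phi).
    by apply: open_near => //; exact: curve_domain_open.
  by apply: filterS => s sc; rewrite /tau /= chart_funK.
have [dpsi dE] := near_eq_diff nearE dcomp.
have vE : derive1 (psi \o c) t = 'd tau (phi (c t)) w.
  rewrite derive1E.
  transitivity ('d (psi \o c : R^o -> 'rV[R]_d) (t : R^o) (1 : R^o)).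
    exact: (deriveE (1 : R^o) dpsi).
  transitivity ('d (tau \o (phi \o c : R^o -> 'rV[R]_d)) (t : R^o) (1 : R^o)).
    exact: (congr1 (fun L : R^o -> 'rV[R]_d => L (1 : R^o)) dE).
  exact: (congr1 (fun L : R^o -> 'rV[R]_d => L (1 : R^o)) (diff_comp dphi dtau)).
rewrite vE; congr (Num.sqrt (_ 0 0)).
have spsi' : chart_source psi (chart_inv phi (phi (c t))) by rewrite chart_funK.
have tauE : tau (phi (c t)) = psi (c t) by rewrite /tau /= chart_funK.
pose u := phi (c t).
have mE : w *m metric g phi u *m w^T =
    'd tau u w *m metric g psi (tau u) *m ('d tau u w)^T.
  exact: (metric_transition w w aphi apsi (chart_fun_target sphi) spsi').
by rewrite mE /u tauE.
Qed.

Lemma speed_ge0 t : 0 <= speed g c t. Proof. exact: sqrtr_ge0. Qed.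

(** On [a, b] the speed is at least [lam] times the norm of the chart velocity, hence at least [lam]
    times the absolute derivative of one coordinate, whose integral dominates the increment of that
    coordinate. *)
Lemma curve_length_ge phi (a b lam : R) (i : 'I_d) : atlas g phi ->
  0 <= a -> a < b -> b <= 1 -> 0 < lam ->
  (forall t, a <= t <= b -> chart_source phi (c t)) ->
  (forall t, a <= t <= b -> forall w : 'rV[R]_d,
    (lam * `|w|) ^+ 2 <= (w *m metric g phi (phi (c t)) *m w^T) 0 0) ->
  ((lam * `|phi (c b) 0 i - phi (c a) 0 i|)%:E <=
    \int[@lebesgue_measure R]_(t in `[0%R, 1%R]) (speed g c t)%:E)%E.
Proof.
move=> aphi a0 ab b1 lam0 src low.
pose F (t : R) : R := phi (c t) 0 i.
pose D (t : R^o) : 'rV[R]_d := 'd (phi \o c : R^o -> 'rV[R]_d) (t : R^o) (1 : R^o).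
pose h (t : R) : R := D t 0 i.
have [dphi cD] := curve_chart_C1 aphi.
have hF t : a <= t <= b -> is_derive t 1 F (h t).
  move=> tab; have dt : differentiable (phi \o c : R^o -> 'rV[R]_d) (t : R^o).
    by apply: dphi; exact: src.
  have dFw : derivable (phi \o c : R^o -> 'rV[R]_d) (t : R^o) (1 : R^o).
    exact: diff_derivable.
  split; first by move/derivable_mxP : (dFw) => /(_ 0 i).
  by rewrite /h /D -deriveE// derive_mx// mxE.
have ch t : a <= t <= b -> {for t, continuous h}.
  move=> tab.
  apply: (@continuous_comp _ _ _ D (fun N : 'rV[R]_d => N 0 i)); last exact: coord_continuous.
  by apply: cD; exact: src.
have cF t : a <= t <= b -> {for t, continuous F}.
  move=> tab; apply: differentiable_continuous; apply/derivable1_diffP.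
  by have [] := hF t tab.
have wh : {within `[a, b], continuous h}.
  by apply: continuous_in_subspaceT => t /set_mem /=; rewrite in_itv/=; exact: ch.
have ftc : (\int[lebesgue_measure]_(t in `[a, b]) (h t)%:E = (F b)%:E - (F a)%:E)%E.
  apply: continuous_FTC2 => //.
    split.
    - move=> t; rewrite in_itv/= => /andP[at_ tb].
      by have [] := hF t; rewrite ?(ltW at_) ?(ltW tb).
    - by apply: cvg_at_right_filter; apply: cF; rewrite lexx ltW.
    - by apply: cvg_at_left_filter; apply: cF; rewrite lexx ltW.
  move=> t; rewrite in_itv/= => /andP[at_ tb]; rewrite derive1E.
  by have [] := hF t; rewrite ?(ltW at_) ?(ltW tb).
have mab : measurable (`[a, b]%classic : set R) by exact: measurable_itv.
have mh : measurable_fun (`[a, b]%classic : set R) (EFin \o h).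
  apply/measurable_EFinP; exact: subspace_continuous_measurable_fun.
have := @le_abse_integral _ _ _ lebesgue_measure _ _ mab mh.
rewrite /comp ftc => hle.
have lamE : (0 <= lam%:E)%E by rewrite lee_fin ltW.
rewrite EFinM; apply: (le_trans (lee_wpmul2l lamE hle)).
rewrite -ge0_integralZl//=; last first.
  by apply/measurable_EFinP; apply: measurableT_comp => //; exact/measurable_EFinP.
rewrite integral_mkcond [leRHS]integral_mkcond.
apply: ge0_le_integral_any => t.
  by rewrite patchE; case: ifP => // _; rewrite -EFinM lee_fin mulr_ge0// ltW.
rewrite !patchE; case: ifP => [|_]; last first.
  by case: ifP => // _; rewrite lee_fin speed_ge0.
move/set_mem; rewrite /= in_itv/= => /[dup] tab /andP[at_ tb].
have t01 : (t \in `[0, 1]%classic) = true.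
  by apply/mem_set; rewrite /= in_itv/= (le_trans a0 at_) (le_trans tb b1).
rewrite t01 -EFinM lee_fin (speedE aphi (src t tab)) -/(D t).
rewrite (@le_trans _ _ (lam * `|D t|))// ?ler_pM2l ?coord_norm_le//.
have lD : 0 <= lam * `|D t| by rewrite mulr_ge0// ltW.
rewrite -(ger0_norm lD) -sqrtr_sqr ler_sqrt; first exact: low.
exact: le_trans (sqr_ge0 _) (low t tab _).
Qed.

End curves.

Section riemannian_distance.
Context {R : realType} {d : nat} {M : topologicalType}.
Variable g : riemannian_manifold R d M.

(* A curve from outside [O] to a point close to [p] has, after its last visit
   to the complement of a coordinate ball around [p], to cross an annulus of
   that ball. *)
Lemma local_dist_lower_bound (p : M) (O : set M) : open O -> O p ->
  exists (W : set M) (eps : R), [/\ open W, W p, 0 < eps &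
    forall x y, ~ O x -> W y -> (eps%:E <= riemannian_dist g x y)%E].
Proof.
move=> oO Op; set phi := chart_at g p.
have aphi : atlas g phi by exact: chart_at_atlas.
have sp : chart_source phi p by exact: chart_at_source.
have tp : chart_target phi (phi p) by exact: chart_fun_target.
have cG i j : {for phi p, continuous (fun u => metric g phi u i j)}.
  apply: (@continuous_comp _ _ _ (metric g phi) (fun N : 'M[R]_d => N i j)).
    by have := metric_smooth aphi 0%N => /= /(_ _ tp)[+ _]; exact.
  exact: coord_continuous.
have [lam lam0 hlam] := near_posdef_norm_le cG (fun w => @metric_pos _ _ _ g _ _ w aphi tp).
have /nbhs_ballP[rho0 /= rho00 hrho] : nbhs (phi p) (fun u =>
    (forall w : 'rV[R]_d, (lam * `|w|) ^+ 2 <= (w *m metric g phi u *m w^T) 0 0) /\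
    (chart_target phi u /\ O (chart_inv phi u))).
  exact: filterI hlam (near_chart_inv sp oO Op).
pose rho := rho0 / 4; have rho_gt0 : 0 < rho by rewrite divr_gt0.
have rho4 : rho0 = 4 * rho by rewrite /rho mulrC divfK.
pose Om := [set x | chart_source phi x /\ `|phi p - phi x| < 4 * rho].
have ball4 u : `|phi p - u| < 4 * rho -> [/\ chart_target phi u, O (chart_inv phi u) &
    forall w : 'rV[R]_d, (lam * `|w|) ^+ 2 <= (w *m metric g phi u *m w^T) 0 0].
  move=> hu; have [] // := hrho u _; first by rewrite -ball_normE /= rho4.
  by move=> ? [].
have OmO x : Om x -> O x.
  by move=> [sx /ball4[_ + _]]; rewrite chart_funK.
pose K := chart_inv phi @` closed_ball_ (fun v : 'rV[R]_d => `|v|) (phi p) (3 * rho).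
have r34 : 3 * rho < 4 * rho by rewrite ltr_pM2r// ltr_nat.
have KE x : chart_source phi x -> `|phi p - phi x| <= 3 * rho -> K x.
  by move=> sx hx; exists (phi x); rewrite ?chart_funK.
have KOm x : K x -> Om x.
  move=> [u /= hu <-]; have hu4 : `|phi p - u| < 4 * rho by exact: le_lt_trans r34.
  by have [tu _ _] := ball4 u hu4; split; [exact: chart_inv_source|rewrite chart_invK].
have clK : closed K.
  apply: compact_closed; first exact: manifold_hausdorff g.
  apply: continuous_compact.
    apply: continuous_in_subspaceT => u /set_mem /= hu; apply: chart_inv_continuous.
    by have [] := ball4 u (le_lt_trans hu r34).
  apply: bounded_closed_compact; last exact: closed_closed_ball_.
  exists (`|phi p| + 3 * rho); split; first exact: num_real.
  move=> x hx u /= hu; apply/ltW/(le_lt_trans _ hx).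
  rewrite -[u](subrK (phi p)) addrC (le_trans (ler_normD _ _))// lerD2l distrC//.
have oOm : open Om.
  rewrite openE => x [sx hx].
  have n1 : \forall z \near x, chart_source phi z.
    by apply: open_near => //; exact: open_chart_source.
  have n2 : \forall u \near phi x, `|phi p - u| < 4 * rho.
    have : nbhs (phi x) (ball (phi p) (4 * rho)).
      by apply: open_near; [exact: ball_open|rewrite -ball_normE].
    by rewrite -ball_normE.
  have n3 : \forall z \near x, `|phi p - phi z| < 4 * rho.
    have cx : {for x, continuous phi} := chart_fun_continuous sx.
    exact: (cx _ n2).
  exact: filterI n1 n3.
pose W : set M := interior [set x | chart_source phi x /\ `|phi p - phi x| < 2 * rho].
exists W, (lam * rho); split.
- exact: open_interior.
- apply: filterI; first exact: open_near (open_chart_source _) sp.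
  by move/cvgrPdist_lt : (chart_fun_continuous sp); apply; rewrite mulr_gt0.
- by rewrite mulr_gt0.
move=> x y nOx /nbhs_singleton[/= sy hy].
apply: le_ereal_inf_tmp => l [c [cC c0 c1 ->]].
have cc : continuous c by case: cC.
pose S := [set t : R | `[0, 1]%classic t /\ ~ Om (c t)].
have cS : compact S.
  have S01 : S `<=` `[0, 1]%classic by move=> t [].
  apply: (subclosed_compact _ (@segment_compact R 0 1) S01).
  apply: closedI; first exact: itv_closed.
  rewrite -[X in closed X]/(~` (c @^-1` Om)); apply: open_closedC.
  by move/continuousP : cc; exact.
have S0 : S !=set0.
  exists 0; split; first by rewrite /= in_itv/= lexx ler01.
  by rewrite c0 => /OmO.
have cid : {within S, continuous (@id R)} by apply: continuous_subspaceT => ?; exact: cvg_id.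
(* [ts] is the last time spent outside [Om]; afterwards the curve stays in the chart. *)
have [ts /set_mem[/= ts01 nOts] tsmax] := compact_EVT_max S0 cS cid.
move: ts01; rewrite in_itv/= => /andP[ts0 ts1].
have Omy : Om y by split => //; rewrite (lt_trans hy)// ltr_pM2r// ltr_nat.
have tslt1 : ts < 1.
  by rewrite lt_neqAle ts1 andbT; apply/eqP => e; apply: nOts; rewrite e c1.
have after t : ts < t <= 1 -> Om (c t).
  move=> /andP[tst t1]; apply: contrapT => nOt.
  have := tsmax t; rewrite leNgt tst => /(_ _)/negP; apply => //; apply/mem_set; split => //.
  by rewrite /= in_itv/= t1 (le_trans ts0)// ltW.
(* Just after [ts] the curve lies in [Om] but outside [K], so at distance more than 3 rho from the
   centre, while its endpoint is within 2 rho. Some coordinate therefore varies by more than rho. *)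
have nKts : \forall t \near ts, (~` K) (c t).
  apply: cc; apply: open_near; first exact: closed_openC.
  by move=> /KOm.
have [t /andP[tst t1] nKt] : exists2 t, ts < t < 1 & ~ K (c t).
  have n1 : \forall t \near ts^'+, ts < t < 1.
    by near=> t; apply/andP; split; near: t; [exact: nbhs_right_gt|exact: nbhs_right_lt].
  have n2 : \forall t \near ts^'+, (~` K) (c t) by exact: cvg_within nKts.
  by have [t []] := filter_ex (filterI n1 n2); exists t.
have Omt s : t <= s <= 1 -> Om (c s).
  by move=> /andP[ts' s1]; apply: after; rewrite s1 (lt_le_trans tst).
have [st ht] : Om (c t) by apply: Omt; rewrite lexx ltW.
have far : 3 * rho < `|phi p - phi (c t)|.
  by rewrite ltNge; apply/negP => /(KE _ st).
have [i hi] : exists i : 'I_d, rho < `|phi (c 1) 0 i - phi (c t) 0 i|.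
  apply: contrapT => nh.
  have : `|phi (c 1) - phi (c t)| <= rho.
    apply: row_norm_le; first exact: ltW.
    move=> i; rewrite leNgt !mxE; apply/negP => hi; apply: nh; by exists i.
  have := ler_distD (phi (c 1)) (phi p) (phi (c t)); rewrite c1.
  move: far hy; lra.
apply: (@le_trans _ _ (lam * `|phi (c 1) 0 i - phi (c t) 0 i|)%:E).
  by rewrite lee_fin ler_pM2l// ltW.
apply: curve_length_ge => //.
- by rewrite (le_trans ts0)// ltW.
- by move=> s /Omt[].
- by move=> s /Omt[_ /ball4[]].
Unshelve. all: by end_near.
Qed.

End riemannian_distance.

Section compact_distance.
Context {R : realType} {d : nat} {M : ptopologicalType}.
Variable g : riemannian_manifold R d M.

Lemma compact_dist_lower_bound (K O : set M) : compact K -> open O -> K `<=` O ->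
  exists2 eps : R, 0 < eps &
    forall x, ~ O x -> (eps%:E <= dist_to_set g x K)%E.
Proof.
move=> cK oO KO.
have loc (p : M) : exists We : set M * R, O p -> [/\ open We.1, We.1 p, 0 < We.2 &
    forall x y, ~ O x -> We.1 y -> (We.2%:E <= riemannian_dist g x y)%E].
  have [Op|nOp] := pselect (O p); last by exists (set0, 0).
  by have [W [e h]] := local_dist_lower_bound g oO Op; exists (W, e).
have /choice[W hW] := loc.
have : cover_compact K by rewrite -compact_cover.
move=> /(_ M [set p | O p] (fun p => (W p).1)) [|p Kp|P PO cov].
- by move=> p /hW[].
- by exists p; [exact: KO|have [] := hW p (KO p Kp)].
exists (\big[Num.min/1]_(p <- finmap.enum_fset P) (W p).2).
  rewrite big_seq; apply: (big_ind (fun e : R => 0 < e)) => //.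
    by move=> a b a0 b0; rewrite lt_min a0.
  by move=> p pP; have [] // := hW p; apply/set_mem/PO.
move=> x nOx; apply: le_ereal_inf_tmp => _ [y Ky <-].
have [p /= pP Wy] := cov y Ky.
have [_ _ _ h] : [/\ open (W p).1, (W p).1 p, 0 < (W p).2 &
    forall x y, ~ O x -> (W p).1 y -> ((W p).2%:E <= riemannian_dist g x y)%E].
  by apply: hW; apply/set_mem/PO.
apply: le_trans (h x y nOx Wy); rewrite lee_fin.
exact: ge_bigmin_seq.
Qed.

(** A point of [V m] outside [O] would have distance at least [eps] to [K], and the Hausdorff
    distance would be at least [eps] as well. *)
Lemma near_subset_of_hausdorff_cvg (V : nat -> set M) (K O : set M) :
  compact K -> open O -> K `<=` O ->
  hausdorff_dist g (V m) K @[m --> \oo] --> 0%E ->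
  \forall m \near \oo, V m `<=` O.
Proof.
move=> cK oO KO cvgV; have [eps eps0 heps] := compact_dist_lower_bound cK oO KO.
have h : \forall m \near \oo, (hausdorff_dist g (V m) K < eps%:E)%E.
  by apply: (cvgV [set z | (z < eps%:E)%E]); apply: (@open_ereal_lt' R 0%E); rewrite lte_fin.
apply: filterS h => m hm x Vx; apply: contrapT => nOx.
have := le_lt_trans (heps x nOx) _ => /(_ eps%:E); rewrite ltxx => /(_ _)/notF; apply.
apply: le_lt_trans hm; rewrite /hausdorff_dist le_max; apply/orP; left.
by apply: ereal_sup_ubound; right; exists x.
Qed.

End compact_distance.

(** * The uniform tail estimate *)

Lemma neg_lne_ge0 {R : realType} (t : R) : t < 2^-1 -> (0 <= - lne t%:E)%E.
Proof.
move=> t2; rewrite oppe_ge0 lne_le0 lee_fin (le_trans (ltW t2))//.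
by rewrite invf_le1 ?ler1n.
Qed.

Section logarithmic_integrals.
Context {R : realType} {M : ptopologicalType}.
Variable J : M -> R.
Hypothesis J_continuous : continuous J.
Variable nu : probability (borel M) R.

Let mJ : measurable_fun [set: borel M] (J : borel M -> R).
Proof. exact: continuous_borel_real. Qed.

(** Where J < 1/2 the logarithm has a constant sign, so the absolute value in the definition of
    [P_eta] hides no cancellation. *)
Lemma abs_integral_lne (U : set M) : U `<=` [set x | J x < 2^-1] ->
  (`| \int[nu]_(x in U) lne (J x)%:E | = \int[nu]_(x in U) (- lne (J x)%:E))%E.
Proof.
move=> UJ.
have L0 (x : borel M) : U x -> (0 <= - lne (J x)%:E)%E.
  by move=> /UJ; exact: neg_lne_ge0.
have -> : (\int[nu]_(x in U) lne (J x)%:E = - \int[nu]_(x in U) (- lne (J x)%:E))%E.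
  by rewrite -integral_ge0N//; apply: eq_integral => x _; rewrite oppeK.
by rewrite abseN gee0_abs// integral_ge0.
Qed.

Lemma measurable_neg_lne :
  measurable_fun [set: borel M] (fun x : borel M => - lne (J x)%:E)%E.
Proof.
have -> : (fun x : borel M => - lne (J x)%:E)%E =
    (fun x : borel M => if J x <= 0 then +oo%E else (- ln (J x))%:E).
  by apply/funext => x /=; case: ifP.
apply: measurable_fun_ifT => //=.
  exact: measurable_fun_ler.
by apply/measurable_EFinP; apply: measurableT_comp => //; exact: measurableT_comp.
Qed.

(** As [lne 0] is -oo, a positive mass on the degenerate set would make the integral over [U]
    infinite. *)
Lemma abs_integral_lne_null (U : set M) (e : R) : open U ->
  [set x | J x = 0] `<=` U -> U `<=` [set x | J x < 2^-1] ->
  (`| \int[nu]_(x in U) lne (J x)%:E | <= e%:E)%E ->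
  nu [set x | J x = 0] = 0%E.
Proof.
move=> oU ZU UJ; rewrite abs_integral_lne// => le_e.
have mZ : measurable ([set x | J x = 0] : set (borel M)).
  have -> : [set x | J x = 0] = J @^-1` [set 0] by [].
  by rewrite -[X in measurable X]setTI; exact: mJ.
have mU : measurable (U : set (borel M)) by exact: open_borel.
have L0 (x : borel M) : U x -> (0 <= - lne (J x)%:E)%E.
  by move=> /UJ; exact: neg_lne_ge0.
have := ge0_subset_integral nu mZ mU (measurable_funTS measurable_neg_lne) L0 ZU.
have -> : (\int[nu]_(x in [set x | J x = 0%R]) (- lne (J x)%:E) = +oo * nu [set x | J x = 0%R])%E.
  rewrite -integral_cst//; apply: eq_integral => x /set_mem /= Jx.
  by rewrite Jx lexx.
move=> /le_trans/(_ le_e) h; apply/eqP; apply: contraT => nuZ.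
by move: h; rewrite gt0_mulye ?leye_eq// lt_def nuZ measure_ge0.
Qed.

End logarithmic_integrals.

Section uniform_tail.
Context {R : realType} {M : ptopologicalType}.
Hypothesis M_compact : compact [set: M].
Variable J : M -> R.
Hypothesis J_continuous : continuous J.
Hypothesis J_ge0 : forall x, 0 <= J x.
Variable V : nat -> set M.
Hypothesis V_open : forall m, open (V m).
Hypothesis V_nbhd : forall m, [set x | J x = 0] `<=` V m.
Hypothesis V_small : forall delta : R, 0 < delta ->
  \forall m \near \oo, V m `<=` [set x | J x < delta].

Lemma small_values_subset (U : set M) : open U -> [set x | J x = 0] `<=` U ->
  exists2 delta : R, 0 < delta <= 2^-1 & [set x | J x < delta] `<=` U.
Proof.
move=> oU ZU.
have h2 : 0 < 2^-1 :> R by rewrite invr_gt0.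
have cU : compact (~` U).
  by apply: (@subclosed_compact _ _ setT) => //; exact: open_closedC.
have [[x0 Ux0]|ne] := pselect ((~` U) !=set0); last first.
  by exists 2^-1; rewrite ?h2//= => x _; apply: contrapT => Ux; apply: ne; exists x.
have [||z /set_mem/= Uz zmin] := @compact_EVT_min M R J (~` U) _ cU.
- by exists x0.
- exact: continuous_subspaceT.
have Jz : 0 < J z.
  by rewrite lt_def J_ge0 andbT; apply/eqP => /ZU.
exists (Num.min (J z) 2^-1); first by rewrite lt_min Jz h2 ge_min lexx orbT.
move=> x /=; rewrite lt_min => /andP[xz _]; apply: contrapT => Ux.
by move: xz; rewrite ltNge zmin//; exact/mem_set.
Qed.

Lemma uniform_log_tail (eta : nat -> R) (kappa : R) :
  eta m @[m --> \oo] --> 0 -> 0 < kappa ->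
  exists2 delta : R, 0 < delta <= 1 & forall nu : probability (borel M) R,
    (forall m, `| \int[nu]_(x in V m) lne (J x)%:E | <= (eta m)%:E)%E ->
    (\int[nu]_(x in [set x | (J x < delta)%R]) (- ln (J x))%:E <= kappa%:E)%E.
Proof.
move=> cvg_eta kappa0.
have h2 : 0 < 2^-1 :> R by rewrite invr_gt0.
have eta_small : \forall m \near \oo, eta m <= kappa.
  move/cvgrPdist_le : cvg_eta => /(_ _ kappa0); apply: filterS => m.
  by rewrite sub0r normrN; exact/le_trans/ler_norm.
(* A single index [m], and hence a single [delta], serves for all [nu]. *)
have [m [etam Vm]] := filter_ex (filterI eta_small (V_small h2)).
have [delta /andP[d0 d2] dV] := small_values_subset (V_open m) (@V_nbhd m).
exists delta; first by rewrite d0 (le_trans d2)// invf_le1 ?ler1n.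
move=> nu /(_ m) Pnu; apply: (@le_trans _ _ (eta m)%:E); last by rewrite lee_fin.
apply: le_trans Pnu; rewrite abs_integral_lne//.
rewrite integral_mkcond [leRHS]integral_mkcond.
have L0 x : V m x -> (0 <= - lne (J x)%:E)%E.
  by move=> /Vm; exact: neg_lne_ge0.
have ln0 x : V m x -> 0 <= - ln (J x).
  move=> /Vm /= Jx; rewrite oppr_ge0; apply: ln_le0; apply: (le_trans (ltW Jx)).
  by rewrite invf_le1 ?ler1n.
apply: ge0_le_integral_any => x; rewrite !patchE.
  by case: ifPn => // /set_mem /dV /ln0; rewrite lee_fin.
case: ifPn => [/set_mem /dV Vx|_]; last first.
  by case: ifPn => // /set_mem /L0.
(* Where J = 0 the real [ln] takes its default value, whereas [- lne] is +oo; the comparison goes in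
   the right direction. *)
rewrite (mem_set Vx) /=; case: ifPn => [_|]; first by rewrite leey.
by rewrite -ltNge => _; rewrite lexx.
Qed.

End uniform_tail.

Theorem theorem1p1 (R : realType) (d : nat) (M : ptopologicalType)
    (g : riemannian_manifold R d M) (M_compact : compact [set: M])
    (r : R) (r_gt1 : 1 < r) (f : M -> M) (f_Cr : Cr_map g r f)
    (V : nat -> set M)
    (V_open : forall m, open (V m))
    (V_nbhd : forall m, degenerate_set g f `<=` V m)
    (V_decr : forall m, V m.+1 `<=` V m)
    (V_cvg : hausdorff_dist g (V m) (degenerate_set g f) @[m --> \oo] --> 0%E)
    (eta : nat -> R)
    (eta_gt0 : forall m, 0 < eta m)
    (eta_cvg : eta m @[m --> \oo] --> 0) :
  upper_semicontinuous_on (P_eta g f V eta)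
    (folding_entropy f : prob_space R M -> \bar R).
Proof.
have f_cont : continuous f by case: f_Cr.
have M_hausdorff := manifold_hausdorff g.
have M_countable := manifold_second_countable g.
have J_cont : continuous (abs_jac g f) by exact: (continuous_abs_jac f_cont r_gt1 f_Cr).
have J_ge0 x : 0 <= abs_jac g f x by exact: abs_jac_ge0.
have [N [C0 fiber_sum]] := fiber_sum_bounded M_compact r_gt1 f_Cr.
have loc_inj x : (~` degenerate_set g f) x ->
    exists U : set M, [/\ open U, U x & {in U &, injective f}].
  by move=> /eqP; exact: (locally_injective_off_degenerate r_gt1 f_Cr).
have Z_compact : compact (degenerate_set g f).
  apply: (@subclosed_compact _ _ setT) => //.
  have -> : degenerate_set g f = abs_jac g f @^-1` [set 0] by [].
  by move/continuous_closedP : J_cont; apply; exact: closed_eq.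
have V_small (delta : R) : 0 < delta ->
    \forall m \near \oo, V m `<=` [set x | abs_jac g f x < delta].
  move=> delta0; apply: (near_subset_of_hausdorff_cvg Z_compact _ _ V_cvg).
    by move/continuousP : J_cont => /(_ [set t | t < delta]); apply; exact: open_lt.
  by move=> x /= ->.
have h2 : 0 < 2^-1 :> R by rewrite invr_gt0.
have null (nu : probability (borel M) R) : P_eta g f V eta nu ->
    nu (degenerate_set g f) = 0%E.
  have [m Vm] := filter_ex (V_small _ h2).
  by move=> /(_ m); exact: abs_integral_lne_null.
apply: (@folding_entropy_usc R M M_compact M_hausdorff M_countable f f_cont
  (abs_jac g f) J_cont J_ge0 N C0 fiber_sum loc_inj) => //.
  move=> kappa kappa0.
  exact: (uniform_log_tail M_compact J_cont J_ge0 V_open V_nbhd V_small eta_cvg kappa0).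
move=> nu Pnu.
(* Since [nu] does not charge the degenerate set, the closed injective pieces carry all of its mass,
   and the conditional measures can be built from them. *)
have [C [U [clC _ CU injU ZC]]] :=
  injective_closed_cover M_compact M_hausdorff M_countable loc_inj.
apply: (@disintegration_exists R M M_compact M_hausdorff f f_cont C clC _ nu).
  by move=> n x y /CU Ux /CU Uy; exact: injU Ux Uy.
apply/eqP; rewrite -measure_le0 -(null nu Pnu); apply: le_measure; rewrite ?inE.
- apply: measurableC; apply: bigcupT_measurable => n; exact: closed_borel.
- by apply: closed_borel; exact: compact_closed.
by move=> x nCx; apply: contrapT => /ZC.
Qed.
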